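(* Let $n\geq 1$ and $r\leq n$, and let $X_1,\dots,X_r$ be the vector fields on $\mathbb{R}^{2n}$ described in the context (the Hamiltonian vector fields of a Williamson basis $q_1,\dots,q_r$ of a Cartan subalgebra of $\mathfrak{sp}(2r,\mathbb{R})\subset\mathfrak{sp}(2n,\mathbb{R})$). Let $g_1,\dots,g_r$ be germs at $0$ of smooth real functions on $\mathbb{R}^{2n}$ such that $$X_i(g_j)=X_j(g_i)\qquad\text{for all } i,j\in\{1,\dots,r\}.$$ Then there exist a germ of smooth function $G$ and $r$ germs of smooth functions $f_1,\dots,f_r$ at $0$ such that (1) $X_j(f_i)=0$ for all $i,j\in\{1,\dots,r\}$, and (2) $g_i=f_i+X_i(G)$ for all $i\in\{1,\dots,r\}$.
   Context: Coordinates on $\mathbb{R}^{2n}$ are $(x_1,y_1,\dots,x_n,y_n)$ with symplectic form $\omega=\sum_{i=1}^n dx_i\wedge dy_i$. Fix integers $k_e,k_h,k_f\geq 0$ with $r=k_e+k_h+2k_f\leq n$. The quadratic functions $q_1,\dots,q_r$ are: $q_i=x_i^2+y_i^2$ for $1\le i\le k_e$ (elliptic); $q_i=x_iy_i$ for $k_e+1\le i\le k_e+k_h$ (hyperbolic); and for $i=k_e+k_h+2j-1$, $1\le j\le k_f$, the focus-focus pair $q_i=x_iy_i+x_{i+1}y_{i+1}$, $q_{i+1}=x_iy_{i+1}-x_{i+1}y_i$. $X_i$ denotes the Hamiltonian vector field of $q_i$; explicitly: for elliptic $i$, $X_i=2(-y_i\partial_{x_i}+x_i\partial_{y_i})$;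 for hyperbolic $i$, $X_i=-x_i\partial_{x_i}+y_i\partial_{y_i}$; for a focus-focus pair $(i,i+1)$, $X_i=-x_i\partial_{x_i}+y_i\partial_{y_i}-x_{i+1}\partial_{x_{i+1}}+y_{i+1}\partial_{y_{i+1}}$ and $X_{i+1}=-x_i\partial_{x_{i+1}}+y_{i+1}\partial_{y_i}+x_{i+1}\partial_{x_i}-y_i\partial_{y_{i+1}}$. (By Williamson's theorem, every Cartan subalgebra of the algebra of quadratic forms on $\mathbb{R}^{2r}$ has such a basis in suitable symplectic coordinates.) All objects are $C^\infty$. *)

(* Defs.v *)
From HB Require Import structures.
From mathcomp Require Import all_boot all_order all_algebra.
From mathcomp Require Import all_classical all_reals all_analysis.
Set Implicit Arguments. Unset Strict Implicit. Unset Printing Implicit Defensive.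
Import Order.TTheory GRing.Theory Num.Theory.
Import numFieldNormedType.Exports.
Local Open Scope classical_set_scope.
Local Open Scope ring_scope.

Section Defs.
Variables (R : realType) (n : nat).
Notation V := 'rV[R]_(n + n).

(* coordinates indexed by nat (0 outside range; never used out of range) *)
Definition xc (p : V) (k : nat) : R :=
  if insub k is Some i then p 0 (lshift n (i : 'I_n)) else 0.
Definition yc (p : V) (k : nat) : R :=
  if insub k is Some i then p 0 (rshift n (i : 'I_n)) else 0.
Definition ex (k : nat) : V :=
  if insub k is Some i then delta_mx 0 (lshift n (i : 'I_n)) else 0.
Definition ey (k : nat) : V :=
  if insub k is Some i then delta_mx 0 (rshift n (i : 'I_n)) else 0.

(* The vector fields X_i (0-based index i, 0 <= i < ke+kh+2kf). *)
Definition Xfield (ke kh kf : nat) (i : nat) (p : V) : V :=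
  if (i < ke)%N then
    2 *: ((- yc p i) *: ex i + xc p i *: ey i)
  else if (i < ke + kh)%N then
    (- xc p i) *: ex i + yc p i *: ey i
  else if ~~ odd (i - (ke + kh)) then
    (* first member of a focus-focus pair (i, i+1) *)
    (- xc p i) *: ex i + yc p i *: ey i
    + (- xc p i.+1) *: ex i.+1 + yc p i.+1 *: ey i.+1
  else
    (* second member of the pair (a, a+1) with a = i - 1 *)
    let a := i.-1 in
    (- xc p a) *: ex i + yc p i *: ey a + xc p i *: ex a - yc p a *: ey i.

Definition vfapp (X : V -> V) (h : V -> R) : V -> R :=
  fun p => derive h p (X p).

Fixpoint iterD (vs : seq V) (f : V -> R) : V -> R :=
  if vs is v :: vs' then (fun p => derive (iterD vs' f) p v) else f.

Definition smooth_on (U : set V) (f : V -> R) : Prop :=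
  forall (vs : seq V) (p : V), U p ->
    (forall v : V, derivable (iterD vs f) p v) /\ {for p, continuous (iterD vs f)}.

Definition smooth_germ (f : V -> R) : Prop :=
  exists U : set V, [/\ open U, U 0 & smooth_on U f].

End Defs.

(* Main.v *)
(** The fields are linear and commute, so the indices can be treated one at a
    time.  Suppose [g_i = f_i + X_i G] with [f_i] killed by every field has been
    achieved for the indices [i] in [D].  For a new index [i] the germ
    [g_i - X_i G] is killed by [X_j], [j] in [D], and it remains to split it as
    [f + X_i H] with [f] killed by every field and [H] killed by [X_j], [j] in
    [D]; then [G + H] works for [D + i].

    - Elliptic fields and the second fields of the focus-focus pairs generate
      periodic flows [R_s]; take for [f] the mean of [g] along the flow and for
      [H] the mean of [s * g (R_s p)].
    - A hyperbolic field is [E_y - E_x], where [E_x], [E_y] are Euler fields in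
      complementary groups of variables; the first field of a focus-focus pair
      has the same form.  Let [h_a] be the Taylor part of [g] of degree [a] in
      [x], [v_a] the part of [h_a] of degree [a] in [y].  Then
      [h_a = v_a + X K_a] for explicit [K_a], and Borel summation of the [v_a]
      and [K_a] gives [f] with [X f = 0] and [K] such that [g - f - X K] is flat
      along [x = 0].  A flat [r] with bounded support in [y] is [X H] for
      [H p = - int_0^1 r (s x, y / s) ds / s].
    - For a focus-focus pair, [f] and [H] are finally averaged along the
      rotation of the pair. *)
Require Import Defs.
From HB Require Import structures.
From mathcomp Require Import all_boot all_order all_algebra.
From mathcomp Require Import all_classical all_reals all_analysis.
From mathcomp Require Import zify ring lra.
Import Order.TTheory GRing.Theory Num.Theory.
Import numFieldNormedType.Exports.
Local Open Scope classical_set_scope.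
Local Open Scope ring_scope.
Set Implicit Arguments. Unset Strict Implicit. Unset Printing Implicit Defensive.

(** * Smooth functions and directional derivatives *)

(** The relations hold only near 0 while the constructions are global, and this shapes the proof.
    The germs are replaced by global smooth functions. A Borel sum then needs infinitely many Taylor
    parts to vanish on one common ball, so the hyperbolic step records vanishing on balls of the sup
    norm, which scalings by [s] in [0, 1] respect. The flat primitive also stretches [y] to [y / s];
    the bounded support in [y] keeps the points that matter inside the ball.

    In the splitting, [f] must be killed by every field, also by those treated later. This rests on
    [X_j g = X_i u] near 0, inherited from the compatibility condition: [f] arises from [g] by
    operators that commute with [X_j] and annihilate every [X_i u].

    The hyperbolic splitting is controlled only for fields that do not involve its own variables, so
    it says nothing about the rotation of a focus-focus pair. The rotating fields are therefore
    placed first: when the first field of the pair comes, [g] is already invariant under the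
    rotation, and averaging leaves the splitting of [g] intact. *)

Definition dd {R : realType} {N : nat} (v : 'rV[R]_N) (f : 'rV[R]_N -> R)
  (p : 'rV[R]_N) : R := 'D_v f p.

Section Ck.
Context {R : realType} {N : nat}.
Notation V := 'rV[R]_N.
Implicit Types (U W : set V) (f g : V -> R) (p q v w : V).

(** Derivatives are those of the whole space along fixed vectors, as in [smooth_on]; [U] only
    selects the points where the conditions are imposed. Linearity in the vector is derived later,
    in [derive_addv]. *)
Fixpoint Ck U k f : Prop :=
  (forall p, U p -> {for p, continuous f}) /\
  if k is k'.+1 then
    forall v, (forall p, U p -> derivable f p v) /\ Ck U k' (dd v f)
  else True.

Lemma Ck_continuous {U k f p} : Ck U k f -> U p -> {for p, continuous f}.
Proof. by case: k => [|k] [cf _]; exact: cf. Qed.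

Lemma CkS {U k f} : Ck U k.+1 f -> Ck U k f.
Proof.
elim: k f => [|k IH] f [cf df]; split=> // v.
by have [? ?] := df v; split=> //; exact: IH.
Qed.

Lemma Ck_sub U W k f : W `<=` U -> Ck U k f -> Ck W k f.
Proof.
move=> WU; elim: k f => [|k IH] f [cf df].
  by split=> // p /WU; exact: cf.
split=> [p /WU|v]; first exact: cf.
by have [d1 d2] := df v; split=> [p /WU|]; [exact: d1|exact: IH].
Qed.

(** Derivatives are ambient, so the conditions at a point can be read off from any [W] containing
    it. This glues the two regions of a cutoff in [smooth_germ_extend]. *)
Lemma Ck_local U k f :
  (forall p, U p -> exists2 W, W p & Ck W k f) -> Ck U k f.
Proof.
elim: k f => [|k IH] f Uf.
  by split=> // p /Uf[W Wp Wf]; exact: (Ck_continuous Wf).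
split=> [p /Uf[W Wp Wf]|v]; first exact: (Ck_continuous Wf).
split=> [p /Uf[W Wp [_ /(_ v)[df _]]]|]; first exact: df.
by apply: IH => p /Uf[W Wp [_ /(_ v)[_ df]]]; exists W.
Qed.

Lemma open_near_eq U f g : open U -> {in U, f =1 g} ->
  forall p, U p -> \near p, f p = g p.
Proof.
move=> oU fg p Up; near=> q; apply: fg; rewrite inE; near: q.
exact: open_nbhs_nbhs.
Unshelve. all: by end_near. Qed.

Lemma derive_in_open U f g v : open U -> {in U, f =1 g} ->
  {in U, dd v f =1 dd v g}.
Proof.
by move=> oU fg p; rewrite inE => Up; apply: near_eq_derive; exact: open_near_eq Up.
Qed.

Lemma continuous_near f g p : (\near p, f p = g p) ->
  {for p, continuous f} -> {for p, continuous g}.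
Proof.
move=> nfg cf; rewrite /prop_for /continuous_at -(nbhs_singleton nfg).
apply: cvg_trans cf; apply: (@near_eq_cvg _ _ (nbhs p)).
by apply: filterS nfg => q ->.
Qed.

Lemma Ck_eq U k f g : open U -> {in U, f =1 g} -> Ck U k f -> Ck U k g.
Proof.
move=> oU; elim: k f g => [|k IH] f g fg [cf df].
  by split=> // p Up; apply: continuous_near (cf p Up); exact: open_near_eq Up.
split=> [p Up|v]; first by apply: continuous_near (cf p Up); exact: open_near_eq Up.
have [d1 d2] := df v; split=> [p Up|].
  by apply: near_eq_derivable (d1 p Up); exact: open_near_eq Up.
by apply: IH d2; exact: derive_in_open.
Qed.

Lemma Ck_cst U k (c : R) : Ck U k (cst c).
Proof.
elim: k c => [|k IH] c; first by split=> // p _; exact: cst_continuous.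
split=> [p _|v]; first exact: cst_continuous.
split=> [p _|]; first exact: derivable_cst.
rewrite (_ : dd v _ = cst 0); first exact: IH.
by apply/funext => p; exact: derive_cst.
Qed.

Lemma CkD U k f g : open U -> Ck U k f -> Ck U k g -> Ck U k (f + g).
Proof.
move=> oU; elim: k f g => [|k IH] f g [cf df] [cg dg].
  by split=> // p Up; apply: continuousD; [exact: cf|exact: cg].
split=> [p Up|v]; first by apply: continuousD; [exact: cf|exact: cg].
have [d1 d2] := df v; have [d3 d4] := dg v; split=> [p Up|].
  by apply: derivableD; [exact: d1|exact: d3].
apply: (@Ck_eq _ _ (dd v f + dd v g)); [by []| |exact: IH].
by move=> p /set_mem Up /=; rewrite /dd deriveD//; [exact: d1|exact: d3].
Qed.

Lemma CkM U k f g : open U -> Ck U k f -> Ck U k g -> Ck U k (f * g).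
Proof.
move=> oU; elim: k f g => [|k IH] f g Cf Cg.
  case: Cf Cg => [cf _] [cg _].
  by split=> // p Up; apply: continuousM; [exact: cf|exact: cg].
case: (Cf) (Cg) => [cf df] [cg dg].
split=> [p Up|v]; first by apply: continuousM; [exact: cf|exact: cg].
have [d1 d2] := df v; have [d3 d4] := dg v; split=> [p Up|].
  by apply: derivableM; [exact: d1|exact: d3].
apply: (@Ck_eq _ _ (f * dd v g + g * dd v f)); [by []| |].
  by move=> p /set_mem Up /=; rewrite /dd deriveM//; [exact: d1|exact: d3].
by apply: CkD => //; apply: IH => //; exact: CkS.
Qed.

End Ck.

Section smooth.
Context {R : realType} {N : nat}.
Notation V := 'rV[R]_N.
Implicit Types (U W : set V) (f g : V -> R) (p q v w : V).

Definition smooth f := forall k, Ck setT k f.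

Lemma smooth_continuous f : smooth f -> continuous f.
Proof. by move=> sf p; exact: Ck_continuous (sf 0%N) I. Qed.

Lemma smooth_derivable f p v : smooth f -> derivable f p v.
Proof. by move=> /(_ 1%N)[_ /(_ v)[+ _]]; exact. Qed.

Lemma smooth_D f v : smooth f -> smooth (dd v f).
Proof. by move=> sf k; have [_ /(_ v)[_]] := sf k.+1. Qed.

(** Coinduction principle for smoothness: most later proofs name a class [C] closed under [dd]
    instead of repeating the induction on the order. *)
Lemma smoothP (C : (V -> R) -> Prop) : (forall f, C f -> continuous f) ->
  (forall f v, C f -> (forall p, derivable f p v) /\ C (dd v f)) ->
  forall f, C f -> smooth f.
Proof.
move=> Cc Cd f Cf k; elim: k f Cf => [|k IH] f Cf.
  by split=> // p _; exact: Cc.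
split=> [p _|v]; first exact: Cc.
by have [d1 d2] := Cd f v Cf; split=> [p _|]; [exact: d1|exact: IH].
Qed.

Lemma smooth_cst (c : R) : smooth (fun=> c).
Proof. by move=> k; exact: Ck_cst. Qed.

Lemma smooth_add f g : smooth f -> smooth g -> smooth (fun p => f p + g p).
Proof. by move=> sf sg k; apply: CkD; [exact: openT|exact: sf|exact: sg]. Qed.

Lemma smooth_mul f g : smooth f -> smooth g -> smooth (fun p => f p * g p).
Proof. by move=> sf sg k; apply: CkM; [exact: openT|exact: sf|exact: sg]. Qed.

Lemma smooth_opp f : smooth f -> smooth (fun p => - f p).
Proof.
move=> sf; rewrite (_ : (fun p => _) = (fun p => -1 * f p)).
  exact: smooth_mul (smooth_cst _) sf.
by apply/funext => p; rewrite mulN1r.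
Qed.

Lemma smooth_sub f g : smooth f -> smooth g -> smooth (fun p => f p - g p).
Proof. by move=> sf sg; apply: smooth_add => //; exact: smooth_opp. Qed.

Lemma smooth_sum (I : Type) (r : seq I) (P : pred I) (F : I -> V -> R) :
  (forall i, P i -> smooth (F i)) -> smooth (fun p => \sum_(i <- r | P i) F i p).
Proof.
move=> sF; elim: r => [|i r IH].
  by under eq_fun do rewrite big_nil; exact: smooth_cst.
under eq_fun do rewrite big_cons; case: (boolP (P i)) => // Pi.
by apply: smooth_add => //; exact: sF.
Qed.

Lemma smooth_exp f k : smooth f -> smooth (fun p => f p ^+ k).
Proof.
move=> sf; elim: k => [|k IH]; first exact: smooth_cst.
by under eq_fun do rewrite exprS; exact: smooth_mul.
Qed.

Lemma derive_cst0 (c : R) p v : dd v (fun=> c) p = 0.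
Proof. exact: derive_cst. Qed.

Lemma derive_add f g p v : smooth f -> smooth g ->
  dd v (fun p => f p + g p) p = dd v f p + dd v g p.
Proof. by move=> sf sg; apply: deriveD; exact: smooth_derivable. Qed.

Lemma derive_mul f g p v : smooth f -> smooth g ->
  dd v (fun p => f p * g p) p = f p * dd v g p + g p * dd v f p.
Proof. by move=> sf sg; apply: deriveM; exact: smooth_derivable. Qed.

Lemma derive_cmul (c : R) f p v : smooth f ->
  dd v (fun p => c * f p) p = c * dd v f p.
Proof.
move=> sf; rewrite derive_mul//; last exact: smooth_cst.
by rewrite derive_cst0 mulr0 addr0.
Qed.

Lemma derive_sub f g p v : smooth f -> smooth g ->
  dd v (fun p => f p - g p) p = dd v f p - dd v g p.
Proof. by move=> sf sg; apply: deriveB; exact: smooth_derivable. Qed.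

Lemma derive_bigsum (I : Type) (r : seq I) (P : pred I) (F : I -> V -> R) p v :
  (forall i, P i -> smooth (F i)) ->
  dd v (fun p => \sum_(i <- r | P i) F i p) p = \sum_(i <- r | P i) dd v (F i) p.
Proof.
move=> sF; elim: r => [|i r IH].
  under eq_fun do rewrite big_nil.
  by rewrite derive_cst0 big_nil.
under eq_fun do rewrite big_cons; rewrite big_cons; case: ifPn => // Pi.
by rewrite derive_add ?IH//; [exact: sF|exact: smooth_sum].
Qed.

Lemma derive_lin_comp (S : V -> V) f p v : linear S ->
  dd v (fun q => f (S q)) p = dd (S v) f (S p).
Proof.
by move=> lS; rewrite /dd /derive; do 2 f_equal; apply/funext => h /=; rewrite lS.
Qed.

Lemma derivable_lin_comp (S : V -> V) f p v : linear S ->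
  derivable f (S p) (S v) -> derivable (fun q => f (S q)) p v.
Proof.
move=> lS; rewrite /derivable (_ : (fun h => h^-1 *: ((f \o shift (S p)) (h *: S v) - f (S p))) =
  (fun h => h^-1 *: (((fun q => f (S q)) \o shift p) (h *: v) - f (S p)))) //.
by apply/funext => h /=; rewrite lS.
Qed.

Lemma cvg_row (T : Type) (F : set_system T) {FF : Filter F} (G : T -> V) p :
  (forall i, (fun t => G t 0 i) @ F --> p 0 i) -> G @ F --> p.
Proof.
move=> Gp; apply/cvg_mx_entourageP => A entA; rewrite near_simpl.
apply: filter_forall => i; apply: filter_forall => j.
have /cvg_entourageP /(_ A entA) := Gp j; rewrite (ord1 i) => Aj.
by apply: (@filterS _ F _ (fun t => A (p 0 j, G t 0 j))) => // t At; rewrite inE.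
Qed.

Lemma rowE p : p = \sum_i p 0 i *: delta_mx 0 i.
Proof. exact: row_sum_delta. Qed.

Lemma lin_sum (S : V -> V) p : linear S -> S p = \sum_i p 0 i *: S (delta_mx 0 i).
Proof.
move=> lS; pose S' : {linear V -> V} := HB.pack S (GRing.isLinear.Build _ _ _ _ S lS).
rewrite [in LHS](rowE p) -[S]/(S' : V -> V) linear_sum.
by apply: eq_bigr => i _; rewrite linearZ.
Qed.

Lemma linear_row_continuous (S : V -> V) : linear S -> continuous S.
Proof.
move=> lS p; apply: (@cvg_row _ (nbhs p)) => i.
rewrite (_ : (fun t => _) = (fun t : V => \sum_j t 0 j * S (delta_mx 0 j) 0 i)); last first.
  apply/funext => t; rewrite (lin_sum t lS) summxE.
  by apply: eq_bigr => j _; rewrite mxE.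
rewrite (lin_sum p lS) summxE.
under eq_bigr do rewrite mxE.
apply: (@cvg_big _ _ _ _ _ add_continuous) => j _; apply: cvgMr_tmp.
exact: coord_continuous.
Qed.

Lemma smooth_lin_comp (S : V -> V) f : linear S -> smooth f ->
  smooth (fun p => f (S p)).
Proof.
move=> lS sf.
apply: (smoothP (C := fun h => exists2 g, smooth g & h = (fun p => g (S p)))).
- move=> _ [g sg ->] p; apply: continuous_comp; first exact: linear_row_continuous.
  exact: smooth_continuous.
- move=> _ v [g sg ->]; split=> [p|].
    by apply: derivable_lin_comp => //; exact: smooth_derivable.
  exists (dd (S v) g); first exact: smooth_D.
  by apply/funext => p; rewrite derive_lin_comp.
- by exists f.
Qed.

Lemma derive_coord i p v : dd v (fun p => p 0 i) p = v 0 i.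
Proof.
have d : is_derive p v id v by exact: is_derive_id.
have := @derive_mx _ _ _ _ id p v; rewrite derive_id => /(_ (@derivable_id _ _ _ _)).
by move=> /matrixP /(_ 0 i); rewrite mxE => ->.
Qed.

Lemma smooth_coord i : smooth (fun p => p 0 i).
Proof.
apply: (smoothP (C := fun h => (exists c : R, h = fun=> c) \/ h = (fun p => p 0 i))).
- move=> _ [[c ->]|->]; first exact: cst_continuous.
  exact: coord_continuous.
- move=> _ v [[c ->]|->].
    split=> [p|]; first exact: derivable_cst.
    by left; exists 0; apply/funext => p; rewrite derive_cst0.
  split=> [p|]; first exact/diff_derivable/differentiable_coord.
  left; exists (v 0 i); apply/funext => p.
  exact: derive_coord.
- by right.
Qed.

Lemma derivable_line f p v t : derivable f (t *: v + p) v ->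
  is_derive t 1 (fun s : R => f (s *: v + p)) (dd v f (t *: v + p)).
Proof.
move=> df.
have E : (fun h : R => h^-1 *: (((fun s : R => f (s *: v + p)) \o shift t) (h *: 1) - f (t *: v + p))) =
         (fun h : R => h^-1 *: ((f \o shift (t *: v + p)) (h *: v) - f (t *: v + p))).
  by apply/funext => h /=; rewrite [h *: 1]mulr1 scalerDl addrA.
by apply: DeriveDef; rewrite /derivable /derive E.
Qed.

Lemma MVT_line f p v (t : R) : (forall q, derivable f q v) ->
  exists2 c, `|c| <= `|t| & f (t *: v + p) - f p = t * dd v f (c *: v + p).
Proof.
move=> df.
have dl s := @derivable_line f p v s (df (s *: v + p)).
have cl : continuous (fun s : R => f (s *: v + p)).
  by move=> s; apply/differentiable_continuous/derivable1_diffP; case: (dl s).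
have [t0|t0|<-] := ltgtP 0 t.
- have [c ct E] := MVT t0 (fun s _ => dl s) (continuous_subspaceT cl).
  exists c; first by rewrite !gtr0_norm ?ltW ?(itvP ct)//.
  by rewrite scale0r add0r subr0 mulrC in E.
- have [c ct E] := MVT t0 (fun s _ => dl s) (continuous_subspaceT cl).
  exists c; first by rewrite !ltr0_norm ?lerN2 ?ltW ?(itvP ct)//.
  move: E; rewrite scale0r add0r sub0r mulrN mulrC => /eqP.
  by rewrite -eqr_opp opprK opprB => /eqP.
- by exists 0 => //; rewrite scale0r add0r subrr mul0r.
Qed.

Lemma dd0 f p : dd 0 f p = 0.
Proof. exact: derive0. Qed.

Lemma derive_homog f p v (a : R) : smooth f -> dd (a *: v) f p = a * dd v f p.
Proof.
move=> sf; have [->|a0] := eqVneq a 0; first by rewrite scale0r dd0 mul0r.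
have := @derivable_line f p (a *: v) 0; rewrite scale0r add0r => /(_ (smooth_derivable sf))[_ <-].
have dv := @derivable_line f p v 0; rewrite scale0r add0r in dv.
have {}dv := dv (smooth_derivable sf).
rewrite -derive1E (_ : (fun s => _) = (fun s => f (s *: v + p)) \o ( *%R a)); last first.
  by apply/funext => s /=; rewrite scalerA mulrC.
rewrite derive1_comp; last 2 first.
- exact: derivableM.
- by rewrite mulr0; case: dv.
rewrite mulr0 derive1E; case: dv => _ ->.
by rewrite derive1Ml// derive1_id mulr1 mulrC.
Qed.

(** The increment along [v + w] is a step along [v] followed by a step along [w] from [h *: v + p].
    The mean value theorem turns the second into [h] times [dd w f] at a nearby point, and
    continuity of [dd w f] gives the limit. *)
Lemma derive_addv f p v w : smooth f -> dd (v + w) f p = dd v f p + dd w f p.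
Proof.
move=> sf; apply/cvg_lim => //.
have dv : h^-1 *: (f (h *: v + p) - f p) @[h --> 0^'] --> dd v f p.
  exact: (@smooth_derivable f p v sf).
suff H : h^-1 *: (f (h *: (v + w) + p) - f (h *: v + p)) @[h --> 0^'] --> dd w f p.
  rewrite (addrC (dd v f p)); apply: (cvg_trans _ (cvgD H dv)).
  apply: near_eq_cvg; near=> h.
  change (h^-1 *: (f (h *: (v + w) + p) - f (h *: v + p)) +
          h^-1 *: (f (h *: v + p) - f p) = h^-1 *: (f (h *: (v + w) + p) - f p)).
  by rewrite -scalerDr; congr (_ *: _); rewrite addrA subrK.
apply/cvgrPdist_le => e e0.
have := @smooth_continuous (dd w f) (smooth_D w sf) p.
move=> /cvgrPdist_le /(_ e e0) /nbhs_ballP[d /= d0 H].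
have d'0 : 0 < d / (`|v| + `|w| + 1).
  by rewrite divr_gt0// ltr_wpDl// addr_ge0.
near=> h.
have h0 : h != 0 by near: h; exact: nbhs_dnbhs_neq.
have hd : `|h| < d / (`|v| + `|w| + 1) by near: h; exact: dnbhs0_lt.
have [c ch E] := @MVT_line f (h *: v + p) w h (fun q => smooth_derivable sf).
rewrite (scalerDr h) (addrC (h *: v) (h *: w)) -addrA E [_ *: _]mulrA mulVf// mul1r.
apply: H; rewrite -ball_normE/= addrA opprD addrCA subrr addr0 normrN.
rewrite (le_lt_trans (ler_normD _ _))// !normrZ.
rewrite ltr_pdivlMr in hd; last by rewrite ltr_wpDl// addr_ge0.
apply: le_lt_trans hd; have hw := ler_wpM2r (normr_ge0 w) ch.
have := normr_ge0 h; rewrite mulrDr mulrDr; lra.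
Unshelve. all: by end_near. Qed.

Lemma derive_sumv f p (I : Type) (r : seq I) (F : I -> V) : smooth f ->
  dd (\sum_(i <- r) F i) f p = \sum_(i <- r) dd (F i) f p.
Proof.
move=> sf; elim: r => [|i r IH]; first by rewrite !big_nil dd0.
by rewrite !big_cons derive_addv// IH.
Qed.

Lemma derive_coords f p v : smooth f ->
  dd v f p = \sum_i v 0 i * dd (delta_mx 0 i) f p.
Proof.
move=> sf; rewrite {1}(rowE v) derive_sumv//; apply: eq_bigr => i _.
exact: derive_homog.
Qed.

Lemma cvg_is_derive f p v (l : R) :
  h^-1 *: (f (h *: v + p) - f p) @[h --> 0^'] --> l -> is_derive p v f l.
Proof.
move=> H; apply: DeriveDef; last exact/cvg_lim.
by apply/cvg_ex; eexists; exact: H.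
Qed.

Lemma cvg_derive f p v (l : R) :
  h^-1 *: (f (h *: v + p) - f p) @[h --> 0^'] --> l -> dd v f p = l.
Proof. by move=> H; exact/cvg_lim. Qed.

Lemma is_derive_cvg f p v : derivable f p v ->
  h^-1 * (f (h *: v + p) - f p) @[h --> 0^'] --> dd v f p.
Proof. by []. Qed.

Lemma cvg_is_derive1 (f : R -> R) (t l : R) :
  h^-1 * (f (h + t) - f t) @[h --> 0^'] --> l -> is_derive t 1 f l.
Proof.
move=> H.
have E : (fun h : R => h^-1 *: ((f \o shift t) (h *: 1) - f t)) =
    (fun h : R => h^-1 * (f (h + t) - f t)).
  by apply/funext => h /=; rewrite [h *: 1]mulr1.
apply: DeriveDef; rewrite /derivable /derive E; last exact/cvg_lim.
by apply/cvg_ex; eexists; exact: H.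
Qed.

Lemma is_derive1_cvg (f : R -> R) (t l : R) : is_derive t 1 f l ->
  h^-1 * (f (h + t) - f t) @[h --> 0^'] --> l.
Proof.
case=> d1 d2; move: d1; rewrite /derivable -d2 /derive.
by under eq_fun do rewrite /= [_ *: 1]mulr1.
Qed.

Lemma derive_translate f p (u : V) v : dd v (fun q => f (u + q)) p = dd v f (u + p).
Proof.
by rewrite /dd /derive; do 2 f_equal; apply/funext => h /=; rewrite addrCA.
Qed.

Lemma derivable_translate f p (u : V) v :
  derivable f (u + p) v -> derivable (fun q => f (u + q)) p v.
Proof.
rewrite /derivable (_ : (fun h => h^-1 *: ((f \o shift (u + p)) (h *: v) - f (u + p))) =
  (fun h => h^-1 *: (((fun q => f (u + q)) \o shift p) (h *: v) - f (u + p)))) //.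
by apply/funext => h /=; rewrite addrCA.
Qed.

End smooth.

(** * Integrals over the unit interval depending on parameters *)

Opaque dd.

Section I01.
Context {R : realType}.
Implicit Types (k l : R -> R).

Definition I01 k : R := (\int[lebesgue_measure]_(s in `[0%R, 1%R]) k s)%R.

Lemma integrable01 k : continuous k ->
  (@lebesgue_measure R).-integrable `[0, 1] (EFin \o k).
Proof.
move=> ck; apply: continuous_compact_integrable; first exact: segment_compact.
exact: continuous_subspaceT.
Qed.

Lemma I01D k l : continuous k -> continuous l ->
  I01 (fun s => k s + l s) = I01 k + I01 l.
Proof. by move=> ck cl; apply: RintegralD => //; exact: integrable01. Qed.

Lemma I01B k l : continuous k -> continuous l ->
  I01 (fun s => k s - l s) = I01 k - I01 l.
Proof. by move=> ck cl; apply: RintegralB => //; exact: integrable01. Qed.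

Lemma I01Z c k : continuous k -> I01 (fun s => c * k s) = c * I01 k.
Proof. by move=> ck; apply: RintegralZl => //; exact: integrable01. Qed.

Lemma eq_I01 k l : (forall s, 0 <= s <= 1 -> k s = l s) -> I01 k = I01 l.
Proof. by move=> kl; apply: eq_Rintegral => s; rewrite inE/= in_itv => /kl. Qed.

Lemma I01_cst c : I01 (fun=> c) = c.
Proof.
by rewrite /I01 Rintegral_cst//= lebesgue_measure_itv/= lte_fin ltr01 sube0 mulr1.
Qed.

Lemma I01_le M k : continuous k -> (forall s, 0 <= s <= 1 -> `|k s| <= M) ->
  `|I01 k| <= M.
Proof.
move=> ck kM; apply: le_trans (le_normr_Rintegral _ (integrable01 ck)) _ => //.
rewrite -[leRHS]I01_cst; apply: le_Rintegral => //.
- by apply: (@integrable01 (fun s => `|k s|)) => s; apply: cvg_norm; exact: ck.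
- exact/integrable01/cst_continuous.
Qed.

Lemma I01_FTC (F f : R -> R) : continuous f ->
  (forall s : R, is_derive s 1 F (f s)) -> I01 f = F 1 - F 0.
Proof.
move=> cf dF.
have cF : continuous F.
  by move=> s; apply/differentiable_continuous/derivable1_diffP; case: (dF s).
rewrite /I01 /Rintegral (@continuous_FTC2 _ f F 0 1)//.
- exact: continuous_subspaceT.
- split.
  + by move=> x _; case: (dF x).
  + exact/cvg_at_right_filter/cF.
  + exact/cvg_at_left_filter/cF.
- by move=> x _; rewrite derive1E; case: (dF x).
Qed.

(** Tube lemma: continuity in the parameter is uniform over the compact interval [0, 1]. *)
Lemma uniform_near01 (T : topologicalType) (k : R -> T -> R) (p : T) (e : R) :
  continuous (fun z : R * T => k z.1 z.2) -> 0 < e ->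
  \forall q \near p, forall s, 0 <= s <= 1 -> `|k s p - k s q| <= e.
Proof.
move=> ck e0.
have /compact_near_coveringP H := @segment_compact R 0 1.
have := H T (nbhs p) (fun q s => `|k s p - k s q| <= e) _ _.
move=> /(_ (nbhs_filter p)) {}H.
suff /H : forall x : R, `[0%R, 1%R]%classic x ->
    \forall x' \near x & i \near nbhs p, `|k x' p - k x' i| <= e.
  by apply: filterS => q Hq s s01; apply: Hq; rewrite /= in_itv.
move=> s _.
have e2 : 0 < e / 2 by rewrite divr_gt0.
have /cvgrPdist_lt /(_ _ e2) [[A B] /= [sA pB] AB] := ck (s, p).
exists (A, B) => //= -[s' q] /= [As' Bq].
have h1 := AB (s', q) (conj As' Bq); have h2 := AB (s', p) (conj As' (nbhs_singleton pB)).
rewrite /= in h1 h2.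
rewrite (le_trans (ler_distD (k s p) _ _))// (splitr e) lerD//; last exact: ltW.
by rewrite distrC ltW.
Qed.

Lemma joint_continuous1 (T U : topologicalType) (k : R -> T -> U) p :
  continuous (fun z : R * T => k z.1 z.2) -> continuous (k ^~ p).
Proof.
move=> ck s; have h : (fun s : R => (s, p)) @ s --> (s, p).
  move=> A [[B C] /= [sB pC] BC]; apply: filterS sB => t Bt.
  by apply: BC; split => //=; exact: nbhs_singleton.
exact: (cvg_comp _ _ h (ck (s, p))).
Qed.

Lemma I01_continuous (T : topologicalType) (k : R -> T -> R) :
  continuous (fun z : R * T => k z.1 z.2) ->
  continuous (fun p => I01 (k ^~ p)).
Proof.
move=> ck p; apply/cvgrPdist_le => e e0.
have := @uniform_near01 _ k p _ ck e0; apply: (@filterS _ (nbhs p)) => q Hq.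
have c r : continuous (k ^~ r) by exact: joint_continuous1.
rewrite -I01B//; apply: I01_le => [s|//].
by apply: cvgB; exact: c.
Qed.

End I01.

Lemma cvg_pair2 (T : Type) (F : set_system T) {FF : Filter F} (U W : topologicalType)
    (f : T -> U) (g : T -> W) (a : U) (b : W) :
  f @ F --> a -> g @ F --> b -> (fun x => (f x, g x)) @ F --> (a, b).
Proof.
move=> fa gb A [[B C] /= [aB bC] BC].
have := @filterI T F FF _ _ (fa _ aB) (gb _ bC).
by apply: (@filterS _ F) => x [Bx Cx]; exact: BC.
Qed.

Lemma cvg_dnbhs (R : realType) (k : R -> R) (x l : R) :
  k y @[y --> x] --> l -> k y @[y --> x^'] --> l.
Proof. exact: (@cvg_within_filter _ _ _ (nbhs x)). Qed.

Section I01_param.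
Context {R : realType} {N : nat}.
Notation V := 'rV[R]_N.
Implicit Types (k : R -> V -> R) (p v : V).

(** Differentiation under the integral: for each [s] the mean value theorem replaces the difference
    quotient by a derivative at a nearby point, and [uniform_near01] makes the error uniform in
    [s]. *)
Lemma I01_is_derive k p v :
  continuous (fun z : R * V => k z.1 z.2) ->
  (forall s q, derivable (k s) q v) ->
  continuous (fun z : R * V => dd v (k z.1) z.2) ->
  is_derive p v (fun q => I01 (k ^~ q)) (I01 (fun s => dd v (k s) p)).
Proof.
move=> ck dk cdk.
apply: cvg_is_derive; apply/cvgrPdist_le => e e0.
have /nbhs_ballP[d /= d0 Hd] := @uniform_near01 _ _ (fun s => dd v (k s)) p _ cdk e0.
have d'0 : 0 < d / (`|v| + 1) by rewrite divr_gt0// ltr_wpDl.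
near=> h.
have h0 : h != 0 by near: h; exact: nbhs_dnbhs_neq.
have hd : `|h| < d / (`|v| + 1) by near: h; exact: dnbhs0_lt.
have c q : continuous (k ^~ q) by exact: joint_continuous1.
have dc := @joint_continuous1 _ _ _ (fun s => dd v (k s)) p cdk.
have cB : continuous (fun s => k s (h *: v + p) - k s p).
  by move=> s; apply: cvgB; exact: c.
rewrite -I01B// [_ *: _](_ : _ = I01 (fun s => h^-1 * (k s (h *: v + p) - k s p))); last first.
  by rewrite I01Z.
rewrite -I01B//; last by move=> s; apply: cvgMl_tmp; exact: cB.
apply: I01_le => [s|s s01].
  by apply: cvgB; [exact: dc|apply: cvgMl_tmp; exact: cB].
have [t th ->] := @MVT_line _ _ (k s) p v h (dk s).
rewrite mulrA mulVf// mul1r; apply: Hd => //.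
rewrite -ball_normE/= opprD addrCA subrr addr0 normrN normrZ.
rewrite ltr_pdivlMr in hd; last by rewrite ltr_wpDl.
apply: le_lt_trans hd; have := ler_wpM2r (normr_ge0 v) th.
have := normr_ge0 h; rewrite mulrDr mulr1; lra.
Unshelve. all: by end_near. Qed.

(* A kernel is smooth in its parameter when it belongs to some class of jointly
   continuous kernels that is stable under directional derivatives. *)
Definition psmooth k := exists C : (R -> V -> R) -> Prop, [/\ C k,
  (forall l, C l -> continuous (fun z : R * V => l z.1 z.2)) &
  (forall l v, C l -> (forall s p, derivable (l s) p v) /\ C (fun s => dd v (l s)))].

Lemma psmooth_D k v : psmooth k -> psmooth (fun s => dd v (k s)).
Proof.
by move=> [C [Ck Cc Cd]]; exists C; split=> //; exact: (Cd _ v Ck).2.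
Qed.

Lemma psmooth_continuous k : psmooth k -> continuous (fun z : R * V => k z.1 z.2).
Proof. by move=> [C [Ck Cc _]]; exact: Cc. Qed.

Lemma psmooth_derivable k s p v : psmooth k -> derivable (k s) p v.
Proof. by move=> [C [Ck _ /(_ _ v Ck)[]]]. Qed.

Lemma psmooth_continuous1 k p : psmooth k -> continuous (k ^~ p).
Proof. by move=> /psmooth_continuous; exact: joint_continuous1. Qed.

Lemma I01_derive k p v : psmooth k ->
  dd v (fun q => I01 (k ^~ q)) p = I01 (fun s => dd v (k s) p).
Proof.
move=> sk.
have [] // := @I01_is_derive k p v (psmooth_continuous sk)
  (fun s q => psmooth_derivable sk) (psmooth_continuous (psmooth_D v sk)).
Qed.

Lemma smooth_I01 k : psmooth k -> smooth (fun p => I01 (k ^~ p)).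
Proof.
move=> sk; apply: (@smoothP _ _
  (fun f => exists2 l, psmooth l & f = (fun p => I01 (l ^~ p)))).
- by move=> _ [l sl ->]; exact: I01_continuous (psmooth_continuous sl).
- move=> _ v [l sl ->]; split.
    move=> p; have [] // := @I01_is_derive l p v (psmooth_continuous sl)
      (fun s q => psmooth_derivable sl) (psmooth_continuous (psmooth_D v sl)).
  exists (fun s => dd v (l s)); first exact: psmooth_D.
  by apply/funext => p; rewrite I01_derive.
- by exists k.
Qed.

End I01_param.

Section linear_kernel.
Context {R : realType} {N : nat}.
Notation V := 'rV[R]_N.
Variable L : R -> V -> V.
Hypothesis lL : forall s, linear (L s).
Hypothesis cL : continuous (fun z : R * V => L z.1 z.2).

(** The chain rule turns [c s * w (L s p)] into a sum over coordinates of kernels of the same form,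
    with the coordinates of [L s v] absorbed in [c]; with sums added the class is closed under
    derivatives. *)
Inductive linear_kernel : (R -> V -> R) -> Prop :=
| linear_kernel1 (c : R -> R) (w : V -> R) : continuous c -> smooth w ->
    linear_kernel (fun s p => c s * w (L s p))
| linear_kernel0 : linear_kernel (fun _ _ => 0)
| linear_kernelD (k l : R -> V -> R) : linear_kernel k -> linear_kernel l ->
    linear_kernel (fun s p => k s p + l s p).

Lemma linear_kernel_smooth k s : linear_kernel k -> smooth (k s).
Proof.
elim=> [c w _ sw||{}k l _ sk _ sl].
- apply: smooth_mul; first exact: smooth_cst.
  exact: smooth_lin_comp.
- exact: smooth_cst.
- exact: smooth_add.
Qed.

Lemma linear_kernel_sum (I : Type) (r : seq I) (F : I -> R -> V -> R) :
  (forall i, linear_kernel (F i)) ->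
  linear_kernel (fun s p => \sum_(i <- r) F i s p).
Proof.
move=> KF; elim: r => [|i r IH].
  rewrite (_ : (fun s p => _) = fun _ _ => 0); first exact: linear_kernel0.
  by apply/funext => s; apply/funext => p; rewrite big_nil.
rewrite (_ : (fun s p => _) = fun s p => F i s p + \sum_(i <- r) F i s p).
  exact: linear_kernelD.
by apply/funext => s; apply/funext => p; rewrite big_cons.
Qed.

Lemma psmooth_linear_kernel k : linear_kernel k -> psmooth k.
Proof.
move=> Kk; exists linear_kernel; split=> // {Kk}k.
  elim=> [c w cc sw||{}k l _ ck _ cl].
  - move=> z; apply: cvgM; first by apply: continuous_comp; [exact: cvg_fst|exact: cc].
    by apply: continuous_comp; [exact: cL|exact: smooth_continuous].
  - exact: cst_continuous.
  - by move=> z; apply: cvgD; [exact: ck|exact: cl].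
move=> v Kk; split=> [s p|].
  exact/smooth_derivable/linear_kernel_smooth.
elim: Kk => [c w cc sw||{}k l Kk Dk Kl Dl].
- rewrite (_ : (fun s => _) = (fun s p => \sum_i (c s * L s v 0 i) * dd (delta_mx 0 i) w (L s p))).
    apply: linear_kernel_sum => i.
    apply: (@linear_kernel1 (fun s => c s * L s v 0 i) (dd (delta_mx 0 i) w)); last exact: smooth_D.
    move=> s; apply: cvgM; first exact: cc.
    apply: (@continuous_comp _ _ _ (fun s => L s v) (fun q : V => q 0 i)); last exact: coord_continuous.
    exact: (@joint_continuous1 _ _ _ L v).
  apply/funext => s; apply/funext => p; rewrite derive_cmul; last exact: smooth_lin_comp.
  rewrite derive_lin_comp// (derive_coords _ _ sw) mulr_sumr.
  by apply: eq_bigr => i _; rewrite mulrA.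
- rewrite (_ : (fun s => _) = fun _ _ => 0); first exact: linear_kernel0.
  by apply/funext => s; apply/funext => p; rewrite derive_cst0.
- rewrite (_ : (fun s => _) = fun s p => dd v (k s) p + dd v (l s) p); first exact: linear_kernelD.
  by apply/funext => s; apply/funext => p; rewrite derive_add//; exact: linear_kernel_smooth.
Qed.

Lemma psmooth_lin (c : R -> R) (w : V -> R) :
  continuous c -> smooth w -> psmooth (fun s p => c s * w (L s p)).
Proof. by move=> cc sw; apply/psmooth_linear_kernel/linear_kernel1. Qed.

End linear_kernel.

(** * Symmetry of second derivatives and the chain rule along curves *)

Section schwarz.
Context {R : realType} {N : nat}.
Notation V := 'rV[R]_N.
Implicit Types (f : V -> R) (p v w u q : V) (t s h : R).

Lemma smooth_line_continuous f p w : smooth f ->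
  continuous (fun s : R => f (s *: w + p)).
Proof.
move=> sf s; apply/differentiable_continuous/derivable1_diffP.
by have [] := @derivable_line _ _ f p w s (smooth_derivable sf).
Qed.

(** Unlike the mean value theorem, this form has a remainder that is smooth in [p] and jointly
    continuous in [t] and [p], so it can be differentiated and passed to the limit. *)
Lemma smooth_segment f p w t : smooth f ->
  f (t *: w + p) - f p = t * I01 (fun s => dd w f (s *: (t *: w) + p)).
Proof.
move=> sf; have cD : continuous (fun s : R => dd w f (s *: (t *: w) + p)).
  by apply: (@smooth_line_continuous (dd w f)); exact: smooth_D.
have cD' : continuous (fun s : R => t * dd w f (s *: (t *: w) + p)).
  by move=> s; apply: cvgMl_tmp; exact: cD.
have dF s : is_derive s 1 (fun s => f (s *: (t *: w) + p)) (t * dd w f (s *: (t *: w) + p)).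
  rewrite -derive_homog//; apply: derivable_line; exact: smooth_derivable.
by rewrite -I01Z// (I01_FTC cD' dF) scale1r scale0r add0r.
Qed.

Lemma segment_continuous (g : V -> R) w : continuous g ->
  continuous (fun z : R * V => I01 (fun s => g (s *: (z.1 *: w) + z.2))).
Proof.
move=> cg.
apply: (@I01_continuous R (R * V)%type (fun s z => g (s *: (z.1 *: w) + z.2))) => z.
have h : x.1 *: (x.2.1 *: w) + x.2.2 @[x --> z] --> z.1 *: (z.2.1 *: w) + z.2.2.
  have c2 : x.2 @[x --> z] --> z.2 by exact: cvg_snd.
  have c21 : x.2.1 @[x --> z] --> z.2.1 by apply: (cvg_comp _ _ c2); exact: cvg_fst.
  have c22 : x.2.2 @[x --> z] --> z.2.2 by apply: (cvg_comp _ _ c2); exact: cvg_snd.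
  apply: (@cvgD R V) => //.
  by apply: cvgZ; [exact: cvg_fst|apply: cvgZr_tmp].
exact: (cvg_comp _ _ h (cg _)).
Qed.

Lemma smooth_translate f u : smooth f -> smooth (fun q => f (u + q)).
Proof.
move=> sf.
apply: (@smoothP _ _ (fun l => exists2 g : V -> R, smooth g & l = (fun q => g (u + q)))).
- move=> _ [g sg ->] p; have h : u + q @[q --> p] --> u + p.
    by apply: (@cvgD R V _ (nbhs p) _ (fun=> u) id); [exact: cvg_cst|exact: cvg_id].
  have cg : continuous g by exact: smooth_continuous.
  exact: (cvg_comp _ _ h (cg _)).
- move=> _ v [g sg ->]; split=> [p|].
    by apply: derivable_translate; exact: smooth_derivable.
  exists (dd v g); first exact: smooth_D.
  by apply/funext => p; rewrite (derive_translate g p _ v).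
- by exists f.
Qed.

Lemma psmooth_translate f u : smooth f -> psmooth (fun s q => f (s *: u + q)).
Proof.
move=> sf; exists (fun k => exists2 g : V -> R, smooth g & k = (fun s q => g (s *: u + q))).
split; first by exists f.
- move=> _ [g sg ->] z.
  have h : x.1 *: u + x.2 @[x --> z] --> z.1 *: u + z.2.
    by apply: cvgD; [apply: cvgZr_tmp; exact: cvg_fst|exact: cvg_snd].
  have cg : continuous g by exact: smooth_continuous.
  exact: (cvg_comp _ _ h (cg _)).
- move=> _ v [g sg ->]; split=> [s p|].
    by apply: derivable_translate; exact: smooth_derivable.
  exists (dd v g); first exact: smooth_D.
  by apply/funext => s; apply/funext => p; rewrite (derive_translate g p _ v).
Qed.

(** Differentiating [smooth_segment] along [v] under the integral writes the increment of [dd v f]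
    in direction [w] as [h] times a mean of [dd v (dd w f)]; dividing by [h] and letting [h] tend to
    0 gives the claim. *)
Lemma schwarz f p v w : smooth f -> dd v (dd w f) p = dd w (dd v f) p.
Proof.
move=> sf; apply: esym; apply: cvg_derive; pose g : V -> R := dd v (dd w f); have sg : smooth g by do 2 apply: smooth_D.
pose J (h : R) := I01 (fun s => g (s *: (h *: w) + p)).
have H : J h @[h --> (0 : R)] --> dd v (dd w f) p.
  have E : dd v (dd w f) p = J 0.
    rewrite /J -[LHS]I01_cst; apply: eq_I01 => s _.
    by rewrite scale0r scaler0 add0r.
  rewrite E; have := @segment_continuous g w (smooth_continuous sg).
  have h : (fun h : R => (h, p)) @ (0 : R) --> ((0 : R), p).
    move=> A [[B C] /= [sB pC] BC]; apply: filterS sB => t Bt.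
    by apply: BC; split => //=; exact: nbhs_singleton.
  by move=> /(_ (0, p)) /(cvg_comp _ _ h).
have := cvg_dnbhs H.
apply: cvg_trans; apply: near_eq_cvg; near=> h.
have h0 : h != 0 by near: h; exact: nbhs_dnbhs_neq.
rewrite /= /J.
have -> : dd v f (h *: w + p) - dd v f p =
    h * I01 (fun s => g (s *: (h *: w) + p)).
  have sk := psmooth_translate (h *: w) (smooth_D w sf).
  have := @derive_cmul _ _ h _ p v (smooth_I01 sk).
  rewrite (I01_derive _ _ sk).
  rewrite (_ : (fun q => _) = (fun q => f (h *: w + q) - f q)); last first.
    by apply/funext => q; rewrite smooth_segment.
  have E := derive_sub p v (smooth_translate (h *: w) sf) sf.
  rewrite (derive_translate f p (h *: w) v) in E.
  rewrite -E.
  move=> ->.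
  apply: (congr1 (fun x => h * x)).
  apply: eq_I01 => s _.
  exact: (derive_translate (dd w f) p (s *: (h *: w)) v).
exact: (esym (mulKf h0 _)).
Unshelve. all: by end_near. Qed.

(** Serves both flows of the proof: [(s x, y / s)] for hyperbolic fields, and the curve in the span
    of [X p] and [X (X p)] for rotations. *)
Lemma is_derive_curve f u w z (a b : R -> R) t da db : smooth f ->
  is_derive t 1 a da -> is_derive t 1 b db ->
  is_derive t 1 (fun t => f (a t *: u + (b t *: w + z)))
    (da * dd u f (a t *: u + (b t *: w + z)) + db * dd w f (a t *: u + (b t *: w + z))).
Proof.
move=> sf Da Db.
have cvg_d (c : R -> R) dc : is_derive t 1 c dc ->
    h^-1 * (c (h + t) - c t) @[h --> 0^'] --> dc /\ c (h + t) @[h --> 0^'] --> c t.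
  move=> dc1; split; first exact: is_derive1_cvg.
  have cc : {for t, continuous c}.
    by case: dc1 => dc1 _; exact/differentiable_continuous/derivable1_diffP.
  have h : h + t @[h --> (0 : R)] --> t.
    by rewrite -[X in _ --> X]add0r; apply: cvgD; [exact: cvg_id|exact: cvg_cst].
  exact: (cvg_dnbhs (cvg_comp _ _ h cc)).
have [Qa Ca] := cvg_d _ _ Da; have [Qb Cb] := cvg_d _ _ Db.
pose Jf v := fun x : R * V => I01 (fun s => dd v f (s *: (x.1 *: v) + x.2)).
have cJ v : continuous (Jf v).
  by apply: (@segment_continuous (dd v f)); exact/smooth_continuous/smooth_D.
have J0 v q : Jf v (0, q) = dd v f q.
  by rewrite /Jf -[RHS]I01_cst; apply: eq_I01 => s _; rewrite scale0r scaler0 add0r.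
pose p := a t *: u + (b t *: w + z).
have Cba : b (h + t) - b t @[h --> 0^'] --> (0 : R).
  by rewrite -[X in _ --> X](subrr (b t)); apply: cvgB => //; exact: cvg_cst.
have Cab : a (h + t) - a t @[h --> 0^'] --> (0 : R).
  by rewrite -[X in _ --> X](subrr (a t)); apply: cvgB => //; exact: cvg_cst.
have L2 : Jf w (b (h + t) - b t, p) @[h --> 0^'] --> dd w f p.
  rewrite -J0; apply: (cvg_comp (fun h => (b (h + t) - b t, p)) (Jf w)); last exact: cJ.
  by apply: cvg_pair2 => //; exact: cvg_cst.
have L1 : Jf u (a (h + t) - a t, a t *: u + (b (h + t) *: w + z)) @[h --> 0^'] --> dd u f p.
  rewrite -J0; apply: (cvg_comp (fun h => (a (h + t) - a t, a t *: u + (b (h + t) *: w + z))) (Jf u)); last exact: cJ.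
  apply: cvg_pair2 => //.
  apply: (@cvgD R V _ _ _ (fun=> a t *: u) (fun h => b (h + t) *: w + z)); first exact: cvg_cst.
  by apply: (@cvgD R V _ _ _ (fun h => b (h + t) *: w) (fun=> z)); [apply: cvgZr_tmp|exact: cvg_cst].
apply: cvg_is_derive1; rewrite -/p.
apply: (cvg_trans _ (cvgD (cvgM Qa L1) (cvgM Qb L2))).
  apply: near_eq_cvg; near=> h => /=.
  (* The increment from [p] passes through [q]: first [b] moves, then [a]. Each part is a scalar
     increment times a mean [Jf] that is continuous. *)
  set q := a t *: u + (b (h + t) *: w + z).
  have E1 : f (a (h + t) *: u + (b (h + t) *: w + z)) - f q = (a (h + t) - a t) * Jf u (a (h + t) - a t, q).
    by rewrite -(smooth_segment q u _ sf) /q scalerBl (addrA (_ - _)) subrK.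
  have E2 : f q - f p = (b (h + t) - b t) * Jf w (b (h + t) - b t, p).
    have Eq : q = (b (h + t) - b t) *: w + p.
      by rewrite /q /p scalerBl [RHS]addrCA [X in _ = _ + X]addrA subrK.
    by rewrite -(smooth_segment p w _ sf) -Eq.
  rewrite -[LHS]/(h^-1 * (a (h + t) - a t) * Jf u (a (h + t) - a t, q) +
    h^-1 * (b (h + t) - b t) * Jf w (b (h + t) - b t, p)).
  by rewrite -!(mulrA h^-1) -E1 -E2 -mulrDr addrA subrK.
Unshelve. all: by end_near. Qed.

End schwarz.

(** * A smooth cutoff function *)

Section bump.
Context {R : realType}.
Implicit Types (t u : R) (P Q : {poly R}).

(** For [u >= 1] the polynomial is at most [A * u ^ m] with [m] its size, while the exponential
    series gives [e^u >= u^(m+1) / (m+1)!]; one power of [u] is left over. *)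
Lemma poly_exp_bound Q : exists2 C, 0 <= C &
  forall u, 1 <= u -> `|Q.[u] * expR (- u)| <= C / u.
Proof.
pose m := size Q; pose A := \sum_(i < m) `|Q`_i|.
exists (A * (m.+1)`!%:R); first by rewrite mulr_ge0// sumr_ge0.
move=> u u1; have u0 : 0 < u by exact: lt_le_trans u1.
have h1 : `|Q.[u]| <= A * u ^+ m.
  rewrite horner_coef mulr_suml (le_trans (ler_norm_sum _ _ _))// ler_sum// => i _.
  rewrite normrM ler_wpM2l// (ger0_norm (exprn_ge0 _ (ltW u0))).
  by apply: ler_weXn2l => //; rewrite ltnW.
have h2 : expR (- u) <= (m.+1)`!%:R / u ^+ m.+1.
  have f0 : 0 < (m.+1)`!%:R :> R by rewrite ltr0n fact_gt0.
  rewrite expRN -[leRHS]invrK lef_pV2 ?posrE ?expR_gt0 ?invr_gt0 ?divr_gt0 ?exprn_gt0//.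
  rewrite invf_div; apply: le_trans (expR_ge1Dxn m (ltW u0)).
  by rewrite lerDr.
rewrite normrM (ger0_norm (expR_ge0 _)).
apply: le_trans (ler_pM (normr_ge0 _) (expR_ge0 _) h1 h2) _.
rewrite exprS invfM -!mulrA ler_wpM2l ?sumr_ge0//.
by rewrite mulrCA ler_wpM2l// mulrCA mulfV ?mulr1// expf_neq0// gt_eqF.
Qed.

Definition flat_exp P t : R := if 0 < t then P.[t^-1] * expR (- t^-1) else 0.

(** The polynomial in [1 / t] produced by differentiating [P(1/t) e^(-1/t)]: the outcome is
    [t^-2 (P - P')(1/t) e^(-1/t)]. *)
Definition flat_exp_next P : {poly R} := 'X^2 * (P - P^`()).

Lemma flat_exp_derive P t : is_derive t 1 (flat_exp P) (flat_exp (flat_exp_next P) t).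
Proof.
have [t0|t0|->] := ltgtP t 0.
- rewrite {2}/flat_exp ltNge (ltW t0)/=.
  have d0 : is_derive t 1 (fun _ : R => 0 : R) 0 by exact: is_derive_cst.
  apply: near_eq_is_derive d0.
  near=> s; rewrite /flat_exp ltNge (_ : s <= 0)//.
  by apply: ltW; near: s; exact: lt_nbhsl.
- rewrite {2}/flat_exp t0.
  have tn0 : t != 0 by rewrite gt_eqF.
  have dV : is_derive t 1 (fun s : R => s^-1) (- t ^- 2).
    have := is_deriveV (f := id) (v := 1) tn0 (is_derive_id _ _).
    by rewrite [_ *: 1]mulr1; apply.
  have dN : is_derive t 1 (fun s : R => - s^-1) (t ^- 2).
    by rewrite -[t ^- 2]opprK; exact: is_deriveN.
  have dE : is_derive t 1 (fun s : R => expR (- s^-1)) (expR (- t^-1) * t ^- 2).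
    exact: (@is_derive1_comp R expR (fun s => - s^-1) t _ _ (is_derive_expR _) dN).
  have dP : is_derive t 1 (fun s : R => P.[s^-1]) (P^`().[t^-1] * - t ^- 2).
    exact: (@is_derive1_comp R (horner P) (fun s => s^-1) t _ _ (is_derive_poly _ _) dV).
  have dPE : is_derive t 1 (fun s : R => P.[s^-1] * expR (- s^-1))
      ((flat_exp_next P).[t^-1] * expR (- t^-1)).
    apply: (is_derive_eq (is_deriveM dP dE)).
    rewrite /flat_exp_next !hornerE /= -![_ *: _]/(_ * _) -exprVn.
    by ring.
  apply: near_eq_is_derive dPE; near=> s; rewrite /flat_exp (_ : 0 < s)//.
  by near: s; exact: lt_nbhsr.
- rewrite {2}/flat_exp ltxx.
  (* For [h > 0] the difference quotient at 0 is the same expression with ['X * P] in place of [P],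
     hence at most [C * h]. *)
  have [C C0 HC] := poly_exp_bound ('X * P).
  apply: cvg_is_derive1; rewrite {2}/flat_exp ltxx.
  apply/cvgrPdist_le => e e0; near=> h.
  rewrite sub0r normrN subr0 addr0 /flat_exp; case: ifPn => [h0|]; last by rewrite mulr0 normr0 ltW.
  have h1 : h < 1.
    rewrite (le_lt_trans (ler_norm h))//; near: h; exact: dnbhs0_lt.
  have := HC h^-1; rewrite invf_ge1// => /(_ (ltW h1)).
  rewrite hornerM hornerX invrK -mulrA => /le_trans; apply.
  have : `|h| <= e / (C + 1) by near: h; apply: dnbhs0_le; rewrite divr_gt0// ltr_wpDl.
  have C1 : 0 < C + 1 by rewrite ltr_wpDl.
  by rewrite (ger0_norm (ltW h0)) (ler_pdivlMr _ _ C1) mulrDr mulr1 mulrC; lra.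
Unshelve. all: by end_near. Qed.

(** Smoothness in one variable is given as a whole tower of derivatives, so that the induction in
    [smooth_comp1] can climb it. *)
Definition smooth1 (F : R -> R) := exists F_ : nat -> R -> R,
  F_ 0%N = F /\ forall k t, is_derive t 1 (F_ k) (F_ k.+1 t).

Definition exp_step := flat_exp 1.

Lemma smooth1_exp_step : smooth1 exp_step.
Proof.
exists (fun k => flat_exp (iter k flat_exp_next 1)); split=> // k t.
by rewrite iterS; exact: flat_exp_derive.
Qed.

Lemma exp_step_gt0 t : 0 < t -> 0 < exp_step t.
Proof. by move=> t0; rewrite /exp_step /flat_exp t0 hornerE mul1r expR_gt0. Qed.

Lemma exp_step_le0 t : t <= 0 -> exp_step t = 0.
Proof. by move=> t0; rewrite /exp_step /flat_exp ltNge t0. Qed.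

Lemma exp_step_ge0 t : 0 <= exp_step t.
Proof. by have [/exp_step_le0->//|/exp_step_gt0/ltW] := leP t 0. Qed.

(** The summands are positive for [t < 1] and [t > 1/2] respectively, and these half-lines cover the
    line, so [bumpf] is a smooth quotient. *)
Definition bump_den t := exp_step (1 - t) + exp_step (t - 2^-1).

Definition bumpf t := exp_step (1 - t) / bump_den t.

Lemma bump_den_neq0 t : bump_den t != 0.
Proof.
rewrite gt_eqF// /bump_den; have [t1|t1] := ltP t 1.
- by apply: ltr_wpDr; [exact: exp_step_ge0|apply: exp_step_gt0; rewrite subr_gt0].
- apply: ltr_wpDl; [exact: exp_step_ge0|apply: exp_step_gt0]; lra.
Qed.

Lemma bump1 t : t <= 2^-1 -> bumpf t = 1.
Proof.
move=> t2; have := bump_den_neq0 t; rewrite /bumpf /bump_den.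
rewrite [exp_step (t - _)]exp_step_le0; last by rewrite subr_le0.
by rewrite addr0 => ?; rewrite divff.
Qed.

Lemma bump0 t : 1 <= t -> bumpf t = 0.
Proof. by move=> t1; rewrite /bumpf exp_step_le0 ?mul0r// subr_le0. Qed.

End bump.

Section smooth_comp.
Context {R : realType} {N : nat}.
Notation V := 'rV[R]_N.
Implicit Types (f q : V -> R) (p v : V).

Lemma comp1_is_derive f p v (F : R -> R) (l : R) : derivable f p v ->
  is_derive (f p) 1 F l -> is_derive p v (fun x => F (f x)) (l * dd v f p).
Proof.
move=> df dF.
have := @derivable_line _ _ f p v 0; rewrite scale0r add0r => /(_ df) dl.
have dF' : is_derive (f (0 *: v + p)) 1 F l by rewrite scale0r add0r.
have := @is_derive1_comp _ F (fun s : R => f (s *: v + p)) 0 _ _ dF' dl.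
move=> /is_derive1_cvg H; apply: cvg_is_derive; move: H.
by under eq_fun do rewrite /= addr0 scale0r add0r.
Qed.

Lemma smooth_comp1 f (F : R -> R) : smooth1 F -> smooth f ->
  smooth (fun p => F (f p)).
Proof.
move=> [F_ [<- dF]] sf k.
have cF n : continuous (fun p => F_ n (f p)).
  move=> p; have cn : {for f p, continuous (F_ n)}.
    by case: (dF n (f p)) => d _; exact/differentiable_continuous/derivable1_diffP.
  have cf : continuous f by exact: smooth_continuous.
  exact: (cvg_comp _ _ (cf p) cn).
have H n p v : is_derive p v (fun x => F_ n (f x)) (F_ n.+1 (f p) * dd v f p).
  exact: (comp1_is_derive (smooth_derivable sf) (dF n (f p))).
suff G n : Ck setT k (fun p => F_ n (f p)) by exact: G.
elim: k n => [|k IH] n; first by split=> // p _; exact: cF.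
split=> [p _|v]; first exact: cF.
split=> [p _|]; first by case: (H n p v).
rewrite (_ : dd v _ = (fun p => F_ n.+1 (f p)) * dd v f).
  by apply: CkM; [exact: openT|exact: IH|exact: smooth_D].
by apply/funext => p; case: (H n p v).
Qed.

Lemma smooth_inv f : smooth f -> (forall p, f p != 0) -> smooth (fun p => (f p)^-1).
Proof.
move=> sf f0 k.
have dV p v : is_derive p v (fun x => (f x)^-1) (- (f p) ^- 2 * dd v f p).
  have h := is_deriveV (f := id) (v := 1) (f0 p) (is_derive_id _ _).
  rewrite [_ *: 1]mulr1 in h.
  exact: (comp1_is_derive (smooth_derivable sf) h).
have cV : continuous (fun p => (f p)^-1).
  have cf : continuous f by exact: smooth_continuous.
  by move=> p; exact: (cvgV (f0 p) (cf p)).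
elim: k => [|k IH]; first by split=> // p _; exact: cV.
split=> [p _|v]; first exact: cV.
split=> [p _|]; first by case: (dV p v).
rewrite (_ : dd v _ = cst (-1) * ((fun p => (f p)^-1) * (fun p => (f p)^-1) * dd v f)).
  apply: CkM; [exact: openT|exact: Ck_cst|].
  apply: CkM; [exact: openT| |exact: smooth_D].
  by apply: CkM; [exact: openT|exact: IH|exact: IH].
apply/funext => p; case: (dV p v) => _ E; rewrite [LHS]E.
by rewrite -[RHS]/(-1 * ((f p)^-1 * (f p)^-1 * dd v f p)) -exprVn expr2 mulN1r mulNr.
Qed.

Lemma smooth_bump q : smooth q -> smooth (fun p => bumpf (q p)).
Proof.
move=> sq; apply: smooth_mul.
  by apply: (smooth_comp1 smooth1_exp_step); apply: smooth_sub => //; exact: smooth_cst.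
apply: smooth_inv; last by move=> p; exact: bump_den_neq0.
by apply: smooth_add; apply: (smooth_comp1 smooth1_exp_step); apply: smooth_sub => //; exact: smooth_cst.
Qed.

(** A cutoff through an invariant quantity is invariant. This is why every cutoff in the proof is
    [bumpf] of an expression in quadratic forms. *)
Lemma dd_bump0 q p v : smooth q -> dd v q p = 0 -> dd v (fun p => bumpf (q p)) p = 0.
Proof.
move=> sq q0.
have [F_ [F0 dF]] := @smooth1_exp_step R.
have H : exists l, is_derive (q p) 1 (@bumpf R) l.
  have d1 : is_derive (q p) 1 (fun t => 1 - t) (0 - 1) by exact: is_deriveB.
  have d2 : is_derive (q p) 1 (fun t => t - 2^-1) (1 - 0) by exact: is_deriveB.
  have e1 (t : R) : is_derive t 1 (@exp_step R) (F_ 1%N t) by rewrite -F0.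
  have b1 := @is_derive1_comp R _ (fun t => 1 - t) (q p) _ _ (e1 (1 - q p)) d1.
  have b2 := @is_derive1_comp R _ (fun t => t - 2^-1) (q p) _ _ (e1 (q p - 2^-1)) d2.
  have b3 := is_deriveD b1 b2.
  have b4 := is_deriveV (bump_den_neq0 (q p)) b3.
  by eexists; exact: (is_deriveM b1 b4).
have [l dl] := H.
have [_ ] := comp1_is_derive (@smooth_derivable _ _ q p v sq) dl.
by rewrite q0 mulr0.
Qed.

End smooth_comp.

(** * Smooth sums of series *)

Section series.
Context {R : realType}.
Implicit Types (u : nat -> R).

(** The terms before [M] stay free, because the Borel construction controls a given derivative on a
    given ball only from some index on. *)
Definition gdom (C : R) (M : nat) u := forall a, (M <= a)%N -> `|u a| <= C / 2 ^+ a.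

Definition ssum u : R := lim (series u @ \oo).

Lemma geo_sum (C : R) m n : (m <= n)%N -> 0 <= C ->
  \sum_(m <= a < n) C / 2 ^+ a <= 2 * C / 2 ^+ m.
Proof.
move=> mn C0; rewrite -(subnKC mn); move: (n - m)%N => k {mn}.
elim: k m => [|k IH] m.
  by rewrite addn0 big_geq// !mulr_ge0// invr_ge0 exprn_ge0.
rewrite big_ltn; last by rewrite -addSnnS leq_addr.
rewrite -addSnnS (le_trans (lerD (lexx _) (IH _)))//.
rewrite exprS invfM; set x := (_ ^+ m)^-1.
by rewrite le_eqVlt; apply/orP; left; apply/eqP; field.
Qed.

Lemma gdom_tail C M u m n : gdom C M u -> 0 <= C -> (M <= m)%N -> (m <= n)%N ->
  `|series u n - series u m| <= 2 * C / 2 ^+ m.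
Proof.
move=> du C0 Mm mn; rewrite sub_series_geq//.
apply: le_trans (ler_norm_sum _ _ _) _; apply: le_trans (geo_sum mn C0).
by rewrite !big_nat ler_sum// => a /andP[ma _]; apply: du; exact: leq_trans ma.
Qed.

Lemma gdom_cvg C M u : 0 <= C -> gdom C M u -> cvgn (series u).
Proof.
move=> C0 du; apply: normed_cvg.
(* Enlarging the constant absorbs the finitely many uncontrolled terms, so that the whole series is
   dominated by a geometric one. *)
pose C' := C + \sum_(b < M) `|u b| * 2 ^+ b.
apply: (@series_le_cvg _ _ (geometric C' 2^-1)) => [a|a|a|].
- exact: normr_ge0.
- by rewrite /= mulr_ge0 ?exprn_ge0// addr_ge0// sumr_ge0.
- have S0 : 0 <= \sum_(b < M) `|u b| * 2 ^+ b by apply: sumr_ge0.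
  rewrite /= exprVn ler_pdivlMr ?exprn_gt0//.
  have [Ma|aM] := leqP M a.
    have := du a Ma; rewrite ler_pdivlMr ?exprn_gt0// => /le_trans; apply.
    by rewrite lerDl.
  rewrite /C' (bigD1 (Ordinal aM))//= addrCA lerDl addr_ge0// sumr_ge0//.
- by apply: is_cvg_geometric_series; rewrite ger0_norm// invf_lt1// ltr1n.
Qed.

Lemma gdom_ssum_tail C M u m : 0 <= C -> gdom C M u -> (M <= m)%N ->
  `|ssum u - series u m| <= 2 * C / 2 ^+ m.
Proof.
move=> C0 du Mm; have cu := gdom_cvg C0 du.
have H : `|series u n - series u m| @[n --> \oo] --> `|ssum u - series u m|.
  by apply: cvg_norm; apply: cvgB => //; exact: cvg_cst.
apply: (cvgr_to_le H); near=> n; apply: gdom_tail du C0 Mm _.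
by near: n; exact: nbhs_infty_ge.
Unshelve. all: by end_near. Qed.

Lemma ssumB u v : cvgn (series u) -> cvgn (series v) ->
  ssum (fun a => u a - v a) = ssum u - ssum v.
Proof. by move=> cu cv; exact: lim_seriesB. Qed.

Lemma ssumZ c u : cvgn (series u) -> ssum (fun a => c * u a) = c * ssum u.
Proof. by move=> cu; exact: lim_seriesZ. Qed.

Lemma ssum_finite M u : (forall a, (M <= a)%N -> u a = 0) -> ssum u = \sum_(a < M) u a.
Proof.
move=> u0; have d : gdom 0 M u by move=> a /u0 ->; rewrite normr0 mul0r.
have := gdom_ssum_tail (lexx 0) d (leqnn M).
by rewrite mulr0 mul0r normr_le0 subr_eq0 => /eqP ->; rewrite seriesEord.
Qed.

Lemma inv2_small (e : R) C : 0 < e -> exists n0 : nat, forall n, (n0 <= n)%N -> C / 2 ^+ n <= e.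
Proof.
move=> e0.
have : (fun n => C * (2^-1) ^+ n) @ \oo --> (0 : R).
  rewrite -[X in _ --> X](mulr0 C); apply: cvgMl_tmp; apply: cvg_expr.
  by rewrite ger0_norm// invf_lt1// ltr1n.
move=> /cvgrPdist_le /(_ e e0) [n0 _ H]; exists n0 => n n0n.
by have := H n n0n; rewrite sub0r normrN exprVn => /(le_trans (ler_norm _)).
Qed.

(** Dominated convergence for series: the two tails beyond a large [n] are small uniformly in [t],
    and the finite head converges termwise. *)
Lemma tannery (T : Type) (F : set_system T) {FF : Filter F} (q : T -> nat -> R)
    (l : nat -> R) (C : R) M : 0 <= C ->
  (\forall t \near F, gdom C M (q t)) -> gdom C M l ->
  (forall a, q t a @[t --> F] --> l a) ->
  ssum (q t) @[t --> F] --> ssum l.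
Proof.
move=> C0 dq dl ql; apply/cvgrPdist_le => e e0.
have e3 : 0 < e / 3 by rewrite divr_gt0.
have [n0 Hn0] := inv2_small (2 * C) e3.
pose n := maxn M n0.
have Hn : 2 * C / 2 ^+ n <= e / 3 by apply: Hn0; exact: leq_maxr.
have Mn : (M <= n)%N by exact: leq_maxl.
have Hs : series (q t) n @[t --> F] --> series l n.
  rewrite seriesEord; under eq_fun do rewrite seriesEord.
  by apply: (@cvg_big _ _ _ _ _ add_continuous) => a _; exact: ql.
have Hs' : \forall t \near F, `|series l n - series (q t) n| <= e / 3.
  by move/cvgrPdist_le : Hs; apply.
near=> t.
have h1 : `|series l n - series (q t) n| <= e / 3 by near: t.
have h2 : gdom C M (q t) by near: t.
have h3 := gdom_ssum_tail C0 dl Mn; have h4 := gdom_ssum_tail C0 h2 Mn.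
have -> : ssum l - ssum (q t) = (ssum l - series l n) + (series l n - series (q t) n)
   - (ssum (q t) - series (q t) n) by ring.
apply: le_trans (ler_normB _ _) _; have := ler_normD (ssum l - series l n) (series l n - series (q t) n).
lra.
Unshelve. all: by end_near. Qed.

End series.

Section smooth_series.
Context {R : realType} {N : nat}.
Notation V := 'rV[R]_N.
Implicit Types (w : nat -> V -> R) (p v : V).

Fixpoint wordD (s : seq 'I_N) (f : V -> R) : V -> R :=
  if s is i :: s' then dd (delta_mx 0 i) (wordD s' f) else f.

Lemma wordD_rcons s i f : wordD (rcons s i) f = wordD s (dd (delta_mx 0 i) f).
Proof. by elim: s => //= j s ->. Qed.

Lemma smooth_wordD s f : smooth f -> smooth (wordD s f).
Proof. by move=> sf; elim: s => //= i s IH; exact: smooth_D. Qed.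

Lemma wordD_sum (I : Type) (r : seq I) (c : I -> R) (F : I -> V -> R) s p :
  (forall i, smooth (F i)) ->
  wordD s (fun p => \sum_(i <- r) c i * F i p) p = \sum_(i <- r) c i * wordD s (F i) p.
Proof.
move=> sF; elim: s p => [//|j s IH] p /=.
rewrite (_ : wordD s _ = fun p => \sum_(i <- r) c i * wordD s (F i) p); last exact/funext.
rewrite derive_bigsum; last first.
  by move=> i _; apply: smooth_mul; [exact: smooth_cst|exact: smooth_wordD].
by apply: eq_bigr => i _; rewrite derive_cmul//; exact: smooth_wordD.
Qed.

Definition geodom w := forall (rho : R), exists C M, 0 <= C /\
  forall p, `|p| <= rho -> gdom C M (w ^~ p).

Definition ssumf w p := ssum (w ^~ p).

(** Domination is asked of all iterated partial derivatives, so the class is closed under [dd] and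
    term-by-term differentiation can be repeated. *)
Definition sdom w := (forall a, smooth (w a)) /\ forall s, geodom (fun a => wordD s (w a)).

Lemma sdom_geodom w : sdom w -> geodom w.
Proof. by case=> _ /(_ [::]). Qed.

Lemma sdom_dd w v : sdom w -> sdom (fun a => dd v (w a)).
Proof.
move=> [sw dw]; split=> [a|s rho]; first exact: smooth_D.
have /choice[CM H] : forall i : 'I_N, exists CM : R * nat, 0 <= CM.1 /\
    forall p, `|p| <= rho -> gdom CM.1 CM.2 (fun a => wordD (rcons s i) (w a) p).
  by move=> i; have [C [M H]] := dw (rcons s i) rho; exists (C, M).
exists (\sum_i `|v 0 i| * (CM i).1), (\max_i (CM i).2)%N; split.
  by apply: sumr_ge0 => i _; rewrite mulr_ge0//; case: (H i).
move=> p prho a Ma /=.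
rewrite (_ : dd v (w a) = fun p => \sum_i v 0 i * dd (delta_mx 0 i) (w a) p); last first.
  by apply/funext => q; rewrite derive_coords.
rewrite wordD_sum; last by move=> i; exact: smooth_D.
rewrite (le_trans (ler_norm_sum _ _ _))// mulr_suml ler_sum// => i _.
rewrite normrM -mulrA ler_wpM2l// -wordD_rcons.
case: (H i) => _ /(_ p prho); apply.
by apply: leq_trans Ma; exact: leq_bigmax.
Qed.

Lemma ball_norm_le p : \forall q \near p, `|q| <= `|p| + 1.
Proof.
apply/nbhs_ballP; exists 1 => //= q; rewrite -ball_normE/= => h.
have := ler_distD p q 0; rewrite !subr0 distrC; lra.
Qed.

Lemma ssumf_continuous w : (forall a, continuous (w a)) -> geodom w ->
  continuous (ssumf w).
Proof.
move=> cw dw p; have [C [M [C0 H]]] := dw (`|p| + 1).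
apply: (@tannery _ V (nbhs p) _ (fun q a => w a q) _ C M C0).
- by apply: filterS (ball_norm_le p) => q; exact: H.
- by apply: H; rewrite lerDl.
- by move=> a; exact: cw.
Qed.

(** [tannery] is applied to the difference quotients. By the mean value theorem each is a derivative
    at [t *: v + p] with [|t| < 1], a point of the ball of radius [|p| + |v|], where the
    differentiated series is dominated. *)
Lemma ssumf_is_derive w p v : sdom w ->
  is_derive p v (ssumf w) (ssumf (fun a => dd v (w a)) p).
Proof.
move=> sdw; have [sw _] := sdw; have dw := sdom_geodom sdw.
have dDw := sdom_geodom (sdom_dd v sdw).
have [C [M [C0 H]]] := dDw (`|p| + `|v|).
have cw q : cvgn (series (w ^~ q)).
  by have [C' [M' [C0' H']]] := dw `|q|; exact: gdom_cvg C0' (H' q (lexx _)).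
apply: cvg_is_derive.
have := @tannery _ R (0^')%classic _ (fun h a => h^-1 * (w a (h *: v + p) - w a p))
  (fun a => dd v (w a) p) C M C0.
have -> : (fun h : R => h^-1 *: (ssumf w (h *: v + p) - ssumf w p)) =
   (fun h : R => ssum (fun a => h^-1 * (w a (h *: v + p) - w a p))).
  apply/funext => h; rewrite ssumZ; last exact: is_cvg_seriesB.
  by rewrite ssumB.
apply.
- near=> h => a Ma.
  have h0 : h != 0 by near: h; exact: nbhs_dnbhs_neq.
  have h1 : `|h| < 1 by near: h; exact: dnbhs0_lt.
  have [t th ->] := @MVT_line _ _ (w a) p v h (fun q => smooth_derivable (sw a)).
  rewrite mulKf//; apply: H => //.
  rewrite (le_trans (ler_normD _ _))// addrC lerD2l normrZ ler_piMl//.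
  by apply: le_trans th _; exact: ltW.
- by apply: H; rewrite lerDl.
- by move=> a; apply: is_derive_cvg; exact: smooth_derivable.
Unshelve. all: by end_near. Qed.

Lemma smooth_ssumf w : sdom w -> smooth (ssumf w).
Proof.
move=> sdw; apply: (@smoothP _ _ (fun f => exists2 w, sdom w & f = ssumf w)).
- move=> _ [u su ->]; apply: ssumf_continuous; last exact: sdom_geodom.
  by move=> a; apply: smooth_continuous; case: su.
- move=> _ v [u su ->]; split=> [p|].
    by case: (ssumf_is_derive p v su).
  exists (fun a => dd v (u a)); first exact: sdom_dd.
  by apply/funext => p; case: (ssumf_is_derive p v su).
- by exists w.
Qed.

Lemma dd_ssumf w p v : sdom w -> dd v (ssumf w) p = ssumf (fun a => dd v (w a)) p.
Proof. by move=> sdw; case: (ssumf_is_derive p v sdw). Qed.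

End smooth_series.

(** * Linear vector fields, scalings and Taylor expansion *)

Opaque I01.

Section vector_fields.
Context {R : realType} {N : nat}.
Notation V := 'rV[R]_N.
Implicit Types (f g u w : V -> R) (p v : V) (L M : V -> V) (k i : 'I_N).

Definition vf L f p : R := dd (L p) f p.

Lemma lin0 L : linear L -> L 0 = 0.
Proof.
move=> lL; have := lL 1 0 0; rewrite !scale1r addr0 => /eqP.
by rewrite -subr_eq0 opprD addrA subrr add0r oppr_eq0 => /eqP.
Qed.

Lemma linZ L (a : R) v : linear L -> L (a *: v) = a *: L v.
Proof. by move=> lL; have := lL a v 0; rewrite addr0 (lin0 lL) addr0. Qed.

Lemma linD L v (w : V) : linear L -> L (v + w) = L v + L w.
Proof. by move=> lL; have := lL 1 v w; rewrite !scale1r. Qed.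

Lemma vfE L f p : smooth f -> vf L f p = \sum_i L p 0 i * dd (delta_mx 0 i) f p.
Proof. by move=> sf; rewrite /vf derive_coords. Qed.

Lemma smooth_vf L f : linear L -> smooth f -> smooth (vf L f).
Proof.
move=> lL sf; rewrite (_ : vf L f = fun p => \sum_i L p 0 i * dd (delta_mx 0 i) f p); last first.
  by apply/funext => p; exact: vfE.
apply: smooth_sum => i _; apply: smooth_mul; last exact: smooth_D.
exact: (@smooth_lin_comp _ _ L (fun q => q 0 i) lL (smooth_coord i)).
Qed.

Lemma vfD L f g p : smooth f -> smooth g -> vf L (fun p => f p + g p) p = vf L f p + vf L g p.
Proof. by move=> sf sg; exact: derive_add. Qed.

Lemma vfB L f g p : smooth f -> smooth g -> vf L (fun p => f p - g p) p = vf L f p - vf L g p.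
Proof. by move=> sf sg; exact: derive_sub. Qed.

Lemma vfM L f g p : smooth f -> smooth g ->
  vf L (fun p => f p * g p) p = f p * vf L g p + g p * vf L f p.
Proof. by move=> sf sg; exact: derive_mul. Qed.

Lemma vfZ L (c : R) f p : smooth f -> vf L (fun p => c * f p) p = c * vf L f p.
Proof. by move=> sf; exact: derive_cmul. Qed.

Lemma vf_sum L (I : Type) (r : seq I) (P : pred I) (F : I -> V -> R) p :
  (forall j, P j -> smooth (F j)) ->
  vf L (fun p => \sum_(j <- r | P j) F j p) p = \sum_(j <- r | P j) vf L (F j) p.
Proof. by move=> sF; exact: derive_bigsum. Qed.

(** The bracket of a constant field with a linear one: Leibniz on the coefficients of [L] yields the
    constant field [L v], and [schwarz] exchanges the second derivatives. *)
Lemma dd_vf L f p v : linear L -> smooth f ->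
  dd v (vf L f) p = dd (L v) f p + vf L (dd v f) p.
Proof.
move=> lL sf; rewrite (_ : vf L f = fun p => \sum_i L p 0 i * dd (delta_mx 0 i) f p); last first.
  by apply/funext => q; exact: vfE.
have sL i : smooth (fun q => L q 0 i).
  exact: (@smooth_lin_comp _ _ L (fun q => q 0 i) lL (smooth_coord i)).
rewrite derive_bigsum; last first.
  by move=> i _; apply: smooth_mul; [exact: sL|exact: smooth_D].
rewrite (derive_coords p (L v) sf) (vfE _ _ (smooth_D v sf)) -big_split/=.
apply: eq_bigr => i _; rewrite (@derive_mul _ _ (fun q => L q 0 i) (dd (delta_mx 0 i) f))//; last exact: smooth_D.
rewrite (derive_lin_comp (fun q : V => q 0 i) p v lL) derive_coord.
by rewrite (schwarz p v (delta_mx 0 i) sf) [LHS]addrC [X in X + _]mulrC.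
Qed.

(** By [dd_vf] both sides consist of a symmetric second-order part and a first-order part along
    [M (L p)] or [L (M p)]. *)
Lemma vf_comm L M f p : linear L -> linear M -> (forall q, L (M q) = M (L q)) -> smooth f ->
  vf L (vf M f) p = vf M (vf L f) p.
Proof.
move=> lL lM LM sf.
apply: (etrans (dd_vf p (L p) lM sf)); apply: esym.
apply: (etrans (dd_vf p (M p) lL sf)).
by rewrite LM /vf (schwarz p (L p) (M p) sf).
Qed.

Lemma vf_lin_comp L (S : V -> V) f p : linear S -> (forall q, S (L q) = L (S q)) ->
  vf L (fun q => f (S q)) p = vf L f (S p).
Proof. by move=> lS SL; rewrite /vf derive_lin_comp// SL. Qed.

Lemma vf_I01 L (K : R -> V -> R) p : psmooth K ->
  vf L (fun q => I01 (K ^~ q)) p = I01 (fun s => vf L (K s) p).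
Proof. by move=> sK; exact: I01_derive. Qed.

End vector_fields.

(** * Scalings, Euler fields and Taylor expansion in a group of variables *)

Section scaling.
Context {R : realType} {N : nat}.
Notation V := 'rV[R]_N.
Implicit Types (f g u w : V -> R) (p v : V) (L : V -> V) (k i : 'I_N) (s t : R) (C D : {set 'I_N}).

Definition sc C s p : V := \row_k (if k \in C then s * p 0 k else p 0 k).
(** Seen as a vector field this is the Euler field of the variables in [C], the generator of the
    scalings [sc C s]. *)
Definition eul C p : V := \row_k (if k \in C then p 0 k else 0).

Lemma sc_linear C s : linear (sc C s).
Proof. by move=> a u v; apply/rowP => k; rewrite !mxE; case: ifP => // _; ring. Qed.

Lemma eul_linear C : linear (eul C).
Proof. by move=> a u v; apply/rowP => k; rewrite !mxE; case: ifP => // _; ring. Qed.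

Lemma scE C s p : sc C s p = s *: eul C p + sc C 0 p.
Proof. by apply/rowP => k; rewrite !mxE; case: ifP => // _; ring. Qed.

Lemma sc1 C p : sc C 1 p = p.
Proof. by apply/rowP => k; rewrite !mxE; case: ifP => // _; rewrite mul1r. Qed.

Lemma sc_sc C s t p : sc C s (sc C t p) = sc C (s * t) p.
Proof. by apply/rowP => k; rewrite !mxE; case: (k \in C); rewrite ?mulrA. Qed.

Lemma sc_comm C D s t p : sc C s (sc D t p) = sc D t (sc C s p).
Proof. by apply/rowP => k; rewrite !mxE; do 2 case: ifP => // _; ring. Qed.

Lemma sc_eul C D s p : sc C s (eul D p) = eul D (sc C s p).
Proof. by apply/rowP => k; rewrite !mxE; do 2 case: ifP => // _; ring. Qed.

Lemma eul_sc C s p : eul C (sc C s p) = s *: eul C p.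
Proof. by apply/rowP => k; rewrite !mxE; case: (k \in C); rewrite ?mulr0. Qed.

Lemma eul_delta C i : eul C (delta_mx 0 i) = if i \in C then delta_mx 0 i else 0.
Proof.
apply/rowP => k; rewrite !mxE; case: (ifP (i \in C)) => iC; rewrite ?mxE/=;
by case: eqVneq => [->|_]; rewrite ?iC//; case: ifP.
Qed.

Lemma sc_delta C s i : sc C s (delta_mx 0 i) = (if i \in C then s else 1) *: delta_mx 0 i.
Proof.
apply/rowP => k; rewrite !mxE/=; case: eqVneq => [->|_]; last by rewrite !mulr0; case: ifP.
by case: ifP; rewrite ?mulr1.
Qed.

Lemma sc_joint_continuous C : continuous (fun z : R * V => sc C z.1 z.2).
Proof.
move=> z.
have h : x.1 *: eul C x.2 + sc C 0 x.2 @[x --> z] --> z.1 *: eul C z.2 + sc C 0 z.2.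
  have c1 : eul C x.2 @[x --> z] --> eul C z.2.
    apply: (cvg_comp (fun x : R * V => x.2) (eul C) cvg_snd).
    exact: (linear_row_continuous (eul_linear C)).
  have c2 : sc C 0 x.2 @[x --> z] --> sc C 0 z.2.
    apply: (cvg_comp (fun x : R * V => x.2) (sc C 0) cvg_snd).
    exact: (linear_row_continuous (sc_linear C 0)).
  apply: (@cvgD R V _ _ _ (fun x : R * V => x.1 *: eul C x.2) (fun x : R * V => sc C 0 x.2)); last exact: c2.
  exact: (@cvgZ R V _ _ _ (fun x : R * V => x.1) (fun x : R * V => eul C x.2) _ _ cvg_fst c1).
rewrite (_ : (fun z : R * V => _) = (fun x => x.1 *: eul C x.2 + sc C 0 x.2)); first exact: h.
by apply/funext => x; rewrite scE.
Qed.

Lemma norm_row_le p (r : R) : 0 <= r -> (forall k, `|p 0 k| <= r) -> `|p| <= r.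
Proof.
move=> r0 H; rewrite [leLHS]/Num.Def.normr/= mx_normrE; apply: bigmax_le => // -[i j] _ /=.
by rewrite (ord1 i).
Qed.

Lemma coord_norm_le p k : `|p 0 k| <= `|p|.
Proof.
rewrite [leRHS]/Num.Def.normr/= mx_normrE.
exact: (le_bigmax _ (fun ij : 'I_1 * 'I_N => `|p ij.1 ij.2|) (0, k)).
Qed.

Lemma norm_sc C s p : 0 <= s <= 1 -> `|sc C s p| <= `|p|.
Proof.
move=> /andP[s0 s1]; apply: norm_row_le => // k; rewrite mxE; case: ifP => _; last exact: coord_norm_le.
rewrite normrM ger0_norm//; apply: le_trans (coord_norm_le p k).
by rewrite ler_piMl.
Qed.

Lemma psmooth_sc C (c : R -> R) f : continuous c -> smooth f ->
  psmooth (fun s p => c s * f (sc C s p)).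
Proof.
by move=> cc sf; apply: psmooth_lin => //; [exact: sc_linear|exact: sc_joint_continuous].
Qed.

Lemma psmooth_sc1 C f : smooth f -> psmooth (fun s p => f (sc C s p)).
Proof.
move=> sf; rewrite (_ : (fun s p => _) = (fun s p => 1 * f (sc C s p))).
  by apply: psmooth_sc => //; exact: cst_continuous.
by apply/funext => s; apply/funext => p; rewrite mul1r.
Qed.

Lemma smooth_sc C s f : smooth f -> smooth (fun p => f (sc C s p)).
Proof. by move=> sf; apply: smooth_lin_comp => //; exact: sc_linear. Qed.

Lemma sc_is_derive C f p t : smooth f ->
  is_derive t 1 (fun s => f (sc C s p)) (dd (eul C p) f (sc C t p)).
Proof.
move=> sf; rewrite (_ : (fun s => _) = (fun s => f (s *: eul C p + sc C 0 p))); last first.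
  by apply/funext => s; rewrite -scE.
by rewrite (scE C t); apply: derivable_line; exact: smooth_derivable.
Qed.

Definition avg C f p := I01 (fun s => f (sc C s p)).

Lemma smooth_avg C f : smooth f -> smooth (avg C f).
Proof. by move=> sf; exact: smooth_I01 (psmooth_sc1 C sf). Qed.

(** [avg C] inverts [1 + E_C], where [E_C] is the Euler field: the derivative of [s * f (sc C s p)]
    in [s] is [f + E_C f] at [sc C s p], and it is integrated over [0, 1]. *)
Lemma avg_euler C f p : smooth f -> f p = avg C f p + vf (eul C) (avg C f) p.
Proof.
move=> sf.
have -> : vf (eul C) (avg C f) p = I01 (fun s => vf (eul C) f (sc C s p)).
  rewrite /avg vf_I01; last exact: psmooth_sc1.
  by apply: eq_I01 => s _; rewrite vf_lin_comp//; [exact: sc_linear|move=> q; exact: sc_eul].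
have c1 : continuous (fun s => f (sc C s p)) by exact: psmooth_continuous1 (psmooth_sc1 C sf).
have c2 : continuous (fun s => vf (eul C) f (sc C s p)).
  exact: psmooth_continuous1 (psmooth_sc1 C (smooth_vf (eul_linear C) sf)).
rewrite /avg -I01D//.
have dF s : is_derive s 1 (fun s => s * f (sc C s p)) (f (sc C s p) + vf (eul C) f (sc C s p)).
  apply: (is_derive_eq (is_deriveM (is_derive_id s 1) (sc_is_derive C p s sf))).
  by rewrite /vf eul_sc derive_homog// -![_ *: _]/(_ * _) mulr1 addrC.
have cF : continuous (fun s => f (sc C s p) + vf (eul C) f (sc C s p)).
  by move=> s; apply: cvgD; [exact: c1|exact: c2].
by rewrite (I01_FTC cF dF) sc1 mul1r mul0r subr0.
Qed.

Lemma avgD C f g p : smooth f -> smooth g ->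
  avg C (fun p => f p + g p) p = avg C f p + avg C g p.
Proof.
move=> sf sg; rewrite /avg -I01D//.
- exact: psmooth_continuous1 (psmooth_sc1 C sf).
- exact: psmooth_continuous1 (psmooth_sc1 C sg).
Qed.

Lemma avgZ C (c : R) f p : smooth f -> avg C (fun p => c * f p) p = c * avg C f p.
Proof.
move=> sf; rewrite /avg -I01Z//; exact: psmooth_continuous1 (psmooth_sc1 C sf).
Qed.

Lemma vf_avg C L f p : (forall s q, sc C s (L q) = L (sc C s q)) -> smooth f ->
  vf L (avg C f) p = avg C (vf L f) p.
Proof.
move=> SL sf; rewrite /avg vf_I01; last exact: psmooth_sc1.
by apply: eq_I01 => s _; rewrite vf_lin_comp//; exact: sc_linear.
Qed.

Lemma avg_sc C D f t p : avg C (fun q => f (sc D t q)) p = avg C f (sc D t p).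
Proof. by apply: eq_I01 => s _; rewrite sc_comm. Qed.

Definition at0 C f p := f (sc C 0 p).

Definition pd i f := dd (delta_mx 0 i) f.

Definition Bop C i f := avg C (pd i f).

Lemma smooth_Bop C i f : smooth f -> smooth (Bop C i f).
Proof. by move=> sf; apply: smooth_avg; exact: smooth_D. Qed.

(** Hadamard's lemma along the segment from [sc C 0 p] to [p]. Its coefficients [Bop C i f] are
    smooth, so it can be iterated; the Taylor operators below are this iteration. *)
Lemma hadamard C f p : smooth f ->
  f p = at0 C f p + \sum_(i in C) p 0 i * Bop C i f p.
Proof.
move=> sf; rewrite /at0.
have dF s : is_derive s 1 (fun s => f (sc C s p)) (\sum_(i in C) p 0 i * pd i f (sc C s p)).
  apply: (is_derive_eq (sc_is_derive C p s sf)).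
  rewrite (derive_coords _ _ sf) (bigID (fun i => i \in C))/= [X in _ + X]big1 ?addr0; last first.
    by move=> i /negbTE iC; rewrite mxE iC mul0r.
  by apply: eq_bigr => i iC; rewrite mxE iC.
have cS i : continuous (fun s => pd i f (sc C s p)).
  exact: psmooth_continuous1 (psmooth_sc1 C (smooth_D _ sf)).
have cF : continuous (fun s => \sum_(i in C) p 0 i * pd i f (sc C s p)).
  move=> s; apply: (@cvg_big _ _ _ _ _ add_continuous) => i _; apply: cvgMl_tmp; exact: cS.
have := I01_FTC cF dF; rewrite sc1 => /eqP; rewrite eq_sym subr_eq addrC => /eqP {1}->.
congr (_ + _).
have G (r : seq 'I_N) : I01 (fun s => \sum_(i <- r | i \in C) p 0 i * pd i f (sc C s p)) =
    \sum_(i <- r | i \in C) p 0 i * Bop C i f p.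
  elim: r => [|i r IH].
    by rewrite big_nil -[RHS](I01_cst 0); apply: eq_I01 => s _; rewrite big_nil.
  rewrite big_cons; under [LHS]eq_I01 => s _ do rewrite big_cons.
  case: (i \in C) => //; rewrite -IH I01D; last 2 first.
  - by move=> s; apply: cvgMl_tmp; exact: cS.
  - move=> s; apply: (@cvg_big _ _ _ _ _ add_continuous) => j _; apply: cvgMl_tmp; exact: cS.
  by rewrite I01Z//; exact: cS.
exact: G.
Qed.

(* In the variables of [C]: [Pop] is the Taylor part of degree [a], [Rop] the
   remainder of order [a], and [Qop] solves [(E_C - a) Q = f - Pop C a f]
   (see [QopP]). *)
Fixpoint Pop C a f p : R :=
  if a is a'.+1 then \sum_(i in C) p 0 i * Pop C a' (Bop C i f) p else at0 C f p.

Fixpoint Rop C a f p : R :=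
  if a is a'.+1 then \sum_(i in C) p 0 i * Rop C a' (Bop C i f) p else f p.

Fixpoint Qop C a f p : R :=
  if a is a'.+1 then
    \sum_(i in C) p 0 i * Qop C a' (Bop C i f) p - a'.+1%:R^-1 * at0 C f p
  else \sum_(i in C) p 0 i * avg C (Bop C i f) p.

Lemma sc_coord C s p k : sc C s p 0 k = if k \in C then s * p 0 k else p 0 k.
Proof. exact: mxE. Qed.

Opaque sc.

Lemma smooth_at0 C f : smooth f -> smooth (at0 C f).
Proof. exact: smooth_sc. Qed.

Lemma smooth_coordM i f : smooth f -> smooth (fun p => p 0 i * f p).
Proof. by move=> sf; apply: smooth_mul => //; exact: smooth_coord. Qed.

Lemma smooth_Pop C a f : smooth f -> smooth (Pop C a f).
Proof.
elim: a f => [|a IH] f sf; first exact: smooth_at0.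
apply: smooth_sum => i _; apply: smooth_coordM; apply: IH; exact: smooth_Bop.
Qed.

Lemma smooth_Rop C a f : smooth f -> smooth (Rop C a f).
Proof.
elim: a f => [|a IH] f sf //.
apply: smooth_sum => i _; apply: smooth_coordM; apply: IH; exact: smooth_Bop.
Qed.

Lemma smooth_Qop C a f : smooth f -> smooth (Qop C a f).
Proof.
elim: a f => [|a IH] f sf.
  by apply: smooth_sum => i _; apply: smooth_coordM; apply: smooth_avg; exact: smooth_Bop.
apply: smooth_sub.
  by apply: smooth_sum => i _; apply: smooth_coordM; apply: IH; exact: smooth_Bop.
by apply: smooth_mul; [exact: smooth_cst|exact: smooth_at0].
Qed.

Lemma taylor C a f p : smooth f -> f p = \sum_(b < a) Pop C b f p + Rop C a f p.
Proof.
elim: a f p => [|a IH] f p sf; first by rewrite big_ord0 add0r.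
rewrite big_ord_recl/= (hadamard C p sf) -addrA; congr (_ + _).
rewrite exchange_big/= -big_split/=; apply: eq_bigr => i _.
by rewrite -mulr_sumr -mulrDr -IH//; exact: smooth_Bop.
Qed.

Lemma vf_coordM L i f p : smooth f ->
  vf L (fun p => p 0 i * f p) p = p 0 i * vf L f p + f p * L p 0 i.
Proof.
move=> sf; rewrite vfM//; last exact: smooth_coord.
by rewrite {2}/vf derive_coord.
Qed.

Lemma vf_at0_eul C f p : vf (eul C) (at0 C f) p = 0.
Proof.
rewrite /at0 vf_lin_comp; [|exact: sc_linear|by move=> q; exact: sc_eul].
by rewrite /vf eul_sc scale0r dd0.
Qed.

(** Write [E] for the Euler field; [E x_i = x_i] for [i] in [C]. In degree 0,
    [x_i (1 + E) u = E (x_i u)] with [u] the average of [Bop C i f]. In the step,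
    [x_i (E - a) u = (E - (a + 1)) (x_i u)] treats the sum in [hadamard], and the term [at0 C f],
    which [E] annihilates, is recovered from [- at0 C f / (a + 1)]. *)
Lemma QopP C a f p : smooth f ->
  f p = Pop C a f p + (vf (eul C) (Qop C a f) p - a%:R * Qop C a f p).
Proof.
elim: a f p => [|a IH] f p sf.
  rewrite mul0r subr0 {1}(hadamard C p sf)/=; congr (_ + _).
  rewrite (@vf_sum _ _ _ _ _ _ (fun (i : 'I_N) q => q 0 i * avg C (Bop C i f) q) p); last first.
    by move=> i _; apply: smooth_coordM; apply: smooth_avg; exact: smooth_Bop.
  apply: eq_bigr => i iC; rewrite vf_coordM; last by apply: smooth_avg; exact: smooth_Bop.
  rewrite mxE iC {1}(avg_euler C p (smooth_Bop C i sf)).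
  by rewrite mulrDr addrC [X in _ + X]mulrC.
rewrite {1}(hadamard C p sf) /=.
set a1 : R := a.+1%:R; have a10 : a1 != 0 by rewrite pnatr_eq0.
have sQ i : smooth (Qop C a (Bop C i f)) by apply: smooth_Qop; exact: smooth_Bop.
rewrite vfB; last 2 first.
- by apply: smooth_sum => i _; exact: smooth_coordM.
- by apply: smooth_mul; [exact: smooth_cst|exact: smooth_at0].
rewrite vfZ; last exact: smooth_at0.
rewrite vf_at0_eul mulr0 subr0.
rewrite (@vf_sum _ _ _ _ _ _ (fun (i : 'I_N) q => q 0 i * Qop C a (Bop C i f) q) p); last first.
  by move=> i _; exact: smooth_coordM.
have -> : \sum_(i in C) p 0 i * Bop C i f p = \sum_(i in C) p 0 i * Pop C a (Bop C i f) p +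
   \sum_(i in C) vf (eul C) (fun q => q 0 i * Qop C a (Bop C i f) q) p -
   a1 * \sum_(i in C) p 0 i * Qop C a (Bop C i f) p.
  rewrite mulr_sumr -big_split/= -sumrB; apply: eq_bigr => i iC.
  rewrite vf_coordM// mxE iC {1}(IH _ p (smooth_Bop C i sf)) /a1 -natr1.
  by ring.
by rewrite mulrBr mulrA mulfV// mul1r; ring.
Qed.

Lemma pdD i f g p : smooth f -> smooth g -> pd i (fun p => f p + g p) p = pd i f p + pd i g p.
Proof. exact: derive_add. Qed.

Lemma pdZ i (c : R) f p : smooth f -> pd i (fun p => c * f p) p = c * pd i f p.
Proof. exact: derive_cmul. Qed.

Lemma BopD C i f g : smooth f -> smooth g ->
  Bop C i (fun p => f p + g p) = fun p => Bop C i f p + Bop C i g p.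
Proof.
move=> sf sg; apply/funext => p; rewrite /Bop -avgD; try exact: smooth_D.
by apply: eq_I01 => s _; exact: pdD.
Qed.

Lemma BopZ C i (c : R) f : smooth f -> Bop C i (fun p => c * f p) = fun p => c * Bop C i f p.
Proof.
move=> sf; apply/funext => p; rewrite /Bop -avgZ; try exact: smooth_D.
by apply: eq_I01 => s _; exact: pdZ.
Qed.

Lemma PopD C a f g p : smooth f -> smooth g ->
  Pop C a (fun p => f p + g p) p = Pop C a f p + Pop C a g p.
Proof.
elim: a f g p => [//|a IH] f g p sf sg /=; rewrite -big_split/=; apply: eq_bigr => i _.
by rewrite (BopD C i sf sg) (IH _ _ p (smooth_Bop C i sf) (smooth_Bop C i sg)) mulrDr.
Qed.

Lemma PopZ C a (c : R) f p : smooth f -> Pop C a (fun p => c * f p) p = c * Pop C a f p.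
Proof.
elim: a f p => [//|a IH] f p sf /=; rewrite mulr_sumr; apply: eq_bigr => i _.
by rewrite (BopZ C i c sf) (IH _ p (smooth_Bop C i sf)) mulrCA.
Qed.

Lemma QopZ C a (c : R) f p : smooth f -> Qop C a (fun p => c * f p) p = c * Qop C a f p.
Proof.
elim: a f p => [|a IH] f p sf /=.
  rewrite mulr_sumr; apply: eq_bigr => i _.
  by rewrite (BopZ C i c sf) (avgZ C c p (smooth_Bop C i sf)) mulrCA.
rewrite mulrBr mulr_sumr; f_equal; last by rewrite /at0; ring.
apply: eq_bigr => i _.
by rewrite (BopZ C i c sf) (IH _ p (smooth_Bop C i sf)) mulrCA.
Qed.

Lemma pd_sc C i s f p : smooth f ->
  pd i (fun q => f (sc C s q)) p = (if i \in C then s else 1) * pd i f (sc C s p).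
Proof.
move=> sf; rewrite /pd (derive_lin_comp f p _ (sc_linear C s)) sc_delta.
exact: derive_homog.
Qed.

Definition disj C D := forall i, i \in C -> (i \in D) = false.

Lemma Bop_sc C D i t f : disj C D -> i \in C -> smooth f ->
  Bop C i (fun q => f (sc D t q)) = fun q => Bop C i f (sc D t q).
Proof.
move=> CD iC sf; have iD : (i \in D) = false by exact: (CD _).
apply/funext => p; rewrite /Bop -(avg_sc C D (pd i f) t p); apply: eq_I01 => s _.
by rewrite pd_sc// iD mul1r.
Qed.

Lemma Pop_sc C D a t f p : disj C D -> smooth f ->
  Pop C a (fun q => f (sc D t q)) p = Pop C a f (sc D t p).
Proof.
move=> CD; elim: a f p => [|a IH] f p sf /=; first by rewrite /at0 sc_comm.
apply: eq_bigr => i iC.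
have E := etrans (congr1 (fun h => Pop C a h p) (Bop_sc t CD iC sf)) (IH _ p (smooth_Bop C i sf)).
apply: (etrans (congr1 (fun x => p 0 i * x) E)).
by rewrite (sc_coord D t p i) (CD _ iC).
Qed.

Lemma Qop_sc C D a t f p : disj C D -> smooth f ->
  Qop C a (fun q => f (sc D t q)) p = Qop C a f (sc D t p).
Proof.
move=> CD; elim: a f p => [|a IH] f p sf /=.
  apply: eq_bigr => i iC.
  have E := etrans (congr1 (fun h => avg C h p) (Bop_sc t CD iC sf)) (avg_sc C D (Bop C i f) t p).
  apply: (etrans (congr1 (fun x => p 0 i * x) E)).
  by rewrite (sc_coord D t p i) (CD _ iC).
f_equal; last by rewrite /at0 sc_comm.
apply: eq_bigr => i iC.
have E := etrans (congr1 (fun h => Qop C a h p) (Bop_sc t CD iC sf)) (IH _ p (smooth_Bop C i sf)).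
apply: (etrans (congr1 (fun x => p 0 i * x) E)).
by rewrite (sc_coord D t p i) (CD _ iC).
Qed.

Lemma Pop_homog C a t f p : Pop C a f (sc C t p) = t ^+ a * Pop C a f p.
Proof.
elim: a f p => [|a IH] f p /=.
  by rewrite mul1r /at0 sc_sc mul0r.
rewrite mulr_sumr; apply: eq_bigr => i iC; rewrite IH sc_coord iC exprS; ring.
Qed.

Definition homog C a f := forall t p, f (sc C t p) = t ^+ a * f p.

Lemma homog_euler C a f p : smooth f -> homog C a f -> vf (eul C) f p = a%:R * f p.
Proof.
move=> sf hf.
have [_ E] := sc_is_derive C p 1 sf; rewrite sc1 in E; rewrite /vf -E.
rewrite (_ : (fun s => f (sc C s p)) = (fun s => s ^+ a * f p)); last first.
  by apply/funext => s; exact: hf.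
have dX : is_derive (1 : R) 1 (fun s : R => s ^+ a) (a%:R).
  apply: DeriveDef; first exact: exprn_derivable.
  by rewrite exp_derive expr1n -![_ *: _]/(_ * _) !mulr1.
have [_ ->] := is_deriveM dX (is_derive_cst (f p) (1 : R) (1 : R)).
by rewrite scaler0 add0r [_ *: _]mulrC.
Qed.

(** An operator in the variables of [C] commutes with scaling those of [D] and with the scalar
    [t ^+ b]. *)
Lemma homog_Pop_disj C D a b f : disj C D -> smooth f -> homog D b f ->
  homog D b (Pop C a f).
Proof.
move=> CD sf hf t p; rewrite -(Pop_sc a t p CD sf) -(PopZ C a _ p sf).
rewrite (_ : (fun q => f (sc D t q)) = (fun q => t ^+ b * f q)) //.
by apply/funext => q; exact: hf.
Qed.

Lemma homog_Qop_disj C D a b f : disj C D -> smooth f -> homog D b f ->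
  homog D b (Qop C a f).
Proof.
move=> CD sf hf t p; rewrite -(Qop_sc a t p CD sf) -(QopZ C a _ p sf).
rewrite (_ : (fun q => f (sc D t q)) = (fun q => t ^+ b * f q)) //.
by apply/funext => q; exact: hf.
Qed.

(** In matrix terms, the rows and the columns of [L] indexed by [C] vanish: the field neither moves
    the variables of [C] nor depends on them. *)
Definition off C L := (forall p k, k \in C -> L p 0 k = 0) /\
  (forall i, i \in C -> L (delta_mx 0 i) = 0).

Lemma off_sc C L s q : linear L -> off C L -> sc C s (L q) = L (sc C s q).
Proof.
move=> lL [L1 L2].
have -> : sc C s (L q) = L q.
  by apply/rowP => k; rewrite sc_coord; case: ifP => // kC; rewrite (L1 _ _ kC) mulr0.
rewrite [in LHS](lin_sum q lL) [in RHS](lin_sum (sc C s q) lL); apply: eq_bigr => i _.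
by rewrite sc_coord; case: ifP => // iC; rewrite L2// !scaler0.
Qed.

Lemma off_eul C D : disj C D -> off C (eul D).
Proof.
move=> CD; split=> [p k kC|i iC]; first by rewrite mxE (CD _ kC).
by rewrite eul_delta (CD _ iC).
Qed.

Lemma pd_vf_off C L i f p : linear L -> off C L -> i \in C -> smooth f ->
  pd i (vf L f) p = vf L (pd i f) p.
Proof.
move=> lL [_ L2] iC sf; apply: (etrans (dd_vf p (delta_mx 0 i) lL sf)).
by rewrite L2// dd0 add0r.
Qed.

Lemma vf_Bop C L i f : linear L -> off C L -> i \in C -> smooth f ->
  vf L (Bop C i f) = Bop C i (vf L f).
Proof.
move=> lL oL iC sf; apply/funext => p; rewrite /Bop vf_avg; last exact: smooth_D.
- by apply: eq_I01 => s _; rewrite (pd_vf_off _ lL oL iC sf).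
- by move=> s q; exact: off_sc.
Qed.

Lemma vf_at0 C L f p : linear L -> off C L -> vf L (at0 C f) p = at0 C (vf L f) p.
Proof.
move=> lL oL; rewrite /at0 vf_lin_comp//; first exact: sc_linear.
by move=> q; exact: off_sc.
Qed.

Lemma vf_Pop C L a f p : linear L -> off C L -> smooth f ->
  vf L (Pop C a f) p = Pop C a (vf L f) p.
Proof.
move=> lL oL; elim: a f p => [|a IH] f p sf /=; first exact: vf_at0.
rewrite (@vf_sum _ _ _ _ _ _ (fun (i : 'I_N) q => q 0 i * Pop C a (Bop C i f) q) p); last first.
  by move=> i _; apply: smooth_coordM; apply: smooth_Pop; exact: smooth_Bop.
apply: eq_bigr => i iC; rewrite vf_coordM; last by apply: smooth_Pop; exact: smooth_Bop.
by rewrite (oL.1 _ _ iC) mulr0 addr0 (IH _ p (smooth_Bop C i sf)) (vf_Bop lL oL iC sf).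
Qed.

Lemma vf_Qop C L a f p : linear L -> off C L -> smooth f ->
  vf L (Qop C a f) p = Qop C a (vf L f) p.
Proof.
move=> lL oL; elim: a f p => [|a IH] f p sf /=.
  rewrite (@vf_sum _ _ _ _ _ _ (fun (i : 'I_N) q => q 0 i * avg C (Bop C i f) q) p); last first.
    by move=> i _; apply: smooth_coordM; apply: smooth_avg; exact: smooth_Bop.
  apply: eq_bigr => i iC; rewrite vf_coordM; last by apply: smooth_avg; exact: smooth_Bop.
  rewrite (oL.1 _ _ iC) mulr0 addr0.
  rewrite (vf_avg p (fun s q => off_sc s q lL oL) (smooth_Bop C i sf)).
  by rewrite (vf_Bop lL oL iC sf).
rewrite vfB; last 2 first.
- by apply: smooth_sum => i _; apply: smooth_coordM; apply: smooth_Qop; exact: smooth_Bop.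
- by apply: smooth_mul; [exact: smooth_cst|exact: smooth_at0].
rewrite vfZ; last exact: smooth_at0.
rewrite vf_at0//; f_equal.
rewrite (@vf_sum _ _ _ _ _ _ (fun (i : 'I_N) q => q 0 i * Qop C a (Bop C i f) q) p); last first.
  by move=> i _; apply: smooth_coordM; apply: smooth_Qop; exact: smooth_Bop.
apply: eq_bigr => i iC; rewrite vf_coordM; last by apply: smooth_Qop; exact: smooth_Bop.
by rewrite (oL.1 _ _ iC) mulr0 addr0 (IH _ p (smooth_Bop C i sf)) (vf_Bop lL oL iC sf).
Qed.

(** The Taylor part of degree [a] turns the Euler field into multiplication by [a]. In the recursion
    [Bop C i] and [E] fail to commute by one copy of [Bop C i], as the bracket of [pd i] with [E] is
    [pd i]; this adds 1 to the degree. *)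
Lemma Pop_eul C a f p : smooth f -> Pop C a (vf (eul C) f) p = a%:R * Pop C a f p.
Proof.
elim: a f p => [|a IH] f p sf /=.
  rewrite mul0r /at0 /vf (_ : eul C (sc C 0 p) = 0) ?dd0//.
  by rewrite eul_sc scale0r.
rewrite mulr_sumr; apply: eq_bigr => i iC.
have -> : Bop C i (vf (eul C) f) = fun q => Bop C i f q + vf (eul C) (Bop C i f) q.
  apply/funext => q; rewrite /Bop vf_avg; last exact: smooth_D.
    rewrite -avgD; [|exact: smooth_D|by apply: smooth_vf; [exact: eul_linear|exact: smooth_D]].
    apply: eq_I01 => s _; rewrite /pd (dd_vf _ _ (eul_linear C) sf) eul_delta iC.
    by [].
  by move=> s r; exact: sc_eul.
have sB := smooth_Bop C i sf.
rewrite (PopD C a p sB (smooth_vf (eul_linear C) sB)) (IH _ p sB).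
by rewrite -natr1; ring.
Qed.

(** A fixed radius replaces vanishing near 0 because a Borel sum requires all its terms to vanish at
    the same points. The radius survives every Taylor operator: these use only derivatives and
    scalings by [s] in [0, 1], which do not increase the sup norm. *)
Definition zero_ball (r : R) f := forall p, `|p| < r -> f p = 0.

Lemma zero_ball_dd r v f : zero_ball r f -> zero_ball r (dd v f).
Proof.
move=> zf p pr.
have [_] : is_derive p v f 0.
  apply: cvg_is_derive.
  have H : \forall h \near 0^', 0 = h^-1 *: (f (h *: v + p) - f p) :> R.
    have v1 : 0 < `|v| + 1 by rewrite ltr_wpDl.
    have e0 : 0 < (r - `|p|) / (`|v| + 1) by rewrite divr_gt0 ?subr_gt0.
    near=> h; rewrite (zf p pr) (zf (h *: v + p)) ?subr0 ?scaler0//.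
    have : `|h| < (r - `|p|) / (`|v| + 1) by near: h; exact: dnbhs0_lt.
    rewrite (ltr_pdivlMr _ _ v1) => hr.
    rewrite (le_lt_trans (ler_normD _ _))// normrZ.
    by rewrite mulrDr mulr1 in hr; have := normr_ge0 h; lra.
  exact: (cvg_trans (near_eq_cvg H) (cvg_cst 0)).
exact.
Unshelve. all: by end_near. Qed.

Lemma zero_ball_sc r C s f : 0 <= s <= 1 -> zero_ball r f -> zero_ball r (fun p => f (sc C s p)).
Proof. by move=> s01 zf p pr; apply: zf; apply: le_lt_trans pr; exact: norm_sc. Qed.

Lemma zero_ball_avg r C f : zero_ball r f -> zero_ball r (avg C f).
Proof.
move=> zf p pr; rewrite /avg -[RHS](I01_cst 0); apply: eq_I01 => s s01.
exact: (zero_ball_sc C s01 zf).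
Qed.

Lemma zero_ball_Bop r C i f : zero_ball r f -> zero_ball r (Bop C i f).
Proof. by move=> zf; apply: zero_ball_avg; exact: zero_ball_dd. Qed.

Lemma zero_ball_at0 r C f : zero_ball r f -> zero_ball r (at0 C f).
Proof. by move=> zf; apply: zero_ball_sc => //; rewrite lexx ler01. Qed.

Lemma zero_ball_Pop r C a f : zero_ball r f -> zero_ball r (Pop C a f).
Proof.
elim: a f => [|a IH] f zf; first exact: zero_ball_at0.
move=> p pr /=; rewrite big1// => i _.
by rewrite (IH _ (zero_ball_Bop C i zf) p pr) mulr0.
Qed.

Lemma zero_ball_Qop r C a f : zero_ball r f -> zero_ball r (Qop C a f).
Proof.
elim: a f => [|a IH] f zf p pr /=.
  by rewrite big1// => i _; rewrite (zero_ball_avg C (zero_ball_Bop C i zf) pr) mulr0.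
rewrite (zero_ball_at0 C zf pr) mulr0 subr0 big1// => i _.
by rewrite (IH _ (zero_ball_Bop C i zf) p pr) mulr0.
Qed.

End scaling.

(** * Borel's lemma *)

Section borel.
Context {R : realType} {N : nat}.
Notation V := 'rV[R]_N.
Implicit Types (f g u w : V -> R) (p q v : V) (i : 'I_N) (C D A B : {set 'I_N}).

Lemma continuous_ball_bounded f (rho : R) : continuous f ->
  exists2 K, 0 <= K & forall q, `|q| <= rho -> `|f q| <= K.
Proof.
move=> cf.
have cb : compact [set q : V | `|q| <= rho].
  apply: bounded_closed_compact; last first.
    apply: (@preimage_closed _ _ (fun q : V => `|q|) [set x | x <= rho]); last exact: closed_le.
    by move=> q _; exact: norm_continuous.
  exists rho; split; first exact: num_real.
  by move=> x rx q /= qr; apply: le_trans qr (ltW rx).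
have := compact_bounded (continuous_compact (continuous_subspaceT cf) cb).
move=> [M [_ HM]]; exists (`|M| + 1); first by rewrite addr_ge0.
move=> q qr; apply: (HM (`|M| + 1)); last by exists q.
by have := ler_norm M; lra.
Qed.

Lemma wordD_bounded f (rho : R) n : smooth f ->
  exists2 K, 0 <= K & forall s q, (size s <= n)%N -> `|q| <= rho -> `|wordD s f q| <= K.
Proof.
elim: n f => [|n IH] f sf.
  have [K K0 HK] := continuous_ball_bounded rho (smooth_continuous sf).
  by exists K => // -[|//] q _ /HK.
have [K K0 HK] := continuous_ball_bounded rho (smooth_continuous sf).
have /choice[Ki HKi] : forall i : 'I_N, exists K, 0 <= K /\ forall s q,
    (size s <= n)%N -> `|q| <= rho -> `|wordD s (pd i f) q| <= K.
  by move=> i; have [K' ? ?] := IH (pd i f) (smooth_D _ sf); exists K'.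
have S0 : 0 <= \sum_i Ki i by apply: sumr_ge0 => i _; case: (HKi i).
exists (K + \sum_i Ki i); first by rewrite addr_ge0.
move=> s q; case/lastP: s => [|s i].
  by move=> _ /HK /= h; apply: le_trans h _; rewrite lerDl.
rewrite size_rcons ltnS => sn qr; rewrite wordD_rcons.
have [_ /(_ s q sn qr) h] := HKi i; apply: le_trans h _.
rewrite (bigD1 i)//= addrCA lerDl addr_ge0// sumr_ge0// => j _.
by case: (HKi j).
Qed.

Lemma near_derive v f g p : (\near p, f p = g p) -> \near p, dd v f p = dd v g p.
Proof.
move=> fg; have := nbhs_interior fg.
apply: (@filterS _ (nbhs p)) => q qI; exact: near_eq_derive.
Qed.

Lemma near_wordD f g p s : (\near p, f p = g p) -> wordD s f p = wordD s g p.
Proof.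
move=> fg; suff : \near p, wordD s f p = wordD s g p by exact: nbhs_singleton.
by elim: s => [//|i s IH] /=; exact: near_derive.
Qed.

Lemma wordD_cst0 s p : wordD s (fun=> 0 : R) p = 0.
Proof.
elim: s p => [//|i s IH] p /=.
rewrite (_ : wordD s _ = fun=> 0); first exact: derive_cst0.
by apply/funext => q; exact: IH.
Qed.

Lemma wordD_sc2 A B (c al be : R) f s : smooth f -> 
  forall p, wordD s (fun q => c * f (sc A al (sc B be q))) p =
  c * (\prod_(i <- s) ((if i \in A then al else 1) * (if i \in B then be else 1))) *
  wordD s f (sc A al (sc B be p)).
Proof.
move=> sf; elim: s => [|i s IH] p /=; first by rewrite big_nil mulr1.
set e := c * _ in IH; rewrite big_cons.
pose F q := wordD s f (sc A al q).
have sF : smooth F by apply: smooth_sc; exact: smooth_wordD.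
rewrite (_ : wordD s _ = fun q => e * F (sc B be q)); last exact/funext.
rewrite derive_cmul; last exact: smooth_sc.
have E := etrans (pd_sc B i be p sF) (congr1 (fun x => (if i \in B then be else 1) * x) (pd_sc A i al (sc B be p) (smooth_wordD s sf))).
rewrite /pd in E; rewrite E /e; move: (dd _ _ _) => x; move: (\prod_(_ <- _) _) => y; case: ifP => _; case: ifP => _; ring.
Qed.

(** By disjointness each letter of the word picks up at most one of the two factors, hence the
    exponent [size s] and not twice that. *)
Lemma prod_factor_le A B (m al be : R) (s : seq 'I_N) : disj A B -> 1 <= m ->
  `|al| <= m -> `|be| <= m ->
  `|\prod_(i <- s) ((if i \in A then al else 1) * (if i \in B then be else 1))| <= m ^+ size s.
Proof.
move=> AB m1 alm bem; elim: s => [|i s IH]; first by rewrite big_nil normr1.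
rewrite big_cons normrM /= exprS; apply: ler_pM => //.
case: ifP => iA; first by rewrite (AB _ iA) mulr1.
by rewrite mul1r; case: ifP; rewrite ?normr1.
Qed.

(* After the two scalings a derivative of order [m] of [w a mu] is
   [O(mu ^ (m - a))], so a large [mu] makes the derivatives of order [< a]
   summable. *)
Lemma borel A B (w : nat -> R -> V -> R) (Psi : nat -> V -> R) : disj A B ->
  (forall a, smooth (Psi a)) -> (forall a mu, smooth (w a mu)) ->
  (forall a (mu rho : R) p, 1 <= mu -> 1 <= rho -> `|p| <= rho ->
    (\near p, w a mu p = 0) \/
    exists al be : R, [/\ `|al| <= rho * mu, `|be| <= rho * mu,
      `|sc A al (sc B be p)| <= rho &
      w a mu = fun q => mu ^- a * Psi a (sc A al (sc B be q))]) ->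
  exists mu : nat -> R, (forall a, 1 <= mu a) /\ sdom (fun a => w a (mu a)).
Proof.
move=> AB sP sw H.
(* Diagonal choice: term [a] is made small only for words shorter than [a] and on the ball of radius
   [a]. For [a = 0] no word qualifies. *)
have /choice[mu Hmu] : forall a, exists mu : R, 1 <= mu /\ forall s p,
    (size s < a)%N -> `|p| <= a%:R -> `|wordD s (w a mu) p| <= 1 / 2 ^+ a.
  case=> [|a]; first by exists 1.
  have [K K0 HK] := wordD_bounded a.+1%:R a (sP a.+1).
  set b : R := a.+1%:R; have b1 : 1 <= b by rewrite ler1n.
  (* The scalings contribute at most [(b m)^a] against the prefactor [m^-(a+1)], leaving
     [b^a K / m]; the choice [m = 1 + e] brings this below [2^-(a+1)]. *)
  pose e : R := 2 ^+ a.+1 * (b ^+ a * K).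
  have b0 : 0 <= b ^+ a * K by rewrite mulr_ge0// exprn_ge0//; lra.
  have e0 : 0 <= e by rewrite mulr_ge0// exprn_ge0.
  have m1 : 1 <= 1 + e by rewrite lerDl.
  exists (1 + e); split => // s p sa pb; set m := 1 + e in m1 *.
  have m0 : 0 < m by lra.
  have [nz|[al [be [h1 h2 h3 ->]]]] := H a.+1 m b p m1 b1 pb.
    by rewrite (near_wordD s nz) wordD_cst0 normr0 mul1r invr_ge0 exprn_ge0.
  rewrite wordD_sc2// !normrM.
  have bm1 : 1 <= b * m by rewrite -[1]mulr1 ler_pM.
  have h4 := prod_factor_le s AB bm1 h1 h2.
  have h5 := HK s _ sa h3.
  have h6 : (b * m) ^+ size s <= (b * m) ^+ a by apply: ler_weXn2l.
  have ma0 : 0 <= m ^- a.+1 by rewrite invr_ge0 exprn_ge0// ltW.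
  rewrite (ger0_norm ma0).
  apply: (@le_trans _ _ (m ^- a.+1 * (b * m) ^+ a * K)).
    apply: ler_pM => //; first by rewrite mulr_ge0.
    by rewrite ler_wpM2l//; exact: le_trans h6.
  have -> : m ^- a.+1 * (b * m) ^+ a * K = m^-1 * (b ^+ a * K).
    by rewrite exprMn exprS; field; rewrite expf_neq0 gt_eqF.
  rewrite ler_pdivrMl// mul1r ler_pdivlMr ?exprn_gt0//.
  by rewrite mulrC -/e /m; lra.
exists mu; split=> [a|]; first by case: (Hmu a).
split=> [a|s rho]; first exact: sw.
(* From this index on, [a] exceeds both the length of the word and the radius, so the diagonal bound
   applies. *)
exists 1, (maxn (size s).+1 (Num.truncn `|rho|).+1); split=> // p prho a.
rewrite geq_max => /andP[sa ra]; apply: (Hmu a).2 => //.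
apply: le_trans prho _; apply: le_trans (ler_norm _) _.
apply: ltW; apply: lt_le_trans (truncnS_gt _) _.
by rewrite ler_nat.
Qed.

End borel.

(** * Functions vanishing to finite and infinite order *)

Opaque bumpf.

Section vanishing.
Context {R : realType} {N : nat}.
Notation V := 'rV[R]_N.
Variable A : {set 'I_N}.
Implicit Types (f g u w : V -> R) (p q v : V) (i : 'I_N) (B : {set 'I_N}) (L : V -> V).

Definition on0 p := forall i, i \in A -> p 0 i = 0.

(** Derivatives in all directions are included, tangential ones too, so every partial derivative
    costs at most one order. *)
Fixpoint van m f : Prop :=
  if m is m'.+1 then (forall p, on0 p -> f p = 0) /\ forall i, van m' (pd i f) else True.

Lemma van_on0 m f p : van m.+1 f -> on0 p -> f p = 0.
Proof. by case=> f0 _; exact: f0. Qed.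

Lemma van_pd m f i : van m.+1 f -> van m (pd i f).
Proof. by move=> [_ h]; exact: h. Qed.

Lemma van_intro m f : (forall p, on0 p -> f p = 0) -> (forall i, van m (pd i f)) -> van m.+1 f.
Proof. by move=> f0 fd; split. Qed.

Opaque van.

Definition flat f := forall m, van m f.

Lemma vanS m f : van m.+1 f -> van m f.
Proof.
elim: m f => [|m IH] f vf //.
apply: van_intro => [p|i]; first exact: van_on0 vf.
by apply: IH; exact: van_pd.
Qed.

Lemma van0 m : van m (fun=> 0).
Proof.
elim: m => [//|m IH]; apply: van_intro => // i; rewrite (_ : pd i _ = fun=> 0)//.
by apply/funext => p; exact: derive_cst0.
Qed.

Lemma vanD m f g : smooth f -> smooth g -> van m f -> van m g -> van m (fun p => f p + g p).
Proof.
elim: m f g => [//|m IH] f g sf sg v1 v2; apply: van_intro => [p p0|i].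
  by rewrite (van_on0 v1)// (van_on0 v2)// addr0.
rewrite (_ : pd i _ = fun p => pd i f p + pd i g p); last by apply/funext => p; exact: pdD.
by apply: IH; [exact: smooth_D|exact: smooth_D|exact: van_pd|exact: van_pd].
Qed.

Lemma vanM m f g : smooth f -> smooth g -> van m g -> van m (fun p => f p * g p).
Proof.
elim: m f g => [//|m IH] f g sf sg vg; apply: van_intro => [p p0|i].
  by rewrite (van_on0 vg)// mulr0.
rewrite (_ : pd i _ = fun p => f p * pd i g p + pd i f p * g p); last first.
  by apply/funext => p; rewrite /pd derive_mul// [X in _ + X]mulrC.
have sfi := smooth_D (delta_mx 0 i) sf; have sgi := smooth_D (delta_mx 0 i) sg.
apply: vanD; [exact: smooth_mul|exact: smooth_mul| |].
- by apply: IH => //; exact: van_pd.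
- by apply: IH => //; exact: vanS.
Qed.

Lemma vanB m f g : smooth f -> smooth g -> van m f -> van m g -> van m (fun p => f p - g p).
Proof.
move=> sf sg vf vg.
rewrite (_ : (fun p => _) = fun p => f p + (fun=> -1) p * g p); last first.
  by apply/funext => p; rewrite mulN1r.
have sc1 : smooth (fun _ : V => -1 : R) by exact: smooth_cst.
by apply: vanD => //; [exact: smooth_mul|apply: vanM => //; exact: van_pd].
Qed.

Lemma van_sum m (I : Type) (r : seq I) (P : pred I) (F : I -> V -> R) :
  (forall j, P j -> smooth (F j)) -> (forall j, P j -> van m (F j)) ->
  van m (fun p => \sum_(j <- r | P j) F j p).
Proof.
move=> sF vF; elim: r => [|j r IH].
  under eq_fun do rewrite big_nil; exact: van0.
under eq_fun do rewrite big_cons; case: (boolP (P j)) => // Pj.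
by apply: vanD; [exact: sF|exact: smooth_sum|exact: vF|].
Qed.

Lemma van_coordM m i f : i \in A -> smooth f -> van m f ->
  van m.+1 (fun p => p 0 i * f p).
Proof.
move=> iA; elim: m f => [|m IH] f sf vf.
  by apply: van_intro => // p p0; rewrite (p0 _ iA) mul0r.
apply: van_intro => [p p0|j]; first by rewrite (p0 _ iA) mul0r.
rewrite (_ : pd j _ = fun p => p 0 i * pd j f p + (fun=> (delta_mx 0 j : V) 0 i) p * f p); last first.
  apply/funext => p; rewrite /pd derive_mul//; last exact: smooth_coord.
  by rewrite derive_coord [X in _ + X]mulrC.
have sfj := smooth_D (delta_mx 0 j) sf.
have sc1 : smooth (fun _ : V => (delta_mx 0 j : V) 0 i) by exact: smooth_cst.
apply: vanD; [exact: smooth_coordM|exact: smooth_mul| |exact: vanM].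
by apply: IH => //; exact: van_pd.
Qed.

Lemma van_vf m L f : linear L -> smooth f -> van m.+1 f -> van m (vf L f).
Proof.
move=> lL sf vf1.
rewrite (_ : vf L f = fun p => \sum_i L p 0 i * pd i f p); last first.
  by apply/funext => p; exact: vfE.
have sL i : smooth (fun q => L q 0 i).
  exact: (@smooth_lin_comp _ _ L (fun q => q 0 i) lL (smooth_coord i)).
have sd i : smooth (pd i f) by exact: smooth_D.
by apply: van_sum => i _; [exact: smooth_mul|apply: vanM => //; exact: van_pd].
Qed.

(** The remainder carries [m] coordinate factors from [A], each raising the order of vanishing by
    one. *)
Lemma van_Rop m f : smooth f -> van m (Rop A m f).
Proof.
elim: m f => [//|m IH] f sf /=.
have sR i : smooth (Rop A m (Bop A i f)) by apply: smooth_Rop; exact: smooth_Bop.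
have H : van m.+1 (fun p => \sum_(i in A) p 0 i * Rop A m (Bop A i f) p).
  apply: (@van_sum m.+1 _ _ (mem A) (fun i p => p 0 i * Rop A m (Bop A i f) p)) => i iA.
    exact: smooth_coordM.
  by apply: van_coordM => //; apply: IH; exact: smooth_Bop.
exact: H.
Qed.

Lemma sc_on0 s p : on0 p -> sc A s p = p.
Proof. by move=> p0; apply/rowP => k; rewrite sc_coord; case: ifP => // /p0 ->; rewrite mulr0. Qed.

(* On [x = 0] the scaling by [2] is the identity, so there [f = 2 ^ a f]. *)
Lemma van_homog m a f : smooth f -> (m <= a)%N -> homog A a f -> van m f.
Proof.
move=> sf ma /(_ 2) h2; elim: m a f sf ma h2 => [//|m IH] a f sf ma h2; apply: van_intro => [p p0|i].
  have := h2 p; rewrite sc_on0// => E.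
  have a1 : 1 < (2 : R) ^+ a by rewrite exprn_egt1 ?ltr1n// -lt0n (leq_trans _ ma).
  have E2 : (2 ^+ a - 1) * f p = 0 by rewrite mulrBl -E; ring.
  by move/eqP: E2; rewrite mulf_eq0 => /orP[/eqP|/eqP//]; lra.
have H p : (if i \in A then 2 else 1) * pd i f (sc A 2 p) = 2 ^+ a * pd i f p.
  rewrite -(pd_sc A i 2 p sf) -(pdZ i _ p sf).
  by f_equal; apply/funext => q; exact: h2.
case: ifP H => iA H.
- apply: (IH a.-1); [exact: smooth_D|by case: a ma {h2 H}|].
  move=> p; apply: (@mulfI _ (2 : R)) => //; rewrite H.
  by case: a ma {h2 H} => // a _; rewrite exprS mulrA.
- apply: (IH a); [exact: smooth_D|exact: ltnW|].
  by move=> p; rewrite -H mul1r.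
Qed.

(** [w a] is [v a] with a cutoff equal to 1 near [x = 0]. At points of [x = 0] the terms from [m] on
    vanish, so the series is there the finite sum of the [v a]; the hypotheses pass to partial
    derivatives with [k] lowered by one. *)
Lemma van_ssumf k m (w v : nat -> V -> R) : sdom w -> (forall a, smooth (v a)) ->
  (forall a p, on0 p -> \near p, w a p = v a p) ->
  (forall a, (m <= a)%N -> van k (v a)) ->
  van k (fun p => ssumf w p - \sum_(a < m) v a p).
Proof.
elim: k w v => [//|k IH] w v sw sv wv vv; apply: van_intro => [p p0|i].
  rewrite /ssumf (@ssum_finite _ m); last first.
    by move=> a ma; rewrite (nbhs_singleton (wv a p p0)) (van_on0 (vv a ma)).
  apply/eqP; rewrite subr_eq0; apply/eqP; apply: eq_bigr => a _.
  exact: (nbhs_singleton (wv a p p0)).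
rewrite (_ : pd i _ = fun p => ssumf (fun a => pd i (w a)) p - \sum_(a < m) pd i (v a) p); last first.
  apply/funext => p; rewrite /pd derive_sub; [|exact: smooth_ssumf|by apply: smooth_sum => a _; exact: sv].
  rewrite dd_ssumf//; f_equal; f_equal.
  exact: (@derive_bigsum _ _ _ _ _ (fun (a : 'I_m) => v a) p).
apply: (IH (fun a => pd i (w a)) (fun a => pd i (v a))).
- exact: sdom_dd.
- by move=> a; exact: smooth_D.
- by move=> a p p0; apply: near_derive; exact: wv.
- by move=> a ma; exact: van_pd (vv a ma).
Qed.

End vanishing.

(** * Quadratic cutoffs and summation of homogeneous terms *)

Section quadratic.
Context {R : realType} {N : nat}.
Notation V := 'rV[R]_N.
Implicit Types (f g u w : V -> R) (p q v : V) (i : 'I_N) (A B C D : {set 'I_N}) (L : V -> V).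

Definition qf C p : R := \sum_(i in C) p 0 i ^+ 2.

Lemma smooth_qf C : smooth (qf C).
Proof. by apply: smooth_sum => i _; apply: smooth_exp; exact: smooth_coord. Qed.

Lemma qf_ge0 C p : 0 <= qf C p.
Proof. by apply: sumr_ge0 => i _; exact: sqr_ge0. Qed.

Lemma coord_qf C p i : i \in C -> p 0 i ^+ 2 <= qf C p.
Proof.
move=> iC; rewrite /qf (bigD1 i)//= lerDl; apply: sumr_ge0 => j _; exact: sqr_ge0.
Qed.

Lemma qf_sc C s p : qf C (sc C s p) = s ^+ 2 * qf C p.
Proof.
by rewrite /qf mulr_sumr; apply: eq_bigr => i iC; rewrite sc_coord iC exprMn.
Qed.

Lemma qf_sc_disj C D s p : disj C D -> qf C (sc D s p) = qf C p.
Proof. by move=> CD; apply: eq_bigr => i iC; rewrite sc_coord (CD _ iC). Qed.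

Lemma qf_eq0 C p : (forall i, i \in C -> p 0 i = 0) -> qf C p = 0.
Proof. by move=> p0; apply: big1 => i /p0 ->; rewrite expr0n. Qed.

Lemma vf_qf_eul C p : vf (eul C) (qf C) p = 2 * qf C p.
Proof. by apply: homog_euler; [exact: smooth_qf|move=> t q; exact: qf_sc]. Qed.

Lemma vf_qf_off C L p : off C L -> vf L (qf C) p = 0.
Proof.
move=> [L1 _]; rewrite /qf (@vf_sum _ _ _ _ _ _ (fun (i : 'I_N) q => q 0 i ^+ 2) p); last first.
  by move=> i _; apply: smooth_exp; exact: smooth_coord.
apply: big1 => i iC.
rewrite (_ : (fun q => q 0 i ^+ 2) = (fun q : V => q 0 i * q 0 i)); last first.
  by apply/funext => q; rewrite expr2.
by rewrite vf_coordM ?L1 ?mulr0 ?addr0 ?/vf ?derive_coord ?L1 ?mulr0//; exact: smooth_coord.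
Qed.

Lemma homog_sc C a f (t : R) p : homog C a f -> t != 0 -> f p = t ^- a * f (sc C t p).
Proof. by move=> hf t0; rewrite hf mulrA mulVf ?mul1r// expf_neq0. Qed.

Lemma disj_sym A B : disj A B -> disj B A.
Proof. by move=> AB i iB; apply/negP => /AB; rewrite iB. Qed.

Lemma abs_le_sqr (x y : R) : 0 <= y -> x ^+ 2 <= y ^+ 2 -> `|x| <= y.
Proof. by move=> y0; rewrite -[X in X <= _]real_normK ?num_real// ler_pXn2r ?nnegrE. Qed.

Lemma near_bump1 (q : V -> R) p : continuous q -> q p < 2^-1 -> \near p, bumpf (q p) = 1.
Proof.
move=> cq qp; near=> x; apply: bump1; apply: ltW; near: x.
exact: (cvgr_lt (q p) (cq p)).
Unshelve. all: by end_near. Qed.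

Lemma near_bump0 (q : V -> R) p : continuous q -> 1 < q p -> \near p, bumpf (q p) = 0.
Proof.
move=> cq qp; near=> x; apply: bump0; apply: ltW; near: x.
exact: (cvgr_gt (q p) (cq p)).
Unshelve. all: by end_near. Qed.

Definition qcut A (m : R) p : R := m ^+ 2 * qf A p.

Lemma smooth_qcut A m : smooth (qcut A m).
Proof. by apply: smooth_mul; [exact: smooth_cst|exact: smooth_qf]. Qed.

(** Homogeneity gives [v a (x) = m^-a v a (m x)], so the term is [m^-a Psi (m x)] with a fixed
    [Psi], the form that [borel] handles with an empty second set. Where the cutoff does not vanish
    locally, [|m x_i| <= 1], so the scaled point stays in the ball. *)
Lemma borel1 A (v : nat -> V -> R) : (forall a, smooth (v a)) -> (forall a, homog A a (v a)) ->
  exists m : nat -> R, sdom (fun a p => v a p * bumpf (qcut A (m a) p)).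
Proof.
move=> sv hv.
have [] := @borel R N A finset.set0 (fun a m p => v a p * bumpf (qcut A m p)) (fun a p => v a p * bumpf (qf A p)).
- by move=> i iA; rewrite finset.in_set0.
- by move=> a; apply: smooth_mul => //; apply: smooth_bump; exact: smooth_qf.
- by move=> a m; apply: smooth_mul => //; apply: smooth_bump; exact: smooth_qcut.
- move=> a m rho p m1 rho1 prho.
  have m0 : 0 < m by lra.
  have [q1|q1] := ltP 1 (qcut A m p).
    left; have := near_bump0 (smooth_continuous (smooth_qcut A m)) q1.
    by apply: (@filterS _ (nbhs p)) => x ->; rewrite mulr0.
  right; exists m, 1; split.
  - by rewrite ger0_norm ?(ltW m0)// ler_peMl// ltW.
  - by rewrite normr1 -[leLHS](mulr1 1) ler_pM.
  - rewrite sc1; apply: norm_row_le => [|i]; first lra.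
    rewrite sc_coord; case: ifP => iA; last by apply: le_trans prho; exact: coord_norm_le.
    apply: le_trans rho1; apply: abs_le_sqr => //; rewrite expr1n exprMn.
    by apply: le_trans q1; rewrite ler_wpM2l ?sqr_ge0//; exact: coord_qf.
  - apply/funext => q; rewrite sc1 (homog_sc q (hv a) (lt0r_neq0 m0)).
    by rewrite /qcut -qf_sc -mulrA.
by move=> m [_ ?]; exists m.
Qed.

(* The scaling [(x, y) -> (s mu x, y / s)] leaves [f] unchanged up to [mu ^ a];
   with [s = max(|y|, 1 / mu)] it maps the support of the cutoff in a ball into
   a ball of the same radius. *)
Lemma borel2 A B (v : nat -> V -> R) : disj A B -> (forall a, smooth (v a)) ->
  (forall a, homog A a (v a)) -> (forall a, homog B a (v a)) ->
  exists m : nat -> R, sdom (fun a p => v a p * bumpf (qcut A (m a) p * qf B p)).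
Proof.
move=> AB sv hA hB; have BA := disj_sym AB.
have sq m : smooth (fun p => qcut A m p * qf B p).
  by apply: smooth_mul; [exact: smooth_qcut|exact: smooth_qf].
have [] := @borel R N A B (fun a m p => v a p * bumpf (qcut A m p * qf B p))
   (fun a p => v a p * bumpf (qf A p * qf B p)) AB.
- move=> a; apply: smooth_mul => //; apply: smooth_bump.
  by apply: smooth_mul; exact: smooth_qf.
- by move=> a m; apply: smooth_mul => //; apply: smooth_bump.
- move=> a m rho p m1 rho1 prho.
  have m0 : 0 < m by lra.
  have [q1|q1] := ltP 1 (qcut A m p * qf B p).
    left; have := near_bump0 (smooth_continuous (sq m)) q1.
    by apply: (@filterS _ (nbhs p)) => x ->; rewrite mulr0.
  right; pose s := Num.max `|eul B p| m^-1.
  have mV : 0 < m^-1 by rewrite invr_gt0.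
  have mV1 : m^-1 <= 1 by rewrite invf_le1.
  have s0 : 0 < s by rewrite lt_max mV orbT.
  have sV : s^-1 <= m by rewrite -[leRHS]invrK lef_pV2 ?posrE// le_max lexx orbT.
  have sB i : i \in B -> `|p 0 i| <= s.
    by move=> iB; rewrite le_max; apply/orP; left; have := coord_norm_le (eul B p) i; rewrite mxE iB.
  have srho : s <= rho.
    rewrite ge_max (le_trans mV1 rho1) andbT; apply: norm_row_le => [|i]; first lra.
    by rewrite mxE; case: ifP => _; rewrite ?normr0; [apply: le_trans prho; exact: coord_norm_le|lra].
  have sA i : i \in A -> `|s * m * p 0 i| <= rho.
    move=> iA; have [H|H] := leP `|eul B p| m^-1.
      have -> : s = m^-1 by exact/max_r.
      rewrite mulVf ?lt0r_neq0// mul1r; apply: le_trans prho; exact: coord_norm_le.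
    have E : s = `|eul B p| by apply/max_l; exact: ltW.
    have s2 : s ^+ 2 <= qf B p.
      have : s <= Num.sqrt (qf B p).
        rewrite E; apply: norm_row_le => [|j]; first exact: sqrtr_ge0.
        rewrite mxE; case: ifP => jB; last by rewrite normr0 sqrtr_ge0.
        by rewrite -sqrtr_sqr ler_wsqrtr//; exact: coord_qf.
      move=> h; rewrite -[leRHS]sqr_sqrtr ?qf_ge0// ler_pXn2r ?nnegrE ?sqrtr_ge0//; exact: ltW.
    apply: le_trans rho1; apply: abs_le_sqr => //; rewrite expr1n.
    apply: le_trans q1; rewrite /qcut !exprMn.
    have -> : s ^+ 2 * m ^+ 2 * p 0 i ^+ 2 = m ^+ 2 * p 0 i ^+ 2 * s ^+ 2 by ring.
    have h0 : 0 <= m ^+ 2 * p 0 i ^+ 2 by apply: mulr_ge0; exact: sqr_ge0.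
    apply: ler_pM => //; first exact: sqr_ge0.
    by rewrite ler_wpM2l ?sqr_ge0//; exact: coord_qf.
  exists (s * m), s^-1; split.
  - by rewrite normrM (gtr0_norm s0) (gtr0_norm m0) (ler_pM2r m0).
  - rewrite gtr0_norm ?invr_gt0//; apply: le_trans sV _; apply: ler_peMl => //; exact: ltW.
  - apply: norm_row_le => [|i]; first lra.
    rewrite sc_coord; case: ifP => iA; rewrite sc_coord; case: ifP => iB.
    + by rewrite (AB _ iA) in iB.
    + exact: sA.
    + rewrite normrM gtr0_norm ?invr_gt0// ler_pdivrMl//.
      by apply: le_trans (sB _ iB) _; rewrite ler_peMr// ltW.
    + by apply: le_trans prho; exact: coord_norm_le.
  - apply/funext => q.
    have E1 : v a (sc A (s * m) (sc B s^-1 q)) = m ^+ a * v a q.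
      rewrite hA hB exprMn exprVn; field; rewrite expf_neq0// lt0r_neq0//.
    have E2 : qf A (sc A (s * m) (sc B s^-1 q)) * qf B (sc A (s * m) (sc B s^-1 q)) =
        qcut A m q * qf B q.
      rewrite qf_sc (qf_sc_disj _ _ BA) qf_sc (qf_sc_disj _ _ AB) /qcut; field.
      by rewrite lt0r_neq0.
    rewrite E1 E2; move: (bumpf _) => x.
    by rewrite !mulrA mulVf ?mul1r// expf_neq0// lt0r_neq0.
by move=> m [_ ?]; exists m.
Qed.

End quadratic.

(** * The flat equation *)

Section flat_solution.
Context {R : realType} {N : nat}.
Notation V := 'rV[R]_N.
Variables A B : {set 'I_N}.
Hypothesis AB : disj A B.
Implicit Types (f g u w psi : V -> R) (p q v : V) (i : 'I_N) (L : V -> V) (c : R -> R).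

Lemma flat_pd i psi : flat A psi -> flat A (pd i psi).
Proof. by move=> fp m; apply: van_pd; exact: fp. Qed.

(** Induction on [m] by the mean value theorem from [s = 0], where flatness gives the value 0: the
    derivative in [s] is a combination of partial derivatives, which are again flat and satisfy the
    bound of order [m]. *)
Lemma flat_bound psi m (rho : R) : 0 <= rho -> smooth psi -> flat A psi ->
  exists2 K, 0 <= K & forall q s, `|q| <= rho -> `|s| <= 1 -> `|psi (sc A s q)| <= K * `|s| ^+ m.
Proof.
move=> r0; elim: m psi => [|m IH] psi sp fp.
  have [K K0 HK] := continuous_ball_bounded rho (smooth_continuous sp).
  exists K => // q s qr s1; rewrite mulr1; apply: HK.
  apply: norm_row_le => // i; rewrite sc_coord; apply: le_trans qr.
  case: ifP => _; last exact: coord_norm_le.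
  by rewrite normrM; apply: le_trans (coord_norm_le q i); rewrite ler_piMl.
have /choice[K HK] : forall i, exists K, 0 <= K /\ forall q s, `|q| <= rho -> `|s| <= 1 ->
    `|pd i psi (sc A s q)| <= K * `|s| ^+ m.
  by move=> i; have [K ? ?] := IH _ (smooth_D (delta_mx 0 i) sp) (flat_pd i fp); exists K.
exists (\sum_i rho * K i).
  by apply: sumr_ge0 => i _; rewrite mulr_ge0//; case: (HK i).
move=> q s qr s1.
have [t ts E] := @MVT_line _ _ psi (sc A 0 q) (eul A q) s (fun x => smooth_derivable sp).
rewrite -!scE in E.
have p0 : psi (sc A 0 q) = 0.
  apply: (van_on0 (fp 1%N)) => i iA; by rewrite sc_coord iA mul0r.
rewrite p0 subr0 in E; rewrite E normrM exprSr mulrA [X in _ <= X]mulrC ler_wpM2l//.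
rewrite (derive_coords _ _ sp) (le_trans (ler_norm_sum _ _ _))// mulr_suml ler_sum// => i _.
rewrite normrM -mulrA; apply: ler_pM => //.
  rewrite mxE; case: ifP => _; last by rewrite normr0.
  by apply: le_trans qr; exact: coord_norm_le.
have [K0 /(_ q t qr (le_trans ts s1)) h] := HK i; apply: le_trans h _.
by rewrite ler_wpM2l// lerXn2r ?nnegrE.
Qed.

Variable kappa : R.
Hypothesis kappa0 : 0 <= kappa.

Definition supp psi := forall q, kappa < qf B q -> psi q = 0.

Lemma supp_dd v psi : supp psi -> supp (dd v psi).
Proof.
move=> sp q kq; rewrite -[RHS](derive_cst0 0 q v); apply: near_eq_derive.
near=> x; apply: sp; near: x.
have cq := smooth_continuous (@smooth_qf R N B).
exact: (cvgr_gt (qf B q) (cq q)).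
Unshelve. all: by end_near. Qed.

(** Both parameters serve differentiation in [p]: a derivative in [x] multiplies by [s], absorbed in
    [c], and a derivative in [y] divides by [s], raising [m]. The value 0 for [s <= 0] makes the
    kernel continuous on the whole product, as [psmooth] demands. *)
Definition kern c m psi : R -> V -> R := fun s p =>
  if 0 < s then c s * s ^- m * psi (sc A s (sc B s^-1 p)) else 0.

Lemma kern_bound c m psi p : continuous c -> smooth psi -> flat A psi -> supp psi ->
  exists2 K, 0 <= K & \forall z \near ((0 : R), p), `|kern c m psi z.1 z.2| <= K * `|z.1|.
Proof.
move=> cc sp fp up.
(* Bounds [q = (x, y / s)] on the support: [|p| + 1] covers the coordinates outside [B], and
   [1 + kappa] those in [B], whose squares are at most [kappa]. *)
pose rho := `|p| + 1 + (1 + kappa).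
have r0 : 0 <= rho by rewrite !addr_ge0.
(* Order [m + 1]: [m] powers of [s] cancel [s^-m], and one remains to force the limit 0. *)
have [K K0 HK] := flat_bound m.+1 r0 sp fp.
exists ((`|c 0| + 1) * K); first by rewrite mulr_ge0// addr_ge0.
have h1 : \forall z \near ((0 : R), p), `|z.1| < 1.
  have c1 : z.1 @[z --> ((0 : R), p)] --> (0 : R) by exact: cvg_fst.
  have := cvgr0_norm_lt _ c1 _ ltr01; exact.
have h2 : \forall z \near ((0 : R), p), `|c z.1| <= `|c 0| + 1.
  have c0 : z.1 @[z --> ((0 : R), p)] --> (0 : R) by exact: cvg_fst.
  have c1 := cvg_comp (fun z : R * V => z.1) c c0 (cc 0).
  have H := @cvgr_dist_lt _ _ _ _ _ _ _ c1 1 ltr01; near=> z.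
  have : `|c 0 - c z.1| < 1 by near: z; exact: H.
  rewrite distrC; have := lerB_dist (c z.1) (c 0); lra.
have h3 : \forall z \near ((0 : R), p), `|z.2| <= `|p| + 1.
  have c1 : z.2 @[z --> ((0 : R), p)] --> p by exact: cvg_snd.
  have c2 : `|z.2| @[z --> ((0 : R), p)] --> `|p| by exact: cvg_norm c1.
  near=> z; apply: ltW; near: z; apply: (cvgr_lt _ c2); by rewrite ltrDl.
near=> z.
have H1 : `|z.1| < 1 by near: z.
have H2 : `|c z.1| <= `|c 0| + 1 by near: z.
have H3 : `|z.2| <= `|p| + 1 by near: z.
rewrite /kern; case: ifPn => [s0|_]; last by rewrite normr0 !mulr_ge0// addr_ge0.
set s := z.1 in s0 H1 H2 *; set q := sc B s^-1 z.2.
have sn0 : s != 0 by rewrite gt_eqF.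
have [Z|NZ] := ltP kappa (qf B q).
  rewrite (up (sc A s q)) ?mulr0 ?normr0 ?mulr_ge0 ?addr_ge0//.
  by rewrite qf_sc_disj//; exact: disj_sym.
have qr : `|q| <= rho.
  apply: norm_row_le => // i; case: (boolP (i \in B)) => iB; last first.
    rewrite /q sc_coord (negbTE iB); apply: (le_trans (coord_norm_le _ _)).
    by apply: le_trans H3 _; rewrite lerDl addr_ge0.
  apply: (@le_trans _ _ (1 + kappa)); last by rewrite /rho; have := normr_ge0 p; lra.
  apply: abs_le_sqr; first by rewrite addr_ge0.
  apply: le_trans (coord_qf _ iB) _; apply: le_trans NZ _.
  by rewrite expr2; nra.
have h := HK q s qr (ltW H1).
rewrite !normrM -!mulrA; apply: ler_pM => //.
rewrite normrV ?unitfE ?expf_neq0// normrX.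
rewrite -ler_pdivlMl ?invr_gt0 ?exprn_gt0 ?normr_gt0// invrK.
by apply: le_trans h _; rewrite exprS; lra.
Unshelve. all: by end_near. Qed.

Lemma kern_continuous c m psi : continuous c -> smooth psi -> flat A psi -> supp psi ->
  continuous (fun z : R * V => kern c m psi z.1 z.2).
Proof.
move=> cc sp fp up [s p].
have cf : z.1 @[z --> (s, p)] --> s by exact: cvg_fst.
have [s0|s0|s0] := ltgtP s 0.
- have E : \forall z \near (s, p), 0 = kern c m psi z.1 z.2.
    near=> z; rewrite /kern ltNge (_ : z.1 <= 0)//; apply: ltW; near: z.
    exact: (cvgr_lt s cf).
  rewrite /continuous_at {2}/kern ltNge (ltW s0)/=.
  exact: (cvg_trans (near_eq_cvg E) (cvg_cst 0)).
- have E : \forall z \near (s, p), c z.1 * z.1 ^- m * psi (sc A z.1 (sc B z.1^-1 z.2)) = kern c m psi z.1 z.2.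
    near=> z; rewrite /kern (_ : 0 < z.1)//; near: z.
    exact: (cvgr_gt s cf).
  rewrite /continuous_at {2}/kern s0.
  apply: (cvg_trans (near_eq_cvg E)).
  have sn0 : s != 0 by rewrite gt_eqF.
  have cV : z.1^-1 @[z --> (s, p)] --> s^-1 by apply: cvgV.
  have c2 : z.2 @[z --> (s, p)] --> p by exact: cvg_snd.
  have cB : sc B z.1^-1 z.2 @[z --> (s, p)] --> sc B s^-1 p.
    exact: (cvg_comp _ _ (cvg_pair2 cV c2) (@sc_joint_continuous R N B (s^-1, p))).
  have cA : sc A z.1 (sc B z.1^-1 z.2) @[z --> (s, p)] --> sc A s (sc B s^-1 p).
    exact: (cvg_comp _ _ (cvg_pair2 cf cB) (@sc_joint_continuous R N A (s, sc B s^-1 p))).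
  have cpsi : continuous psi by exact: smooth_continuous.
  apply: cvgM; last exact: (cvg_comp _ _ cA (cpsi _)).
  apply: cvgM; first exact: (cvg_comp _ _ cf (cc s)).
  by apply: cvgV; [exact: expf_neq0|exact: (cvg_comp (fun z : R * V => z.1) (fun x => x ^+ m) cf (@exprn_continuous R m s))].
- rewrite s0 in cf *; rewrite /continuous_at {2}/kern ltxx.
  have [K K0 HK] := kern_bound m p cc sp fp up.
  apply/cvgrPdist_le => e e0.
  have e1 : 0 < e / (K + 1) by rewrite divr_gt0// ltr_wpDl.
  near=> z; rewrite sub0r normrN.
  have h1 : `|z.1| < e / (K + 1).
    near: z; have := cvgr0_norm_lt _ cf _ e1; exact.
  have h2 : `|kern c m psi z.1 z.2| <= K * `|z.1| by near: z.
  apply: le_trans h2 _.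
  rewrite ltr_pdivlMr ?ltr_wpDl// in h1.
  by have := normr_ge0 z.1; lra.
Unshelve. all: by end_near. Qed.

Lemma kern_smooth c m psi s : smooth psi -> smooth (kern c m psi s).
Proof.
move=> sp; rewrite /kern; case: (0 < s); last exact: smooth_cst.
apply: smooth_mul; first exact: smooth_cst.
have := smooth_sc B s^-1 (smooth_sc A s sp); exact.
Qed.

Lemma pd_kern c m psi i s p : smooth psi ->
  pd i (kern c m psi s) p =
  if i \in A then kern (fun s => c s * s) m (pd i psi) s p
  else if i \in B then kern c m.+1 (pd i psi) s p else kern c m (pd i psi) s p.
Proof.
move=> sp; rewrite /kern; case: (boolP (0 < s)) => s0; last by rewrite /pd derive_cst0; case: ifP => // _; case: ifP.
have sA := smooth_sc A s sp.
rewrite pdZ; last exact: (smooth_sc B s^-1 sA).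
have E := etrans (pd_sc B i s^-1 p sA) (congr1 (fun x => (if i \in B then s^-1 else 1) * x) (pd_sc A i s (sc B s^-1 p) sp)).
rewrite E; move: (pd i psi _) => x.
case: (boolP (i \in A)) => iA; first by rewrite (AB iA) mul1r; ring.
rewrite mul1r; case: ifP => iB; last by rewrite mul1r.
by rewrite exprS invfM; ring.
Qed.

(** Closed under derivatives by [pd_kern], since partial derivatives keep flatness and support; sums
    and multiples are there to pass from coordinate directions to arbitrary ones. *)
Inductive flat_kernel : (R -> V -> R) -> Prop :=
| flat_kernel1 c m psi : continuous c -> smooth psi -> flat A psi -> supp psi ->
    flat_kernel (kern c m psi)
| flat_kernel0 : flat_kernel (fun _ _ => 0)
| flat_kernelD (k l : R -> V -> R) : flat_kernel k -> flat_kernel l ->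
    flat_kernel (fun s p => k s p + l s p)
| flat_kernelZ a (k : R -> V -> R) : flat_kernel k -> flat_kernel (fun s p => a * k s p).

Lemma flat_kernel_smooth k s : flat_kernel k -> smooth (k s).
Proof.
elim=> [c m psi _ sp _ _||{}k l _ sk _ sl|a {}k _ sk].
- exact: kern_smooth.
- exact: smooth_cst.
- exact: smooth_add.
- by apply: smooth_mul => //; exact: smooth_cst.
Qed.

Lemma flat_kernel_sum (I : Type) (r : seq I) (F : I -> R -> V -> R) :
  (forall j, flat_kernel (F j)) ->
  flat_kernel (fun s p => \sum_(j <- r) F j s p).
Proof.
move=> KF; elim: r => [|j r IH].
  rewrite (_ : (fun s p => _) = fun _ _ => 0); first exact: flat_kernel0.
  by apply/funext => s; apply/funext => p; rewrite big_nil.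
rewrite (_ : (fun s p => _) = fun s p => F j s p + \sum_(j <- r) F j s p).
  exact: flat_kernelD.
by apply/funext => s; apply/funext => p; rewrite big_cons.
Qed.

Lemma psmooth_flat_kernel k : flat_kernel k -> psmooth k.
Proof.
move=> Kk; exists flat_kernel; split=> // {Kk}k.
  elim=> [c m psi cc sp fp up||{}k l _ ck _ cl|a {}k _ ck].
  - exact: kern_continuous.
  - exact: cst_continuous.
  - by move=> z; apply: cvgD; [exact: ck|exact: cl].
  - by move=> z; apply: cvgMl_tmp; exact: ck.
move=> v Kk; split=> [s p|].
  exact/smooth_derivable/flat_kernel_smooth.
elim: Kk => [c m psi cc sp fp up||{}k l Kk Dk Kl Dl|a {}k Kk Dk].
- rewrite (_ : (fun s => _) = (fun s p => \sum_i v 0 i * pd i (kern c m psi s) p)); last first.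
    apply/funext => s; apply/funext => p; apply: derive_coords; exact: kern_smooth.
  apply: (flat_kernel_sum _ (F := fun i s p => v 0 i * pd i (kern c m psi s) p)) => i.
  apply: (@flat_kernelZ (v 0 i) (fun s p => pd i (kern c m psi s) p)).
  rewrite (_ : (fun s p => _) = if i \in A then kern (fun s => c s * s) m (pd i psi)
     else if i \in B then kern c m.+1 (pd i psi) else kern c m (pd i psi)); last first.
    apply/funext => s; apply/funext => p; rewrite pd_kern//.
    by case: ifP => // _; case: ifP.
  have sd := smooth_D (delta_mx 0 i) sp; have fd := flat_pd i fp.
  have ud := supp_dd (delta_mx 0 i) up.
  case: ifP => _; last by case: ifP => _; exact: flat_kernel1.
  apply: flat_kernel1 => //; move=> s; apply: cvgM; [exact: cc|exact: cvg_id].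
- rewrite (_ : (fun s => _) = fun _ _ => 0); first exact: flat_kernel0.
  by apply/funext => s; apply/funext => p; rewrite derive_cst0.
- rewrite (_ : (fun s => _) = fun s p => dd v (k s) p + dd v (l s) p); first exact: flat_kernelD.
  by apply/funext => s; apply/funext => p; rewrite derive_add//; exact: flat_kernel_smooth.
- rewrite (_ : (fun s => _) = fun s p => a * dd v (k s) p); first exact: flat_kernelZ.
  by apply/funext => s; apply/funext => p; rewrite derive_cmul//; exact: flat_kernel_smooth.
Qed.

End flat_solution.

Section flat_primitive.
Context {R : realType} {N : nat}.
Notation V := 'rV[R]_N.
Variables A B : {set 'I_N}.
Hypothesis AB : disj A B.
Implicit Types (f g u w psi : V -> R) (p q v : V) (i : 'I_N) (L : V -> V).

(** Its flow is [(e^-t x, e^t y)]; with [s = e^-t] this becomes the curve [(s x, y / s)] of the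
    kernels, and infinite time corresponds to [s = 0]. *)
Definition hyp p : V := eul B p - eul A p.

Lemma eul_sc_disj C D (s : R) p : disj C D -> eul C (sc D s p) = eul C p.
Proof. by move=> CD; apply/rowP => k; rewrite !mxE; case: (boolP (k \in C)) => // kC; rewrite (CD _ kC). Qed.

Lemma hyp_linear : linear hyp.
Proof.
move=> a u v; rewrite /hyp (eul_linear B) (eul_linear A).
by apply/rowP => k; rewrite !mxE; ring.
Qed.

Lemma sc_hyp C s q : sc C s (hyp q) = hyp (sc C s q).
Proof.
rewrite /hyp -!(scaleN1r (eul A _)) !(addrC (eul B _)) (sc_linear C s (-1) (eul A q) (eul B q)).
by rewrite (sc_eul C A) (sc_eul C B).
Qed.

Lemma vf_hyp f p : smooth f -> vf hyp f p = vf (eul B) f p - vf (eul A) f p.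
Proof.
move=> sf; rewrite /vf /hyp derive_addv// -(scaleN1r (eul A p)) derive_homog//.
by rewrite mulN1r.
Qed.

Lemma vf_kern L c m psi s p : linear L ->
  (forall s q, sc A s (sc B s^-1 (L q)) = L (sc A s (sc B s^-1 q))) -> smooth psi ->
  vf L (kern A B c m psi s) p = kern A B c m (vf L psi) s p.
Proof.
move=> lL LS sp; rewrite /kern; case: (boolP (0 < s)) => s0; last first.
  by rewrite /vf derive_cst0.
have sA := smooth_sc B s^-1 (smooth_sc A s sp).
rewrite vfZ//; apply: (congr1 (fun x => c s / s ^+ m * x)).
apply: (@vf_lin_comp _ _ L (fun q => sc A s (sc B s^-1 q))) => [|q]; last exact: LS.
by move=> a u v; rewrite sc_linear sc_linear.
Qed.

Variables (kappa : R) (psi : V -> R).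
Hypotheses (kappa0 : 0 <= kappa) (sp : smooth psi) (fp : flat A psi) (up : supp B kappa psi).

Lemma flat_vf L f : linear L -> smooth f -> flat A f -> flat A (vf L f).
Proof. by move=> lL sf ff m; apply: van_vf. Qed.

(** For [s > 0] this is the derivative of [psi] along the flow reparametrised by [s = e^-t], whence
    the sign and the factor [1 / s]. It also holds at [s = 0], so the fundamental theorem applies on
    all of [0, 1]. *)
Lemma kern_derive p (s : R) :
  is_derive s (1 : R) (fun s => kern A B (fun=> 1) 0 psi s p) (- kern A B (fun=> 1) 1 (vf hyp psi) s p).
Proof.
have [s0|s0|->] := ltgtP s 0.
- rewrite {2}/kern ltNge (ltW s0)/= oppr0.
  have d0 : is_derive s 1 (fun _ : R => 0 : R) 0 by exact: is_derive_cst.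
  apply: near_eq_is_derive d0.
  near=> t; rewrite /kern ltNge (_ : t <= 0)//; apply: ltW; near: t.
  exact: (@cvgr_lt _ _ _ _ id s cvg_id).
- have E t : 0 < t -> sc A t (sc B t^-1 p) = t *: eul A p + (t^-1 *: eul B p + sc A 0 (sc B 0 p)).
    move=> t0; apply/rowP => k; rewrite !(sc_coord, mxE).
    case: (boolP (k \in A)) => kA; first by rewrite (AB kA); ring.
    by case: ifP => _; ring.
  set z := sc A 0 (sc B 0 p) in E.
  have dV : is_derive s 1 (fun t : R => t^-1) (- s ^- 2).
    have h := is_deriveV (f := id) (v := 1) (lt0r_neq0 s0) (is_derive_id s (1 : R)).
    by rewrite [_ *: 1]mulr1 in h.
  have D := @is_derive_curve R N psi (eul A p) (eul B p) z id (fun t => t^-1) s _ _ sp (is_derive_id s (1:R)) dV.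
  have EQ : - kern A B (fun=> 1) 1 (vf hyp psi) s p =
     1 * dd (eul A p) psi (s *: eul A p + (s^-1 *: eul B p + z)) +
     (- s ^- 2) * dd (eul B p) psi (s *: eul A p + (s^-1 *: eul B p + z)).
    rewrite /kern s0 (vf_hyp _ sp) -!E// /vf.
    have -> : eul A (sc A s (sc B s^-1 p)) = s *: eul A p by rewrite eul_sc (eul_sc_disj _ _ AB).
    have -> : eul B (sc A s (sc B s^-1 p)) = s^-1 *: eul B p.
      by rewrite (eul_sc_disj _ _ (disj_sym AB)) eul_sc.
    rewrite !derive_homog// expr1; field; rewrite lt0r_neq0//.
  rewrite EQ; apply: near_eq_is_derive D.
  near=> t; have t0 : 0 < t by near: t; exact: (@cvgr_gt _ _ _ _ id s cvg_id).
  by rewrite /kern t0 E// expr0 invr1 !mul1r.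
- have -> : - kern A B (fun=> 1) 1 (vf hyp psi) 0 p = kern A B (fun=> 1) 1 psi 0 p.
    by rewrite /kern ltxx oppr0.
  apply: cvg_is_derive1.
  (* The difference quotient at 0 of the kernel of exponent 0 is the kernel of exponent 1, which is
     continuous and vanishes at 0. *)
  rewrite (_ : (fun h : R => h^-1 * _) = (fun h => kern A B (fun=> 1) 1 psi h p)); last first.
    apply/funext => h; rewrite addr0 /kern ltxx subr0; case: ifP => _; last by rewrite mulr0.
    by rewrite expr0 expr1 invr1 !mul1r.
  apply: cvg_dnbhs.
  have H : continuous (fun z : R * V => kern A B (fun=> 1) 1 psi z.1 z.2).
    by apply: (kern_continuous AB kappa0) => //; exact: cst_continuous.
  exact: (@joint_continuous1 _ _ _ (kern A B (fun=> 1) 1 psi) p H 0).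
Unshelve. all: by end_near. Qed.

Definition flat_prim p : R := - 1 * I01 (fun s => kern A B (fun=> 1) 1 psi s p).

Lemma kern1_psmooth f : smooth f -> flat A f -> supp B kappa f ->
  psmooth (kern A B (fun=> 1) 1 f).
Proof.
move=> sf ff uf; apply: (psmooth_flat_kernel AB kappa0); apply: flat_kernel1 => //.
exact: cst_continuous.
Qed.

Lemma smooth_flat_prim : smooth flat_prim.
Proof.
apply: smooth_mul; first exact: smooth_cst.
by apply: smooth_I01; exact: kern1_psmooth.
Qed.

Lemma vf_flat_prim L p : linear L ->
  (forall s q, sc A s (sc B s^-1 (L q)) = L (sc A s (sc B s^-1 q))) ->
  vf L flat_prim p = - I01 (fun s => kern A B (fun=> 1) 1 (vf L psi) s p).
Proof.
move=> lL LS; have pk := kern1_psmooth sp fp up.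
rewrite vfZ; last exact: smooth_I01.
rewrite mulN1r vf_I01//; congr (- _).
by apply: eq_I01 => s _; exact: vf_kern.
Qed.

Lemma supp_vf L f : supp B kappa f -> supp B kappa (vf L f).
Proof. by move=> uf q kq; exact: (supp_dd _ uf). Qed.

(** [X] commutes with the scalings, so [X] of the primitive is the integral of the derivative of
    [psi (s x, y / s)] in [s]; the boundary term is [psi p] at 1 and 0 at 0. *)
Lemma hyp_flat_prim p : vf hyp flat_prim p = psi p.
Proof.
rewrite vf_flat_prim; [|exact: hyp_linear|]; last first.
  by move=> s q; rewrite !sc_hyp.
have pk := kern1_psmooth (smooth_vf hyp_linear sp) (flat_vf hyp_linear sp fp) (supp_vf hyp up).
have ck := psmooth_continuous1 (p:=p) pk.
rewrite -mulN1r -I01Z//.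
apply: (etrans (@I01_FTC R (fun s => kern A B (fun=> 1) 0 psi s p)
  (fun s => -1 * kern A B (fun=> 1) 1 (vf hyp psi) s p) _ _)).
- by move=> s; apply: cvgMl_tmp; exact: ck.
- by move=> s; rewrite mulN1r; exact: kern_derive.
- by rewrite /kern ltr01 ltxx subr0 expr0 !invr1 !mul1r !sc1.
Qed.

End flat_primitive.

Section flat_solve.
Context {R : realType} {N : nat}.
Notation V := 'rV[R]_N.
Implicit Types (L : V -> V) (r : V -> R).

(** The cutoff in [y] reaches out to [|y| = d / 2]. At [(s x, y / s)] either the cutoff vanishes or
    the [y]-part is below [d / 2]; in the second case the point lies in the ball of radius [d]
    because [p] does. Hence vanishing of [vf L r] on that ball passes to [H]. *)
Lemma flat_solve (A B : {set 'I_N}) r (d : R) : disj A B -> smooth r -> flat A r -> 0 < d ->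
  exists H : V -> R, [/\ smooth H, (\forall p \near (0 : V), r p = vf (hyp A B) H p) &
    forall L, linear L -> off A L -> off B L -> zero_ball d (vf L r) -> zero_ball d (vf L H)].
Proof.
move=> AB sr fr d0.
pose kappa : R := (d / 2) ^+ 2.
have k0 : 0 < kappa by rewrite exprn_gt0// divr_gt0.
pose b (p : V) : R := kappa^-1 * qf B p.
have sb : smooth b by apply: smooth_mul; [exact: smooth_cst|exact: smooth_qf].
have sbb := smooth_bump sb.
pose psi p := bumpf (b p) * r p.
have sp : smooth psi by apply: smooth_mul.
have fp : flat A psi by move=> m; apply: vanM.
have up : supp B kappa psi.
  move=> q kq; rewrite /psi bump0 ?mul0r// /b mulrC ler_pdivlMr// mul1r; exact: ltW.
exists (flat_prim A B psi); split.
- exact: (smooth_flat_prim AB (ltW k0)).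
- have cb : continuous b by exact: smooth_continuous.
  have : \forall p \near (0 : V), bumpf (b p) = 1.
    apply: near_bump1 => //; rewrite /b qf_eq0 ?mulr0 ?invr_gt0// => i _.
    by rewrite mxE.
  apply: (@filterS _ (nbhs (0 : V))) => p b1.
  by rewrite (hyp_flat_prim AB (ltW k0) sp fp up) /psi b1 mul1r.
- move=> L lL oA oB zL p pd.
  rewrite (vf_flat_prim AB (ltW k0) sp fp up)//; last first.
    by move=> s q; rewrite (off_sc _ _ lL oB) (off_sc _ _ lL oA).
  rewrite (_ : I01 _ = 0) ?oppr0//.
  rewrite -[RHS](I01_cst 0); apply: eq_I01 => s /andP[s0 s1].
  rewrite /kern; case: ifPn => // s0'; set q := sc A s _.
  suff -> : vf L psi q = 0 by rewrite mulr0.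
  rewrite /psi vfM// [X in _ + _ * X](_ : _ = 0) ?mulr0 ?addr0; last first.
    by apply: dd_bump0 => //; rewrite -/(vf L b q) /b vfZ ?vf_qf_off ?mulr0//; exact: smooth_qf.
  have [kq|kq] := leP kappa (qf B q).
    by rewrite bump0 ?mul0r// /b mulrC ler_pdivlMr// mul1r.
  rewrite zL ?mulr0//.
  apply: (@le_lt_trans _ _ (Num.max (d / 2) `|p|)); last first.
    by rewrite gt_max pd andbT ltr_pdivrMr// ltr_pMr// ltr1n.
  apply: norm_row_le => [|i]; first by rewrite le_max divr_ge0// ltW.
  rewrite le_max; case: (boolP (i \in B)) => iB.
    apply/orP; left; apply: abs_le_sqr; first by rewrite divr_ge0// ltW.
    by apply: le_trans (coord_qf _ iB) _; exact: ltW.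
  apply/orP; right; rewrite /q !sc_coord (negbTE iB).
  apply: le_trans (coord_norm_le p i); case: ifP => // _.
  by rewrite normrM ger0_norm// ler_piMl.
Qed.

End flat_solve.

(** * Hyperbolic fields *)

Section hyp_split.
Context {R : realType} {N : nat}.
Notation V := 'rV[R]_N.
Implicit Types (f g u w psi : V -> R) (p q v : V) (i : 'I_N) (L : V -> V).

Lemma PopB (C : {set 'I_N}) a f g p : smooth f -> smooth g ->
  Pop C a (fun p => f p - g p) p = Pop C a f p - Pop C a g p.
Proof.
move=> sf sg; have sg' : smooth (fun p => -1 * g p) by apply: smooth_mul => //; exact: smooth_cst.
have E : (fun p => f p - g p) = (fun p => f p + -1 * g p) by apply/funext => q; rewrite mulN1r.
rewrite E; apply: (etrans (PopD C a p sf sg')).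
by rewrite (PopZ C a (-1) p sg) mulN1r.
Qed.

Lemma off_eul0 (C : {set 'I_N}) L q : linear L -> off C L -> L (eul C q) = 0 /\ eul C (L q) = 0.
Proof.
move=> lL [L1 L2]; split.
  rewrite (lin_sum _ lL) big1// => i _; rewrite mxE; case: ifP => iC; last by rewrite scale0r.
  by rewrite L2// scaler0.
by apply/rowP => k; rewrite !mxE; case: ifP => // kC; rewrite L1.
Qed.

Variables A B : {set 'I_N}.
Hypothesis AB : disj A B.
Let BA := disj_sym AB.
Let X : V -> V := hyp A B.
Let lX : linear X := hyp_linear A B.

Lemma off_hyp L q : linear L -> off A L -> off B L -> L (X q) = X (L q).
Proof.
move=> lL oA oB; rewrite /X /hyp -!(scaleN1r (eul A _)) !(addrC (eul B _)) lL.
by rewrite !(off_eul0 _ lL oA).1 !(off_eul0 _ lL oA).2 !(off_eul0 _ lL oB).1 !(off_eul0 _ lL oB).2.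
Qed.

Lemma vf_ssumf L (w : nat -> V -> R) p : sdom w -> (forall a, vf L (w a) p = 0) ->
  vf L (ssumf w) p = 0.
Proof.
move=> sw w0; rewrite /vf (dd_ssumf _ _ sw) /ssumf (@ssum_finite _ 0) ?big_ord0// => a _.
exact: w0.
Qed.

Lemma vf_mul_bump L f (q : V -> R) p : smooth f -> smooth q -> vf L q p = 0 ->
  vf L (fun p => f p * bumpf (q p)) p = bumpf (q p) * vf L f p.
Proof.
move=> sf sq q0; rewrite vfM//; last exact: smooth_bump.
by rewrite [X in f p * X](dd_bump0 sq q0) mulr0 add0r.
Qed.

Lemma hyp_qf p : vf X (qf A) p = - (2 * qf A p) /\ vf X (qf B) p = 2 * qf B p.
Proof.
split; rewrite vf_hyp ?vf_qf_eul; try exact: smooth_qf.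
  by rewrite vf_qf_off ?sub0r//; exact: off_eul.
by rewrite vf_qf_off ?subr0//; exact: off_eul.
Qed.

(** On the part of bidegree [(a, a)] the field [E_B - E_A] acts as [a - a = 0]. This is why the
    Taylor coefficients of [f] ignore every term [X u]. *)
Lemma Pop_hyp0 a u p : smooth u -> Pop B a (Pop A a (vf X u)) p = 0.
Proof.
move=> su; have sA := smooth_vf (eul_linear A) su; have sB := smooth_vf (eul_linear B) su.
have sw := smooth_Pop A a su.
have -> : Pop A a (vf X u) = fun q => vf (eul B) (Pop A a u) q - a%:R * Pop A a u q.
  apply/funext => q.
  have -> : vf X u = fun q => vf (eul B) u q - vf (eul A) u q.
    by apply/funext => x; exact: vf_hyp.
  apply: (etrans (PopB A a q sB sA)).
  by rewrite (Pop_eul A a q su) (vf_Pop a q (eul_linear B) (off_eul AB) su).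
apply: (etrans (PopB B a p (smooth_vf (eul_linear B) sw) _)).
  by apply: smooth_mul => //; exact: smooth_cst.
by rewrite (Pop_eul B a p sw) (PopZ B a _ p sw) subrr.
Qed.

Lemma hyp_homog0 a f p : smooth f -> homog A a f -> homog B a f -> vf X f p = 0.
Proof.
by move=> sf hA hB; rewrite vf_hyp// (homog_euler p sf hA) (homog_euler p sf hB) subrr.
Qed.

(** The radius [d] is fixed beforehand since the cutoff inside [flat_solve] depends on it and enters
    [H]. The radius [e] of the last clause is free: [f] is the Borel sum alone. *)
Lemma hyp_split g (d : R) : smooth g -> 0 < d -> exists f H,
  [/\ smooth f /\ smooth H, \forall p \near (0 : V), g p = f p + vf X H p,
    forall p, vf X f p = 0,
    forall L, linear L -> off A L -> off B L -> zero_ball d (vf L g) -> zero_ball d (vf L H) &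
    forall L u e, linear L -> off A L -> off B L -> smooth u ->
      (forall p, `|p| < e -> vf L g p = vf X u p) -> zero_ball e (vf L f)].
Proof.
move=> sg d0.
pose h a := Pop A a g; pose v a := Pop B a (h a); pose K a := Qop B a (h a).
have sh a : smooth (h a) by exact: smooth_Pop.
have sv a : smooth (v a) by exact: smooth_Pop.
have sK a : smooth (K a) by exact: smooth_Qop.
have hh a : homog A a (h a) by move=> t p; exact: Pop_homog.
have hvA a : homog A a (v a) by exact: (homog_Pop_disj a BA (sh a) (hh a)).
have hvB a : homog B a (v a) by move=> t p; exact: Pop_homog.
have hK a : homog A a (K a) by exact: (homog_Qop_disj a BA (sh a) (hh a)).
(* [K a] has degree [a] in [x], so [X = E_B - E_A] acts on it as [E_B - a], and [QopP] in the
   variables [B] applies. *)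
have E a p : h a p = v a p + vf X (K a) p.
  by rewrite vf_hyp// (homog_euler p (sK a) (hK a)); exact: QopP.
(* The cutoff for the [v a] depends on [|x|^2 |y|^2], which [X] preserves, so [X f = 0] holds
   exactly. The [K a] only need to be right to infinite order along [x = 0], so a cutoff in [x]
   suffices. *)
have [mf sdf] := borel2 AB sv hvA hvB; have [mk sdk] := borel1 sK hK.
set wf := (fun a p => _) in sdf; set wk := (fun a p => _) in sdk.
pose f := ssumf wf; pose k := ssumf wk.
have sf : smooth f by exact: smooth_ssumf.
have sk : smooth k by exact: smooth_ssumf.
pose r p := g p - f p - vf X k p.
have svk : smooth (vf X k) by exact: smooth_vf.
have sgf : smooth (fun p => g p - f p) by exact: smooth_sub.
have sr : smooth r by exact: smooth_sub.
have sqf a : smooth (fun p : V => qcut A (mf a) p * qf B p).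
  by apply: smooth_mul; [exact: smooth_qcut|exact: smooth_qf].
have qf0 a p : on0 A p -> qcut A (mf a) p * qf B p = 0.
  by move=> p0; rewrite /qcut qf_eq0 ?mulr0 ?mul0r.
have qk0 a p : on0 A p -> qcut A (mk a) p = 0.
  by move=> p0; rewrite /qcut qf_eq0 ?mulr0.
have nb (q : V -> R) p : continuous q -> q p = 0 -> \near p, bumpf (q p) = 1.
  by move=> cq q0; apply: near_bump1 => //; rewrite q0 invr_gt0.
have fr : flat A r.
  move=> m.
  (* Order [m + 1] is needed because applying [X] to the third difference costs one order. The
     finite sums then cancel by [E]. *)
  have v1 : van A m.+1 (fun p => g p - \sum_(a < m.+1) h a p).
    rewrite (_ : (fun p => _) = Rop A m.+1 g); first exact: van_Rop.
    by apply/funext => p; rewrite {1}(taylor A m.+1 p sg) addrAC subrr add0r.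
  have v2 : van A m.+1 (fun p => f p - \sum_(a < m.+1) v a p).
    apply: van_ssumf => // [a p p0|a ma].
      have H := nb _ p (smooth_continuous (sqf a)) (qf0 a p p0).
      by apply: (@filterS _ (nbhs p)) H => x; rewrite /wf => ->; rewrite mulr1.
    exact: van_homog (sv a) ma (hvA a).
  have v3 : van A m.+1 (fun p => k p - \sum_(a < m.+1) K a p).
    apply: van_ssumf => // [a p p0|a ma].
      have H := nb _ p (smooth_continuous (smooth_qcut A (mk a))) (qk0 a p p0).
      by apply: (@filterS _ (nbhs p)) H => x; rewrite /wk => ->; rewrite mulr1.
    exact: van_homog (sK a) ma (hK a).
  have s1 : smooth (fun p => g p - \sum_(a < m.+1) h a p) by apply: smooth_sub => //; exact: smooth_sum.
  have s2 : smooth (fun p => f p - \sum_(a < m.+1) v a p) by apply: smooth_sub => //; exact: smooth_sum.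
  have sKs : smooth (fun p => \sum_(a < m.+1) K a p) by exact: smooth_sum.
  have s3 : smooth (fun p => k p - \sum_(a < m.+1) K a p) by exact: smooth_sub.
  have v4 := van_vf lX s3 v3.
  rewrite (_ : r = fun p => (g p - \sum_(a < m.+1) h a p) - (f p - \sum_(a < m.+1) v a p)
     - vf X (fun p => k p - \sum_(a < m.+1) K a p) p).
    apply: vanB => //; [exact: smooth_sub|exact: smooth_vf|].
    by apply: vanB => //; exact: vanS.
  apply/funext => p; rewrite (vfB X p sk sKs).
  rewrite (@vf_sum _ _ _ _ _ _ (fun (a : 'I_m.+1) => K a) p)//.
  rewrite (eq_bigr (fun a : 'I_m.+1 => v a p + vf X (K a) p)); last by move=> a _; exact: E.
  by rewrite big_split/= /r; ring.
have [H2 [sH2 EH2 ZH2]] := flat_solve AB sr fr d0.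
have lf L a p : linear L -> off A L -> off B L -> vf L (wf a) p =
    bumpf (qcut A (mf a) p * qf B p) * Pop B a (Pop A a (vf L g)) p.
  move=> lL oA oB; rewrite (@vf_mul_bump L (v a) (fun p => qcut A (mf a) p * qf B p))//.
    rewrite (vf_Pop a p lL oB (sh a)) (_ : vf L (h a) = Pop A a (vf L g))//.
    by apply/funext => q; exact: vf_Pop.
  rewrite (@vfM _ _ L (qcut A (mf a)) (qf B)); [|exact: smooth_qcut|exact: smooth_qf].
  by rewrite /qcut vfZ ?vf_qf_off ?mulr0 ?addr0//; exact: smooth_qf.
have lk L a p : linear L -> off A L -> off B L -> vf L (wk a) p =
    bumpf (qcut A (mk a) p) * Qop B a (Pop A a (vf L g)) p.
  move=> lL oA oB; rewrite (@vf_mul_bump L (K a) (qcut A (mk a)))//.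
  - rewrite (vf_Qop a p lL oB (sh a)) (_ : vf L (h a) = Pop A a (vf L g))//.
    by apply/funext => q; exact: vf_Pop.
  - exact: smooth_qcut.
  - by rewrite /qcut vfZ ?vf_qf_off ?mulr0//; exact: smooth_qf.
exists f, (fun p => k p + H2 p); split.
- by split=> //; exact: smooth_add.
- apply: (@filterS _ (nbhs (0 : V))) EH2 => p.
  by rewrite vfD// -/X => <-; rewrite /r; ring.
- move=> p; apply: vf_ssumf => // a.
  rewrite (@vf_mul_bump X (v a) (fun p => qcut A (mf a) p * qf B p))//.
    by rewrite (@hyp_homog0 a)// mulr0.
  rewrite (@vfM _ _ X (qcut A (mf a)) (qf B)); [|exact: smooth_qcut|exact: smooth_qf].
  rewrite {2}/qcut vfZ; last exact: smooth_qf.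
  by rewrite (hyp_qf p).1 (hyp_qf p).2 /qcut; ring.
- move=> L lL oA oB zg.
  have zk : zero_ball d (vf L k).
    move=> p pd; apply: vf_ssumf => // a; rewrite lk//.
    by rewrite (zero_ball_Qop B a (zero_ball_Pop A a zg) pd) mulr0.
  have zf : zero_ball d (vf L f).
    move=> p pd; apply: vf_ssumf => // a; rewrite lf//.
    by rewrite (zero_ball_Pop B a (zero_ball_Pop A a zg) pd) mulr0.
  have zr : zero_ball d (vf L r).
    move=> p pd; rewrite (vfB L p sgf svk) (vfB L p sg sf) zg// zf// subrr sub0r.
    rewrite (vf_comm p lL lX (fun q => off_hyp q lL oA oB) sk).
    by rewrite /vf (zero_ball_dd (X p) zk pd) oppr0.
  by move=> p pd; rewrite (vfD L p sk sH2) zk// (ZH2 L lL oA oB zr)// addr0.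
- move=> L u e lL oA oB su gu p pe; apply: vf_ssumf => // a; rewrite lf//.
  have sLg := smooth_vf lL sg; have sXu := smooth_vf lX su.
  (* On the ball [vf L g] differs from [vf X u] by a function that vanishes there; its Taylor parts
     vanish on the ball, and those of [vf X u] vanish by [Pop_hyp0]. *)
  pose D q := vf L g q - vf X u q.
  have sD : smooth D by exact: smooth_sub.
  have zD : zero_ball e D by move=> q qe; rewrite /D gu// subrr.
  have EQ : Pop A a (vf L g) = fun q => Pop A a D q + Pop A a (vf X u) q.
    apply/funext => q; rewrite -(PopD A a q sD sXu); f_equal.
    by apply/funext => x; rewrite /D subrK.
  rewrite EQ (PopD B a p (smooth_Pop A a sD) (smooth_Pop A a sXu)) Pop_hyp0//.
  by rewrite (zero_ball_Pop B a (zero_ball_Pop A a zD) pe) addr0 mulr0.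
Qed.

End hyp_split.

(** * Rotations *)

Section rotation.
Context {R : realType} {N : nat}.
Notation V := 'rV[R]_N.
Implicit Types (f g h u : V -> R) (p q v : V) (L : V -> V) (s : R).
Variables (X : V -> V) (c : R).
Hypotheses (lX : linear X) (c0 : 0 < c) (X3 : forall p, X (X (X p)) = - (c ^+ 2) *: X p).

(** Rodrigues' formula: [X^3 = - c^2 X] gives [exp (t X) = 1 + c^-1 sin (c t) X + c^-2 (1 - cos (c
    t)) X^2]. Here [c t = 2 pi s], so the period in [s] is 1. *)
Definition rotA s : R := c^-1 * sin (2 * pi * s).
Definition rotB s : R := c ^- 2 * (1 - cos (2 * pi * s)).
Definition rot s p : V := rotA s *: X p + (rotB s *: X (X p) + p).

Lemma rot_linear s : linear (rot s).
Proof.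
move=> a u v; rewrite /rot !lX; apply/rowP => k; rewrite !mxE; ring.
Qed.

Lemma rot_comm L s p : linear L -> (forall q, L (X q) = X (L q)) -> rot s (L p) = L (rot s p).
Proof. by move=> lL LX; rewrite /rot -!LX !(linD _ _ lL) !(linZ _ _ lL). Qed.

Lemma rot0 p : rot 0 p = p.
Proof. by rewrite /rot /rotA /rotB mulr0 sin0 cos0 subrr !mulr0 !scale0r !add0r. Qed.

Lemma rot1 p : rot 1 p = p.
Proof.
by rewrite /rot /rotA /rotB mulr1 mulr_natl sin2pi cos2pi subrr !mulr0 !scale0r !add0r.
Qed.

Lemma rotA_derive s : is_derive s (1 : R) rotA (2 * pi / c * cos (2 * pi * s)).
Proof.
have d : is_derive s (1 : R) (fun s : R => 2 * pi * s) (2 * pi).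
  have h := is_deriveM (is_derive_cst (2 * pi : R) s (1 : R)) (is_derive_id s (1 : R)).
  by rewrite scaler0 addr0 [_ *: _]mulr1 in h.
have h1 := @is_derive1_comp R sin (fun s => 2 * pi * s) s _ _ (is_derive_sin _) d.
have h2 := is_deriveM (is_derive_cst (c^-1 : R) s (1 : R)) h1.
apply: (is_derive_eq h2); rewrite scaler0 addr0 /= /GRing.scale/=; ring.
Qed.

Lemma rotB_derive s : is_derive s (1 : R) rotB (2 * pi / c ^+ 2 * sin (2 * pi * s)).
Proof.
have d : is_derive s (1 : R) (fun s : R => 2 * pi * s) (2 * pi).
  have h := is_deriveM (is_derive_cst (2 * pi : R) s (1 : R)) (is_derive_id s (1 : R)).
  by rewrite scaler0 addr0 [_ *: _]mulr1 in h.
have h1 := @is_derive1_comp R cos (fun s => 2 * pi * s) s _ _ (is_derive_cos _) d.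
have h3 := is_deriveB (is_derive_cst (1 : R) s (1 : R)) h1.
have h2 := is_deriveM (is_derive_cst (c ^- 2 : R) s (1 : R)) h3.
apply: (is_derive_eq h2); rewrite scaler0 addr0 /= /GRing.scale/=; ring.
Qed.

Lemma rotA_continuous : continuous rotA.
Proof. by move=> s; apply/differentiable_continuous/derivable1_diffP; case: (rotA_derive s). Qed.

Lemma rotB_continuous : continuous rotB.
Proof. by move=> s; apply/differentiable_continuous/derivable1_diffP; case: (rotB_derive s). Qed.

Lemma rot_continuous : continuous (fun z : R * V => rot z.1 z.2).
Proof.
move=> z; have c1 : x.1 @[x --> z] --> z.1 by exact: cvg_fst.
have c2 : x.2 @[x --> z] --> z.2 by exact: cvg_snd.
have cX : continuous X by exact: linear_row_continuous.
have cA := cvg_comp (fun x : R * V => x.1) rotA c1 (rotA_continuous (x := z.1)).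
have cB := cvg_comp (fun x : R * V => x.1) rotB c1 (rotB_continuous (x := z.1)).
have cX1 := cvg_comp (fun x : R * V => x.2) X c2 (cX z.2).
have cX2 := cvg_comp (fun x : R * V => X x.2) X cX1 (cX (X z.2)).
apply: (@cvgD R V _ _ _ (fun x : R * V => rotA x.1 *: X x.2)
   (fun x : R * V => rotB x.1 *: X (X x.2) + x.2)).
  exact: (@cvgZ R V _ _ _ (fun x : R * V => rotA x.1) (fun x : R * V => X x.2) _ _ cA cX1).
apply: (@cvgD R V _ _ _ (fun x : R * V => rotB x.1 *: X (X x.2)) (fun x : R * V => x.2)); last exact: c2.
exact: (@cvgZ R V _ _ _ (fun x : R * V => rotB x.1) (fun x : R * V => X (X x.2)) _ _ cB cX2).
Qed.

Lemma rot_derive f p s : smooth f ->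
  is_derive s (1 : R) (fun s => f (rot s p)) (2 * pi / c * vf X f (rot s p)).
Proof.
move=> sf; have D := is_derive_curve (X p) (X (X p)) p sf (rotA_derive s) (rotB_derive s).
apply: (is_derive_eq D); rewrite -/(rot s p).
have -> : vf X f (rot s p) = cos (2 * pi * s) * dd (X p) f (rot s p) +
    c^-1 * sin (2 * pi * s) * dd (X (X p)) f (rot s p).
  rewrite /vf -!derive_homog// -derive_addv//; congr (dd _ f _).
  (* Applying [X] to [rot s p] and reducing [X^3], the coefficient of [X p] becomes
     [1 - c^2 rotB s = cos (2 pi s)]. *)
  rewrite /rot !(linD _ _ lX) !(linZ _ _ lX) X3 /rotA /rotB.
  apply/rowP => k; rewrite !mxE; field; rewrite gt_eqF//.
by field; rewrite gt_eqF.
Qed.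

Lemma psmooth_rot (k : R -> R) f : continuous k -> smooth f ->
  psmooth (fun s p => k s * f (rot s p)).
Proof. by move=> ck sf; exact: (psmooth_lin rot_linear rot_continuous ck sf). Qed.

(** Whole orbits of points near 0 stay near 0, so relations between germs can be averaged. The sup
    norm need not be preserved by the rotation; boundedness of the coefficients is used instead. *)
Lemma near_rot (P : set V) : (\forall p \near (0 : V), P p) ->
  \forall p \near (0 : V), forall s, 0 <= s <= 1 -> P (rot s p).
Proof.
move=> /nbhs_norm0P[e /= e0 eP].
have e3 : 0 < e / 3 by rewrite divr_gt0.
have cX : continuous X by exact: linear_row_continuous.
have nX : `|X p| @[p --> (0 : V)] --> (0 : R).
  have := cvg_norm (cX 0); rewrite (lin0 lX) normr0; exact.
have nXX : `|X (X p)| @[p --> (0 : V)] --> (0 : R).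
  have h := cvg_comp X X (cX 0) (cX (X 0)).
  have := cvg_norm h; rewrite (lin0 lX) (lin0 lX) normr0; exact.
have n0 : `|p| @[p --> (0 : V)] --> (0 : R).
  have := @cvg_norm R V V (nbhs (0 : V)) _ id 0 cvg_id; rewrite normr0; exact.
have c1 : 0 < c * (e / 3) by rewrite mulr_gt0.
(* The denominator 6 instead of 3 accounts for [1 - cos <= 2]. *)
have c2 : 0 < c ^+ 2 * (e / 6) by rewrite mulr_gt0// ?exprn_gt0// divr_gt0.
near=> p => s _; apply: eP => /=.
have h1 : `|X p| < c * (e / 3) by near: p; exact: (cvgr_lt _ nX).
have h2 : `|X (X p)| < c ^+ 2 * (e / 6) by near: p; exact: (cvgr_lt _ nXX).
have h3 : `|p| < e / 3 by near: p; exact: (cvgr_lt _ n0).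
have a1 : `|rotA s *: X p| <= c^-1 * `|X p|.
  rewrite normrZ ler_wpM2r// normrM gtr0_norm ?invr_gt0//.
  by apply: ler_piMr; [rewrite invr_ge0 ltW|rewrite ler_norml sin_geN1 sin_le1].
have a2 : `|rotB s *: X (X p)| <= c ^- 2 * (2 * `|X (X p)|).
  rewrite normrZ mulrA ler_wpM2r// normrM gtr0_norm ?invr_gt0 ?exprn_gt0//.
  apply: ler_wpM2l; first by rewrite invr_ge0 exprn_ge0// ltW.
  have := cos_geN1 (2 * pi * s); have := cos_le1 (2 * pi * s).
  by rewrite ler_norml; lra.
have b1 : c^-1 * `|X p| < e / 3 by rewrite ltr_pdivrMl.
have b2 : c ^- 2 * (2 * `|X (X p)|) < e / 3.
  rewrite ltr_pdivrMl ?exprn_gt0//; lra.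
rewrite /rot; apply: le_lt_trans (ler_normD _ _) _.
have := ler_normD (rotB s *: X (X p)) p; lra.
Unshelve. all: by end_near. Qed.

Definition rmean (k : R -> R) g p : R := I01 (fun s => k s * g (rot s p)).

Lemma smooth_rmean k g : continuous k -> smooth g -> smooth (rmean k g).
Proof. by move=> ck sg; apply: smooth_I01; exact: psmooth_rot. Qed.

Lemma vf_rmean L k g p : continuous k -> smooth g -> linear L ->
  (forall q, L (X q) = X (L q)) -> vf L (rmean k g) p = rmean k (vf L g) p.
Proof.
move=> ck sg lL LX; rewrite /rmean vf_I01; last exact: psmooth_rot.
apply: eq_I01 => s _; rewrite vfZ; last exact: (smooth_lin_comp (rot_linear s)).
apply: (congr1 (fun x => k s * x)).
by apply: (vf_lin_comp _ _ (rot_linear s)) => q; exact: rot_comm.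
Qed.

Lemma rmean_near k g h : (\forall p \near (0 : V), g p = h p) ->
  \forall p \near (0 : V), rmean k g p = rmean k h p.
Proof.
move=> /near_rot; apply: (@filterS _ (nbhs (0 : V))) => p H.
by apply: eq_I01 => s /H ->.
Qed.

Lemma rmeanD k g h p : continuous k -> smooth g -> smooth h ->
  rmean k (fun p => g p + h p) p = rmean k g p + rmean k h p.
Proof.
move=> ck sg sh; rewrite /rmean -I01D.
- by apply: eq_I01 => s _; rewrite mulrDr.
- exact: (psmooth_continuous1 (psmooth_rot ck sg)).
- exact: (psmooth_continuous1 (psmooth_rot ck sh)).
Qed.

Lemma rmean0 k p : rmean k (fun=> 0) p = 0.
Proof. by rewrite /rmean -[RHS](I01_cst 0); apply: eq_I01 => s _; rewrite mulr0. Qed.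

Notation one := (fun=> 1 : R).

Lemma cont1 : continuous (one : R -> R). Proof. exact: cst_continuous. Qed.
Lemma cont_id : continuous (id : R -> R). Proof. by move=> x; exact: cvg_id. Qed.

Lemma rmean_vf0 g p : smooth g -> rmean one (vf X g) p = 0.
Proof.
move=> sg; have sv := smooth_vf lX sg.
have cv := psmooth_continuous1 (p:=p) (psmooth_rot cont1 sv).
have t0 : 2 * pi / c != 0 by rewrite mulf_neq0 ?invr_eq0 ?mulf_neq0 ?gt_eqF ?pi_gt0.
apply: (mulfI t0); rewrite mulr0 /rmean -I01Z//.
apply: (etrans (@I01_FTC R (fun s => g (rot s p)) (fun s => 2 * pi / c * (1 * vf X g (rot s p))) _ _)).
- by move=> s; apply: cvgMl_tmp; exact: cv.
- by move=> s; rewrite mul1r; exact: rot_derive.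
- by rewrite rot0 rot1 subrr.
Qed.

(** Integration by parts over one period: the derivative of [s * g (rot s p)] integrates to [g p],
    since [rot 1 p = p]. *)
Lemma rmean_vf_id g p : smooth g -> 2 * pi / c * rmean id (vf X g) p = g p - rmean one g p.
Proof.
move=> sg; have sv := smooth_vf lX sg.
have cv := psmooth_continuous1 (p:=p) (psmooth_rot cont_id sv).
have cg := psmooth_continuous1 (p:=p) (psmooth_rot cont1 sg).
rewrite /rmean -I01Z//; apply/eqP; rewrite eq_sym subr_eq; apply/eqP.
rewrite -I01D//; last by move=> s; apply: cvgMl_tmp; exact: cv.
apply: esym; apply: (etrans (@I01_FTC R (fun s => s * g (rot s p)) _ _ _)).
- by move=> s; apply: cvgD; [apply: cvgMl_tmp; exact: cv|exact: cg].
- move=> s; have h := is_deriveM (is_derive_id s (1 : R)) (rot_derive p s sg).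
  by apply: (is_derive_eq h); rewrite /GRing.scale/=; ring.
- by rewrite rot1 mul1r mul0r subr0.
Qed.

Lemma rmean_inv g : smooth g -> (\forall p \near (0 : V), vf X g p = 0) ->
  \forall p \near (0 : V), rmean one g p = g p.
Proof.
move=> sg /(rmean_near id (h := fun=> 0)).
apply: (@filterS _ (nbhs (0 : V))) => p; rewrite rmean0 => h.
by have := rmean_vf_id p sg; rewrite h mulr0 => /esym/eqP; rewrite subr_eq0 => /eqP.
Qed.

(** In the last clause [vf L] commutes with the mean, so near 0 [vf L f] is the mean of [vf X u]
    over a period, which is 0. *)
Lemma rot_split g : smooth g -> exists f H, [/\ smooth f /\ smooth H,
  forall p, g p = f p + vf X H p, forall p, vf X f p = 0,
  forall L, linear L -> (forall q, L (X q) = X (L q)) ->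
    (\forall p \near (0 : V), vf L g p = 0) -> \forall p \near (0 : V), vf L H p = 0 &
  forall L u, linear L -> (forall q, L (X q) = X (L q)) -> smooth u ->
    (\forall p \near (0 : V), vf L g p = vf X u p) -> \forall p \near (0 : V), vf L f p = 0].
Proof.
move=> sg; exists (rmean one g), (fun p => 2 * pi / c * rmean id g p).
have s1 := smooth_rmean cont1 sg; have s2 := smooth_rmean cont_id sg.
split.
- by split=> //; apply: smooth_mul => //; exact: smooth_cst.
- move=> p; rewrite vfZ// (vf_rmean p cont_id sg lX)// rmean_vf_id//; ring.
- by move=> p; rewrite (vf_rmean p cont1 sg lX)// rmean_vf0.
- move=> L lL LX /(rmean_near id (h := fun=> 0)).
  apply: (@filterS _ (nbhs (0 : V))) => p; rewrite rmean0 => h.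
  by rewrite vfZ// (vf_rmean p cont_id sg lL LX) h mulr0.
- move=> L u lL LX su /(rmean_near one).
  apply: (@filterS _ (nbhs (0 : V))) => p; rewrite rmean_vf0// => h.
  by rewrite (vf_rmean p cont1 sg lL LX).
Qed.

End rotation.

(** * Commuting families *)

Section families.
Context {R : realType} {N : nat} {I : finType}.
Notation V := 'rV[R]_N.
Implicit Types (f g h u : V -> R) (p q v : V) (i j k : I).
Variable X : I -> V -> V.
Hypotheses (lX : forall i, linear (X i)) (cX : forall i j q, X i (X j q) = X j (X i q)).

Definition near0 (P : V -> Prop) := \forall p \near (0 : V), P p.

Lemma near0_imp (P Q : V -> Prop) : (forall p, P p -> Q p) -> near0 P -> near0 Q.
Proof. by move=> PQ; apply: (@filterS _ (nbhs (0 : V))). Qed.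

Lemma near0_imp2 (P Q S : V -> Prop) : (forall p, P p -> Q p -> S p) -> near0 P -> near0 Q -> near0 S.
Proof. by move=> PQS nP nQ; exact: (@filterS2 _ (nbhs (0 : V)) _ _ _ _ PQS nP nQ). Qed.

Lemma near0_all (P : V -> Prop) : (forall p, P p) -> near0 P.
Proof. by move=> Pp; exact: (@filterE _ (nbhs (0 : V)) _ _ Pp). Qed.

Lemma near0_vf (L : V -> V) f g : near0 (fun p => f p = g p) -> near0 (fun p => vf L f p = vf L g p).
Proof.
move=> fg; have := nbhs_interior fg.
apply: (@filterS _ (nbhs (0 : V))) => q qI; exact: near_eq_derive.
Qed.

Lemma near0_ball f : near0 (fun p => f p = 0) -> exists2 e : R, 0 < e & zero_ball e f.
Proof. by move=> /nbhs_norm0P[e /= e0 H]; exists e. Qed.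

Lemma ball_near0 e f : 0 < e -> zero_ball e f -> near0 (fun p => f p = 0).
Proof. by move=> e0 z; apply/nbhs_norm0P; exists e. Qed.

(* The induction step; taking [j = i] and [u = g] in the last clause shows that
   [f] is killed by [X i] as well. *)
Definition splittable (D : pred I) i := forall g, smooth g ->
  (forall j, D j -> near0 (fun p => vf (X j) g p = 0)) ->
  exists f H, [/\ smooth f /\ smooth H,
    near0 (fun p => g p = f p + vf (X i) H p),
    forall j, D j -> near0 (fun p => vf (X j) H p = 0) &
    forall j u, smooth u -> near0 (fun p => vf (X j) g p = vf (X i) u p) ->
      near0 (fun p => vf (X j) f p = 0)].

(** Induction on the treated prefix. The splitting hypothesis is asked only for actual prefixes of
    [l], which lets the order of [l] encode that rotations come before the focus-focus fields that
    rely on them. *)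
Lemma solve_family (l : seq I) (g : I -> V -> R) :
  (forall l1 i l2, l = l1 ++ i :: l2 -> splittable (mem l1) i) ->
  (forall i, smooth (g i)) ->
  (forall i j, near0 (fun p => vf (X i) (g j) p = vf (X j) (g i) p)) ->
  exists G, exists2 f : I -> V -> R, smooth G & forall i, i \in l ->
    [/\ smooth (f i), near0 (fun p => g i p = f i p + vf (X i) G p) &
      forall j, near0 (fun p => vf (X j) (f i) p = 0)].
Proof.
move=> sp sg cg; elim/last_ind: l sp => [|l i IH] sp.
  by exists (fun=> 0), (fun _ _ => 0) => //; exact: smooth_cst.
have [l1 j l2 E|G [f sG Hf]] := IH.
  by apply: (sp l1 j (rcons l2 i)); rewrite E rcons_cat.
have [il|il] := boolP (i \in l).
  exists G, f => // j; rewrite mem_rcons in_cons => /orP[/eqP ->|]; exact: Hf.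
pose g' p := g i p - vf (X i) G p.
have sXG j : smooth (vf (X j) G) by exact: smooth_vf.
have sg' : smooth g' by exact: smooth_sub.
have Xg' j : near0 (fun p => vf (X j) g' p = vf (X i) (fun q => g j q - vf (X j) G q) p).
  apply: near0_imp (cg j i) => q E.
  by rewrite (vfB _ _ (sg i) (sXG i)) (vfB _ _ (sg j) (sXG j)) E (vf_comm q (lX j) (lX i) (cX j i) sG).
(* By compatibility [X_j g' = X_i (g_j - X_j G)], which near 0 is [X_i f_j]. It vanishes because
   [f_j] is killed by all fields, including the still untreated [X_i]. *)
have D0 j : mem l j -> near0 (fun p => vf (X j) g' p = 0).
  move=> jl; have [sfj Ej Fj] := Hf j jl.
  have E1 : near0 (fun p => g j p - vf (X j) G p = f j p).
    by apply: near0_imp Ej => p ->; rewrite addrK.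
  have E2 := near0_imp2 (fun p (e1 : vf (X i) _ p = vf (X i) (f j) p) => etrans e1) (near0_vf (X i) E1) (Fj i).
  exact: near0_imp2 (fun p e1 => etrans e1) (Xg' j) E2.
have spl : splittable (mem l) i by apply: (sp l i [::]); rewrite cats1.
have [f' [H [[sf' sH] E1 E2 E3]]] := spl g' sg' D0.
exists (fun p => G p + H p), (fun j => if j == i then f' else f j); first exact: smooth_add.
move=> j; rewrite mem_rcons in_cons; case: eqVneq => [->|ji] /= jl.
  split=> //.
    apply: near0_imp E1 => p; rewrite (vfD _ p sG sH) /g' => h.
    by rewrite addrCA -h addrC subrK.
  by move=> j'; apply: E3 (Xg' j'); apply: smooth_sub.
have [sfj Ej Fj] := Hf j jl; split=> //.
by apply: near0_imp2 Ej (E2 j jl) => p -> h; rewrite (vfD _ p sG sH) h addr0.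
Qed.

Lemma splittable_rot D i (c : R) : 0 < c ->
  (forall p, X i (X i (X i p)) = - (c ^+ 2) *: X i p) -> splittable D i.
Proof.
move=> c0 X3 g sg Dg.
have [f [H [sfH E F Z U]]] := rot_split (lX i) c0 X3 sg.
exists f, H; split=> //.
- exact: near0_all.
- by move=> j Dj; apply: Z => //; exact: Dg.
- by move=> j u su; exact: U.
Qed.

Lemma common_radius (P : I -> R -> Prop) : (forall i (a b : R), a <= b -> P i b -> P i a) ->
  (forall i, exists2 e : R, 0 < e & P i e) -> exists2 e : R, 0 < e & forall i, P i e.
Proof.
move=> Pm /(_ _)/cid2-/all_sig[F HF].
exists (\big[Num.min/1]_i F i) => [|i].
  by apply: lt_bigmin => // i _; case: (HF i).
by apply: (Pm i _ (F i)); [exact: bigmin_le|case: (HF i)].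
Qed.

Lemma hyp_near_split (A B : {set 'I_N}) (J : pred I) i g : disj A B -> X i = hyp A B ->
  (forall j, J j -> off A (X j) /\ off B (X j)) -> smooth g ->
  exists f H, [/\ smooth f /\ smooth H,
    near0 (fun p => g p = f p + vf (X i) H p), forall p, vf (X i) f p = 0,
    forall j, J j -> near0 (fun p => vf (X j) g p = 0) -> near0 (fun p => vf (X j) H p = 0) &
    forall j u, J j -> smooth u -> near0 (fun p => vf (X j) g p = vf (X i) u p) ->
      near0 (fun p => vf (X j) f p = 0)].
Proof.
move=> AB Xi oJ sg.
(* One radius must serve all the fields that kill [g] near 0. For the others the implication is
   vacuous, and any radius, here 1, will do. *)
have [e e0 He] : exists2 e : R, 0 < e & forall j,
    near0 (fun p => vf (X j) g p = 0) -> zero_ball e (vf (X j) g).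
  apply: (@common_radius (fun j e => near0 (fun p => vf (X j) g p = 0) -> zero_ball e (vf (X j) g))).
    by move=> j a b ab H /H z p pa; apply: z; exact: lt_le_trans ab.
  move=> j; have [/near0_ball[e e0 z]|n] := pselect (near0 (fun p => vf (X j) g p = 0)).
    by exists e.
  by exists 1.
have [f [H [sfH E F Z U]]] := hyp_split AB sg e0.
exists f, H; rewrite Xi; split=> //.
- move=> j /oJ[oA oB] /He zj; apply: (ball_near0 e0).
  exact: Z.
- move=> j u /oJ[oA oB] su /nbhs_norm0P[e' /= e'0 He'].
  by apply: (ball_near0 e'0); apply: (U (X j) u e').
Qed.

Lemma splittable_hyp (A B : {set 'I_N}) (D : pred I) i : disj A B -> X i = hyp A B -> ~~ D i ->
  (forall j, j != i -> off A (X j) /\ off B (X j)) -> splittable D i.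
Proof.
move=> AB Xi Di oX g sg Dg.
have [f [H [sfH E F Z U]]] := hyp_near_split AB Xi oX sg.
exists f, H; split=> //.
- move=> j Dj; apply: Z; last exact: Dg.
  by apply: contraNneq Di => <-.
- move=> j u su; have [->|ji] := eqVneq j i; last exact: U.
  by move=> _; exact: near0_all.
Qed.

(** [hyp_near_split] gives nothing for [X k], which acts on the same variables. Since [k] is in [D],
    [g] equals its mean [m g] near 0; the mean commutes with all the fields, so averaging [f] and
    [H] preserves their relations and makes both invariant under [X k]. *)
Lemma splittable_pair (A B : {set 'I_N}) (D : pred I) i k (c : R) : disj A B -> X i = hyp A B ->
  ~~ D i -> D k -> 0 < c -> (forall p, X k (X k (X k p)) = - (c ^+ 2) *: X k p) ->
  (forall j, j != i -> j != k -> off A (X j) /\ off B (X j)) -> splittable D i.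
Proof.
move=> AB Xi Di Dk c0 X3 oX g sg Dg.
have oJ j : (j != i) && (j != k) -> off A (X j) /\ off B (X j) by move=> /andP[]; exact: oX.
have [f [H [[sf sH] E F Z U]]] := hyp_near_split AB Xi oJ sg.
pose m := rmean (X k) c (fun=> 1).
have c1 := @cont1 R.
have mE j h p : smooth h -> vf (X j) (m h) p = m (vf (X j) h) p.
  by move=> sh; rewrite /m (vf_rmean c (lX k) p c1 sh (lX j) (cX j k)).
have sm h : smooth h -> smooth (m h) by exact: (smooth_rmean c (lX k) c1).
have mn g1 g2 : near0 (fun p => g1 p = g2 p) -> near0 (fun p => m g1 p = m g2 p).
  exact: (rmean_near (lX k) c0).
have m0 p : m (fun=> 0) p = 0 by exact: rmean0.
have mk h p : smooth h -> vf (X k) (m h) p = 0.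
  by move=> sh; rewrite mE// /m (rmean_vf0 (lX k) c0 X3 p sh).
exists (m f), (m H); split; first by split; exact: sm.
- have sv := smooth_vf (lX i) sH.
  have h1 := rmean_inv (lX k) c0 X3 sg (Dg k Dk).
  apply: near0_imp2 h1 (mn _ _ E) => p <-; rewrite -/(m g) => ->.
  by rewrite mE// /m (rmeanD c (lX k) p c1 sf sv).
- move=> j Dj; have [->|jk] := eqVneq j k.
    by apply: near0_all => p; exact: mk.
  have ji : j != i by apply: contraNneq Di => <-.
  have Jj : (j != i) && (j != k) by rewrite ji.
  by apply: near0_imp (mn _ _ (Z j Jj (Dg j Dj))) => p; rewrite m0 -mE.
- move=> j u su h; have [->|jk] := eqVneq j k.
    by apply: near0_all => p; exact: mk.
  have [->|ji] := eqVneq j i.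
    apply: near0_all => p; rewrite mE//.
    by rewrite (_ : vf (X i) f = fun=> 0) ?m0//; exact/funext.
  have Jj : (j != i) && (j != k) by rewrite ji.
  by apply: near0_imp (mn _ _ (U j u Jj su h)) => p; rewrite m0 -mE.
Qed.

End families.

(** * Williamson's fields *)

Section germs.
Context {R : realType} {n : nat}.
Notation V := 'rV[R]_(n + n).
Implicit Types (f g : V -> R) (U : set V).

Transparent dd.

Lemma smooth_on_Ck U f k vs : smooth_on U f -> Ck U k (Defs.iterD vs f).
Proof.
move=> sf; elim: k vs => [|k IH] vs; first by split=> // p /(sf vs)[].
split=> [p /(sf vs)[]//|v]; split=> [p /(sf vs)[]//|].
exact: (IH (v :: vs)).
Qed.

Lemma smooth_smooth_germ f : smooth f -> smooth_germ f.
Proof.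
move=> sf; exists setT; split; [exact: openT|by []|move=> vs p _].
have sv : smooth (Defs.iterD vs f) by elim: vs => //= v vs; exact: smooth_D.
split=> [v|]; first exact: smooth_derivable.
have c := smooth_continuous sv; exact: c.
Qed.

Opaque dd.

(** The cutoff is supported where the Euclidean norm is at most [e / 2], hence inside [U]. The
    complement [W] of [q <= 1] is open and the product is 0 on it, so every point has a set on which
    smoothness is known. *)
Lemma smooth_germ_extend g : smooth_germ g ->
  exists2 h : V -> R, smooth h & \forall p \near (0 : V), g p = h p.
Proof.
move=> [U [oU U0 sg]].
have /nbhs_norm0P[e /= e0 eU] : nbhs (0 : V) U by exact: open_nbhs_nbhs.
pose kappa : R := (e / 2) ^+ 2.
have e2 : 0 < e / 2 by rewrite divr_gt0.
have k0 : 0 < kappa by rewrite exprn_gt0.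
pose q (p : V) : R := kappa^-1 * qf [set: 'I_(n + n)]%SET p.
have sq : smooth q by apply: smooth_mul; [exact: smooth_cst|exact: smooth_qf].
have cq : continuous q by exact: smooth_continuous.
pose W := [set p : V | 1 < q p].
have oW : open W by apply: (@open_comp _ _ q [set x | 1 < x]); [move=> p _; exact: cq|exact: open_gt].
exists (fun p => bumpf (q p) * g p).
  move=> k; apply: Ck_local => p _.
  have [qp|qp] := ltP 1 (q p).
    exists W => //; apply: (@Ck_eq _ _ W k (cst 0)) => //; last exact: Ck_cst.
    by move=> x; rewrite inE => /ltW x1; rewrite bump0 ?mul0r.
  exists U; last first.
    apply: CkM => //; last exact: (@smooth_on_Ck U g k [::]).
    by apply: (@Ck_sub _ _ setT) => //; exact: smooth_bump.
  apply: eU => /=; apply: (@le_lt_trans _ _ (e / 2)); last by rewrite ltr_pdivrMr// ltr_pMr// ltr1n.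
  apply: norm_row_le => [|i]; first exact: ltW.
  apply: abs_le_sqr; first exact: ltW.
  apply: le_trans (coord_qf _ (finset.in_setT i)) _.
  by move: qp; rewrite /q mulrC ler_pdivrMr// mul1r.
have := near_bump1 cq (p := 0); rewrite {1}/q qf_eq0 ?mulr0 ?invr_gt0//; last first.
  by move=> i _; rewrite mxE.
by move=> /(_ (ltr0Sn R 1)); apply: (@filterS _ (nbhs (0 : V))) => p ->; rewrite mul1r.
Qed.

End germs.

Section coordinates.
Context {R : realType} {n : nat}.
Notation V := 'rV[R]_(n + n).
Implicit Types (p q u v : V) (k a : nat).

Lemma xcE p (i : 'I_n) : xc p i = p 0 (lshift n i).
Proof. by rewrite /xc; case: insubP => [j _ /val_inj ->//|]; rewrite ltn_ord. Qed.

Lemma ycE p (i : 'I_n) : yc p i = p 0 (rshift n i).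
Proof. by rewrite /yc; case: insubP => [j _ /val_inj ->//|]; rewrite ltn_ord. Qed.

Lemma coordP p q : (forall k, xc p k = xc q k) -> (forall k, yc p k = yc q k) -> p = q.
Proof.
move=> hx hy; apply/rowP => k; case: (split_ordP k) => i ->.
  by rewrite -!xcE.
by rewrite -!ycE.
Qed.

Lemma xcL (a : R) u v k : xc (a *: u + v) k = a * xc u k + xc v k.
Proof. by rewrite /xc; case: insub => [i|]; rewrite ?mxE// mulr0 addr0. Qed.

Lemma ycL (a : R) u v k : yc (a *: u + v) k = a * yc u k + yc v k.
Proof. by rewrite /yc; case: insub => [i|]; rewrite ?mxE// mulr0 addr0. Qed.

Lemma xcZ (a : R) u k : xc (a *: u) k = a * xc u k.
Proof. by rewrite /xc; case: insub => [i|]; rewrite ?mxE// mulr0. Qed.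

Lemma ycZ (a : R) u k : yc (a *: u) k = a * yc u k.
Proof. by rewrite /yc; case: insub => [i|]; rewrite ?mxE// mulr0. Qed.

Lemma xcD u v k : xc (u + v) k = xc u k + xc v k.
Proof. by rewrite /xc; case: insub => [i|]; rewrite ?mxE// addr0. Qed.

Lemma ycD u v k : yc (u + v) k = yc u k + yc v k.
Proof. by rewrite /yc; case: insub => [i|]; rewrite ?mxE// addr0. Qed.

Lemma xcN u k : xc (- u) k = - xc u k.
Proof. by rewrite /xc; case: insub => [i|]; rewrite ?mxE// oppr0. Qed.

Lemma ycN u k : yc (- u) k = - yc u k.
Proof. by rewrite /yc; case: insub => [i|]; rewrite ?mxE// oppr0. Qed.

Lemma xc_ex a k : (a < n)%N -> xc (ex R n a) k = (k == a)%:R.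
Proof.
move=> an; rewrite /ex insubT /xc; case: (@insubP _ _ 'I_n k) => [i _ <-|].
  by rewrite mxE /= eq_lshift.
by rewrite -leqNgt => nk; rewrite gtn_eqF// (leq_trans an).
Qed.

Lemma yc_ey a k : (a < n)%N -> yc (ey R n a) k = (k == a)%:R.
Proof.
move=> an; rewrite /ey insubT /yc; case: (@insubP _ _ 'I_n k) => [i _ <-|].
  by rewrite mxE /= eq_rshift.
by rewrite -leqNgt => nk; rewrite gtn_eqF// (leq_trans an).
Qed.

Lemma yc_ex a k : yc (ex R n a) k = 0.
Proof.
rewrite /yc /ex; case: insubP => [i _ _|//]; case: insubP => [j _ _|_]; rewrite mxE//=.
by rewrite eq_rlshift.
Qed.

Lemma xc_ey a k : xc (ey R n a) k = 0.
Proof.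
rewrite /xc /ey; case: insubP => [i _ _|//]; case: insubP => [j _ _|_]; rewrite mxE//=.
by rewrite eq_lrshift.
Qed.

End coordinates.

Section fields.
Context {R : realType} {n : nat}.
Notation V := 'rV[R]_(n + n).
Variables ke kh kf : nat.
Hypothesis hr : (ke + kh + 2 * kf <= n)%N.
Implicit Types (p q u v : V) (i j k : nat) (S : pred nat).
Let b := (ke + kh)%N.
Let r := (ke + kh + 2 * kf)%N.
Let X i : V -> V := Xfield ke kh kf i.

Lemma Xfield_linear i : linear (X i).
Proof.
move=> a u v; rewrite /X /Xfield; rewrite !(xcL, ycL).
by case: ifP => _; [|case: ifP => _; [|case: ifP => _]];
  apply/rowP => k; rewrite !mxE; ring.
Qed.

Variant kind_spec i : Type :=
| KindElliptic of (i < ke)%N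
| KindHyperbolic of (ke <= i)%N & (i < b)%N
| KindFocusFirst m of (m < kf)%N & i = (b + m.*2)%N
| KindFocusSecond m of (m < kf)%N & i = (b + m.*2.+1)%N.

Lemma kindP i : (i < r)%N -> kind_spec i.
Proof.
move=> ir; case: (ltnP i ke) => [|ki]; first exact: KindElliptic.
case: (ltnP i b) => [|bi]; first exact: KindHyperbolic.
have E := odd_double_half (i - b).
have m1 : ((i - b)./2 < kf)%N by move: ir; rewrite /r -/b; lia.
case: (odd (i - b)) E => E.
  by apply: (@KindFocusSecond _ (i - b)./2) => //; lia.
by apply: (@KindFocusFirst _ (i - b)./2) => //; lia.
Qed.

Lemma elliptic_coord i p k : (i < ke)%N ->
  xc (X i p) k = (k == i)%:R * (- 2 * yc p i) /\ yc (X i p) k = (k == i)%:R * (2 * xc p i).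
Proof.
move=> ik; have i_n : (i < n)%N by lia.
rewrite /X /Xfield ik !(xcZ, ycZ, xcD, ycD) !(xc_ey, yc_ex) xc_ex// yc_ey//.
by split; ring.
Qed.

Lemma hyperbolic_coord i p k : (ke <= i)%N -> (i < b)%N ->
  xc (X i p) k = (k == i)%:R * - xc p i /\ yc (X i p) k = (k == i)%:R * yc p i.
Proof.
move=> ki ib; have i_n : (i < n)%N by lia.
rewrite /X /Xfield ltnNge ki /= ib !(xcZ, ycZ, xcD, ycD) !(xc_ey, yc_ex) xc_ex// yc_ey//.
by split; ring.
Qed.

Lemma focus0_coord m p k : (m < kf)%N -> let a := (b + m.*2)%N in
  xc (X a p) k = (k == a)%:R * - xc p a + (k == a.+1)%:R * - xc p a.+1 /\
  yc (X a p) k = (k == a)%:R * yc p a + (k == a.+1)%:R * yc p a.+1.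
Proof.
move=> mk a; have a_n : (a.+1 < n)%N by rewrite /a /b; lia.
have a_n' := ltnW a_n.
have h1 : (a < ke)%N = false by rewrite /a /b; lia.
have h2 : (a < ke + kh)%N = false by rewrite /a /b; lia.
have h3 : odd (a - (ke + kh)) = false by rewrite /a /b addKn odd_double.
rewrite /X /Xfield h1 h2 h3 /= !(xcZ, ycZ, xcD, ycD) !(xc_ey, yc_ex) !xc_ex// !yc_ey//.
by split; ring.
Qed.

Lemma focus1_coord m p k : (m < kf)%N -> let a := (b + m.*2)%N in
  xc (X a.+1 p) k = (k == a)%:R * xc p a.+1 - (k == a.+1)%:R * xc p a /\
  yc (X a.+1 p) k = (k == a)%:R * yc p a.+1 - (k == a.+1)%:R * yc p a.
Proof.
move=> mk a; have a_n : (a.+1 < n)%N by rewrite /a /b; lia.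
have a_n' := ltnW a_n.
have h1 : (a.+1 < ke)%N = false by rewrite /a /b; lia.
have h2 : (a.+1 < ke + kh)%N = false by rewrite /a /b; lia.
have h3 : odd (a.+1 - (ke + kh)) = true.
  by rewrite /a /b -addnS addKn /= odd_double.
rewrite /X /Xfield h1 h2 h3 /= !(xcZ, ycZ, xcD, ycD, xcN, ycN) !(xc_ey, yc_ex) !xc_ex// !yc_ey//.
by split; ring.
Qed.

(* [site i k]: the pair [(x_k, y_k)] of coordinates is involved in [X i]. *)
Definition site i k : bool :=
  if (i < b)%N then k == i else ((b + (i - b)./2.*2)%N <= k < (b + (i - b)./2.*2).+2)%N.

Lemma site_focus m : site (b + m.*2) =1 (fun k => (b + m.*2 <= k < (b + m.*2).+2)%N) /\
  site (b + m.*2.+1) =1 (fun k => (b + m.*2 <= k < (b + m.*2).+2)%N).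
Proof.
split=> k; rewrite /site ltnNge leq_addr /= addKn.
  by rewrite doubleK.
by rewrite (half_bit_double m true).
Qed.

Lemma site_simple i : (i < b)%N -> site i =1 pred1 i.
Proof. by move=> ib k; rewrite /site ib. Qed.

Lemma field_local i p k : (i < r)%N -> ~~ site i k -> xc (X i p) k = 0 /\ yc (X i p) k = 0.
Proof.
move=> ir; case: (kindP ir) => [ik|ki ib|m mk ->|m mk ->].
- rewrite site_simple ?ltn_addr//= => /negbTE nk.
  by rewrite !(elliptic_coord _ _ ik).1 !(elliptic_coord _ _ ik).2 nk !mul0r.
- rewrite site_simple//= => /negbTE nk.
  by rewrite !(hyperbolic_coord _ _ ki ib).1 !(hyperbolic_coord _ _ ki ib).2 nk !mul0r.
- rewrite (site_focus m).1 => nk.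
  rewrite (focus0_coord _ _ mk).1 (focus0_coord _ _ mk).2.
  have -> : (k == (b + m.*2)%N) = false by lia.
  have -> : (k == (b + m.*2).+1)%N = false by lia.
  by rewrite !mul0r addr0.
- rewrite (site_focus m).2 addnS => nk.
  rewrite (focus1_coord _ _ mk).1 (focus1_coord _ _ mk).2.
  have -> : (k == (b + m.*2)%N) = false by lia.
  have -> : (k == (b + m.*2).+1)%N = false by lia.
  by rewrite !mul0r subr0.
Qed.

Lemma field_vanish i p : (i < r)%N -> (forall k, site i k -> xc p k = 0 /\ yc p k = 0) -> X i p = 0.
Proof.
move=> ir p0.
have x0 k : xc (0 : V) k = 0 by rewrite /xc; case: insub => // j; rewrite mxE.
have y0 k : yc (0 : V) k = 0 by rewrite /yc; case: insub => // j; rewrite mxE.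
case: (kindP ir) p0 => [ik|ki ib|m mk ->|m mk ->] p0.
- have [|px py] := p0 i; first by rewrite (site_simple (ltn_addr _ ik)) /=.
  apply: coordP => k; rewrite ?x0 ?y0 ?(elliptic_coord _ _ ik).1 ?(elliptic_coord _ _ ik).2 ?px ?py;
  by rewrite !mulr0.
- have [|px py] := p0 i; first by rewrite (site_simple ib) /=.
  apply: coordP => k; rewrite ?x0 ?y0 ?(hyperbolic_coord _ _ ki ib).1 ?(hyperbolic_coord _ _ ki ib).2 ?px ?py;
  by rewrite ?oppr0 !mulr0.
- have [|px py] := p0 (b + m.*2)%N; first by rewrite (site_focus m).1; lia.
  have [|px' py'] := p0 (b + m.*2).+1; first by rewrite (site_focus m).1; lia.
  apply: coordP => k; rewrite ?x0 ?y0 ?(focus0_coord _ _ mk).1 ?(focus0_coord _ _ mk).2 ?px ?py ?px' ?py';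
  by rewrite ?oppr0 !mulr0 addr0.
- have [|px py] := p0 (b + m.*2)%N; first by rewrite (site_focus m).2; lia.
  have [|px' py'] := p0 (b + m.*2).+1; first by rewrite (site_focus m).2; lia.
  rewrite addnS.
  apply: coordP => k; rewrite ?x0 ?y0 ?(focus1_coord _ _ mk).1 ?(focus1_coord _ _ mk).2 ?px ?py ?px' ?py';
  by rewrite !mulr0 subrr.
Qed.

(** Distinct fields share coordinates only inside a focus-focus pair, so [field_comm] reduces to the
    single computation [focus_comm]. *)
Lemma site_cases i j : (i < r)%N -> (j < r)%N ->
  [\/ (forall k, site i k -> ~~ site j k), i = j |
    exists2 m, (m < kf)%N & (i = b + m.*2 /\ j = (b + m.*2).+1 \/ j = b + m.*2 /\ i = (b + m.*2).+1)%N].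
Proof.
move=> ir jr; case: (ltnP i b) => ib; case: (ltnP j b) => jb.
- have [->|ij] := eqVneq i j; first by constructor 2.
  constructor 1 => k; rewrite (site_simple ib) (site_simple jb) /= => /eqP ->; exact: ij.
- by constructor 1 => k; rewrite (site_simple ib) /site ltnNge jb /= => /eqP ->; lia.
- by constructor 1 => k; rewrite (site_simple jb) /site ltnNge ib /=; lia.
- have [ij|ij] := eqVneq (i - b)./2 (j - b)./2; last first.
    by constructor 1 => k; rewrite /site !ltnNge ib jb /=; lia.
  have [//|bi ib'|m mk Ei|m mk Ei] := kindP ir; try lia;
  have [//|bj jb'|m' mk' Ej|m' mk' Ej] := kindP jr; try lia.
  + by constructor 2; lia.
  + by constructor 3; exists m => //; left; lia.
  + by constructor 3; exists m => //; right; lia.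
  + by constructor 2; lia.
Qed.

Lemma focus_comm m q : (m < kf)%N -> X (b + m.*2) (X (b + m.*2).+1 q) = X (b + m.*2).+1 (X (b + m.*2) q).
Proof.
move=> mk; set a := (b + m.*2)%N.
have e1 : (a == a.+1) = false by lia.
have e2 : (a.+1 == a) = false by lia.
have X0 p k : xc (X a p) k = _ := (focus0_coord p k mk).1.
have Y0 p k : yc (X a p) k = _ := (focus0_coord p k mk).2.
have X1 p k : xc (X a.+1 p) k = _ := (focus1_coord p k mk).1.
have Y1 p k : yc (X a.+1 p) k = _ := (focus1_coord p k mk).2.
by apply: coordP => k; rewrite !(X0, Y0, X1, Y1) -/a !eqxx e1 e2 /=; ring.
Qed.

Lemma field_disjoint i j q : (i < r)%N -> (j < r)%N -> (forall k, site i k -> ~~ site j k) ->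
  X i (X j q) = 0.
Proof. by move=> ir jr ij; apply: field_vanish => // k /ij; exact: field_local. Qed.

Lemma field_comm i j q : (i < r)%N -> (j < r)%N -> X i (X j q) = X j (X i q).
Proof.
move=> ir jr; case: (site_cases ir jr) => [ij|->//|[m mk [[-> ->]|[-> ->]]]]; last 2 first.
- exact: focus_comm.
- by rewrite -focus_comm.
rewrite (field_disjoint _ ir jr ij) (field_disjoint _ jr ir)// => k jk.
by apply/negP => /ij; rewrite jk.
Qed.

Definition rotating i := (i < ke)%N || ((b <= i)%N && odd (i - b)).

(** On its own plane an elliptic field is twice a quarter turn, so [c = 2]; the second field of a
    pair squares to -1 on its four coordinates, so [c = 1]. The cubic form of the identity
    accommodates the remaining coordinates, where the fields vanish. *)
Lemma rotating_cube i : (i < r)%N -> rotating i ->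
  exists2 c : R, 0 < c & forall p, X i (X i (X i p)) = - (c ^+ 2) *: X i p.
Proof.
move=> ir; case: (kindP ir) => [ik|ki ib|m mk ->|m mk ->]; rewrite /rotating.
- move=> _; exists 2 => // p.
  have Xi q k : xc (X i q) k = _ := (elliptic_coord q k ik).1.
  have Yi q k : yc (X i q) k = _ := (elliptic_coord q k ik).2.
  by apply: coordP => k; rewrite ?xcZ ?ycZ !(Xi, Yi) !eqxx /=; ring.
- by rewrite ltnNge ki leqNgt ib.
- by rewrite addKn odd_double andbF orbF ltnNge (leq_trans (leq_addr kh ke)) ?leq_addr.
- move=> _; exists 1 => // p; rewrite addnS.
  set a := (b + m.*2)%N.
  have e1 : (a == a.+1) = false by lia.
  have e2 : (a.+1 == a) = false by lia.
  have X1 q k : xc (X a.+1 q) k = _ := (focus1_coord q k mk).1.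
  have Y1 q k : yc (X a.+1 q) k = _ := (focus1_coord q k mk).2.
  by apply: coordP => k; rewrite ?xcZ ?ycZ !(X1, Y1) -/a !eqxx e1 e2 /=; ring.
Qed.

Definition xset S : {set 'I_(n + n)} := [set k : 'I_(n + n) | (k < n)%N && S k].
Definition yset S : {set 'I_(n + n)} := [set k : 'I_(n + n) | (n <= k)%N && S (k - n)%N].

Lemma mem_xset S (i : 'I_n) : (lshift n i \in xset S) = S i.
Proof. by rewrite inE /= ltn_ord. Qed.

Lemma mem_xset_r S (i : 'I_n) : (rshift n i \in xset S) = false.
Proof. by rewrite inE /= ltnNge leq_addr. Qed.

Lemma mem_yset S (i : 'I_n) : (rshift n i \in yset S) = S i.
Proof. by rewrite inE /= leq_addr addKn. Qed.

Lemma mem_yset_l S (i : 'I_n) : (lshift n i \in yset S) = false.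
Proof. by rewrite inE /= leqNgt ltn_ord. Qed.

Lemma xy_disj S : disj (xset S) (yset S).
Proof. by move=> k; rewrite !inE => /andP[kn _]; rewrite leqNgt kn. Qed.

Lemma hyp_xy S p k : xc (hyp (xset S) (yset S) p) k = (S k)%:R * - xc p k /\
  yc (hyp (xset S) (yset S) p) k = (S k)%:R * yc p k.
Proof.
have [kn|kn] := ltnP k n; last first.
  by rewrite /xc /yc insubF ?oppr0 ?mulr0// ltnNge kn.
have -> : k = Ordinal kn by [].
set j := Ordinal kn.
rewrite /hyp !(xcD, ycD, xcN, ycN) !xcE !ycE ![eul _ _ _ _]mxE mem_xset mem_xset_r mem_yset mem_yset_l.
by case: (S j) => /=; split; ring.
Qed.

Lemma lshift_ex (i : 'I_n) : delta_mx 0 (lshift n i) = ex R n i.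
Proof. by rewrite /ex; case: insubP => [j _ /val_inj ->//|]; rewrite ltn_ord. Qed.

Lemma rshift_ey (i : 'I_n) : delta_mx 0 (rshift n i) = ey R n i.
Proof. by rewrite /ey; case: insubP => [j _ /val_inj ->//|]; rewrite ltn_ord. Qed.

Lemma off_field S j : (j < r)%N -> (forall k, S k -> ~~ site j k) ->
  off (xset S) (X j) /\ off (yset S) (X j).
Proof.
move=> jr Sj; split; split.
- move=> p k; case: (split_ordP k) => i ->; rewrite ?mem_xset_r// mem_xset => /Sj h.
  by rewrite -xcE (field_local p jr h).1.
- move=> k; case: (split_ordP k) => i ->; rewrite ?mem_xset_r// mem_xset => /Sj h.
  apply: field_vanish => // k' jk'; rewrite lshift_ex xc_ex// yc_ex; split=> //.
  by case: eqVneq => // E; rewrite -E jk' in h.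
- move=> p k; case: (split_ordP k) => i ->; rewrite ?mem_yset_l// mem_yset => /Sj h.
  by rewrite -ycE (field_local p jr h).2.
- move=> k; case: (split_ordP k) => i ->; rewrite ?mem_yset_l// mem_yset => /Sj h.
  apply: field_vanish => // k' jk'; rewrite rshift_ey yc_ey// xc_ey; split=> //.
  by case: eqVneq => // E; rewrite -E jk' in h.
Qed.

Lemma hyperbolic_hyp i : (ke <= i)%N -> (i < b)%N -> X i = hyp (xset (site i)) (yset (site i)).
Proof.
move=> ki ib; apply/funext => p; apply: coordP => k.
  rewrite (hyp_xy _ p k).1 (hyperbolic_coord _ _ ki ib).1 (site_simple ib) /=.
  by case: eqVneq => [->|_]; rewrite ?mul0r.
rewrite (hyp_xy _ p k).2 (hyperbolic_coord _ _ ki ib).2 (site_simple ib) /=.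
by case: eqVneq => [->|_]; rewrite ?mul0r.
Qed.

Lemma focus_hyp m : (m < kf)%N ->
  X (b + m.*2)%N = hyp (xset (site (b + m.*2))) (yset (site (b + m.*2))).
Proof.
move=> mk; set a := (b + m.*2)%N.
have E k : site a k = (k == a) || (k == a.+1) by rewrite (site_focus m).1; lia.
have e1 : (a == a.+1) = false by lia.
apply/funext => p; apply: coordP => k.
  rewrite (hyp_xy _ p k).1 (focus0_coord _ _ mk).1 E -/a.
  case: (eqVneq k a) => [->|_]; first by rewrite e1 /=; ring.
  by case: (eqVneq k a.+1) => [->|_] /=; ring.
rewrite (hyp_xy _ p k).2 (focus0_coord _ _ mk).2 E -/a.
case: (eqVneq k a) => [->|_]; first by rewrite e1 /=; ring.
by case: (eqVneq k a.+1) => [->|_] /=; ring.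
Qed.

Notation Xr := (fun i : 'I_r => X i).

(** The condition that all rotating indices lie in [D] supplies the partner required by
    [splittable_pair] for the first field of a focus-focus pair. *)
Lemma splittable_field (D : pred 'I_r) (i : 'I_r) :
  (rotating i \/ ~~ D i /\ forall k : 'I_r, rotating k -> D k) -> splittable Xr D i.
Proof.
have lX (j : 'I_r) : linear (Xr j) by exact: Xfield_linear.
have cX (i1 j : 'I_r) q : Xr i1 (Xr j q) = Xr j (Xr i1 q) by apply: field_comm; exact: ltn_ord.
have [roti|nroti] := boolP (rotating i).
  move=> _; have [c c0 c3] := rotating_cube (ltn_ord i) roti.
  exact: (splittable_rot lX cX c0).
case=> // -[Di rD].
have disj_i (j : 'I_r) : j != i -> (forall m, (m < kf)%N ->
    ~ (i = (b + m.*2)%N :> nat /\ j = (b + m.*2).+1 :> nat \/ j = (b + m.*2)%N :> nat /\ i = (b + m.*2).+1 :> nat)) ->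
    forall k, site i k -> ~~ site j k.
  move=> ji nm; case: (site_cases (ltn_ord i) (ltn_ord j)) => [//|ij|[m mk H]].
    by move: ji; rewrite -(inj_eq val_inj) /= ij eqxx.
  by case: (nm m mk H).
case: (kindP (ltn_ord i)) => [ik|ki ib|m mk Ei|m mk Ei].
- by move: nroti; rewrite /rotating ik.
- have oX (j : 'I_r) : j != i -> off (xset (site i)) (Xr j) /\ off (yset (site i)) (Xr j).
    by move=> ji; apply: off_field => //; apply: disj_i => // m mk; rewrite /b; lia.
  exact (@splittable_hyp _ _ _ Xr lX _ _ D i (@xy_disj (site i)) (hyperbolic_hyp ki ib) Di oX).
- have kr : ((b + m.*2).+1 < r)%N by rewrite /r -/b; lia.
  pose k := Ordinal kr.
  have rk : rotating k by rewrite /rotating /= -addnS leq_addr addKn /= odd_double orbT.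
  have [c c0 c3] := rotating_cube kr rk.
  have Xi : Xr i = hyp (xset (site i)) (yset (site i)) by rewrite /= Ei; exact: focus_hyp.
  have oX (j : 'I_r) : j != i -> j != k ->
      off (xset (site i)) (Xr j) /\ off (yset (site i)) (Xr j).
    move=> ji jk; apply: off_field => //; apply: disj_i => // m' mk'.
    by move: jk; rewrite -(inj_eq val_inj) /=; lia.
  exact (@splittable_pair _ _ _ Xr lX cX _ _ D i k c (@xy_disj (site i)) Xi Di (rD k rk) c0 c3 oX).
- by move: nroti; rewrite /rotating Ei leq_addr addKn /= odd_double orbT.
Qed.

Lemma mem_prefix (T : eqType) (s1 s2 l1 l2 : seq T) (x : T) :
  s1 ++ s2 = l1 ++ x :: l2 -> x \notin s1 -> {subset s1 <= l1}.
Proof.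
elim: s1 l1 => [//|y s1 IH] [|z l1] /= [E1].
  by rewrite -E1 inE eqxx.
move=> E2; rewrite inE negb_or => /andP[_ xs] u; rewrite !inE E1 => /orP[->//|us].
by rewrite (IH l1 E2 xs _ us) orbT.
Qed.

Lemma field_decomposition (g : 'I_r -> V -> R) : (forall i : 'I_r, smooth (g i)) ->
  (forall i j : 'I_r, near0 (fun p => vf (X i) (g j) p = vf (X j) (g i) p)) ->
  exists G, exists2 f : 'I_r -> V -> R, smooth G & forall i : 'I_r,
    [/\ smooth (f i), near0 (fun p => g i p = f i p + vf (X i) G p) &
      forall j : 'I_r, near0 (fun p => vf (X j) (f i) p = 0)].
Proof.
move=> sg cg.
have lX (j : 'I_r) : linear (Xr j) by exact: Xfield_linear.
have cX (i1 j : 'I_r) q : Xr i1 (Xr j q) = Xr j (Xr i1 q) by apply: field_comm; exact: ltn_ord.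
(* Rotating indices precede all others, so by [mem_prefix] every prefix ending before a non-rotating
   index contains all of them; uniqueness keeps that index out of its own prefix. *)
pose s1 := [seq i : 'I_r <- enum 'I_r | rotating i]; pose s2 := [seq i : 'I_r <- enum 'I_r | ~~ rotating i].
have us : uniq (s1 ++ s2).
  rewrite cat_uniq; apply/and3P; split; try by apply: filter_uniq; exact: enum_uniq.
  apply/hasPn => i.
  by rewrite !mem_filter => /andP[/negbTE ->].
have [||//|G [f sG H]] := @solve_family _ _ _ Xr lX cX (s1 ++ s2) g.
- move=> l1 i l2 E; apply: splittable_field.
  have [|ni] := boolP (rotating i); first by left.
  right; split.
    by move: us; rewrite E cat_uniq /= negb_or => /and3P[_ /andP[]].
  move=> k rk; apply: (mem_prefix E); first by rewrite mem_filter (negbTE ni).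
  by rewrite mem_filter rk mem_enum.
- by [].
exists G, f => // i; apply: H.
have ie : i \in enum 'I_r by rewrite mem_enum.
rewrite mem_cat; apply/orP; have [ri|ri] := boolP (rotating i); [left|right];
  by rewrite mem_filter ri ie.
Qed.

End fields.

Transparent dd.
Unset Implicit Arguments.

Theorem theorem2p2 (R : realType) (n ke kh kf : nat)
  (hn : (1 <= n)%N) (hr : (ke + kh + 2 * kf <= n)%N)
  (g : 'I_(ke + kh + 2 * kf) -> 'rV[R]_(n + n) -> R) :
  (forall i, smooth_germ (g i)) ->
  (forall i j : 'I_(ke + kh + 2 * kf), \forall p \near (0 : 'rV[R]_(n + n)),
      vfapp (Xfield ke kh kf i) (g j) p = vfapp (Xfield ke kh kf j) (g i) p) ->
  exists (G : 'rV[R]_(n + n) -> R) (f : 'I_(ke + kh + 2 * kf) -> 'rV[R]_(n + n) -> R),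
    [/\ smooth_germ G,
        (forall i, smooth_germ (f i)),
        (forall i j : 'I_(ke + kh + 2 * kf), \forall p \near (0 : 'rV[R]_(n + n)),
            vfapp (Xfield ke kh kf j) (f i) p = 0) &
        (forall i : 'I_(ke + kh + 2 * kf), \forall p \near (0 : 'rV[R]_(n + n)),
            g i p = f i p + vfapp (Xfield ke kh kf i) G p)].
Proof.
move=> sg cg.
have /choice[h Hh] : forall i, exists h, smooth h /\ \forall p \near (0 : 'rV[R]_(n + n)), g i p = h p.
  by move=> i; have [h ? ?] := smooth_germ_extend (sg i); exists h.
(* Near 0 the derivatives along the fields depend only on the germs, so compatibility passes from
   [g] to the global representatives [h]. *)
have ch (i j : 'I_(ke + kh + 2 * kf)) : near0 (fun p => vf (Xfield ke kh kf i) (h j) p = vf (Xfield ke kh kf j) (h i) p).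
  have E1 := near0_vf (Xfield ke kh kf i) (Hh j).2.
  have E2 := near0_vf (Xfield ke kh kf j) (Hh i).2.
  apply: near0_imp2 (near0_imp2 (fun p a b => etrans (esym a) b) E1 (cg i j)) E2.
  by move=> p; exact: etrans.
have [G [f sG H]] := field_decomposition hr (fun i => (Hh i).1) ch.
exists G, f; split.
- exact: smooth_smooth_germ.
- by move=> i; apply: smooth_smooth_germ; case: (H i).
- by move=> i j; case: (H i) => _ _; exact.
- move=> i; have [_ E _] := H i.
  by apply: near0_imp2 (Hh i).2 E => p ->.
Qed.
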